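(* Let $\Phi,\lambda,f,\mathcal D,F,\Phi^{(1)},\Phi^{(2)}$ be as in the context, and let $Z,\tilde Z$ be independent with density $f$. For Borel $A\subset\mathbb{R}^2$ let $M^{(i)}(A)=\mathbb E\big[\sum_{a\in\Phi^{(i)}}\mathbf 1_{\{\hat a\in A\}}\big]$, $i=1,2$, and let $\mathcal S(A)$ be the Lebesgue measure of $A$. Define $$P_{\mathcal D}(\lambda,f)=2\pi\lambda\int_0^\infty\mathbb E\Big[e^{-\lambda F(s,Z,\tilde Z)}\mathbf 1_{\{(Z,\tilde Z)\in\mathcal D\}}\Big]s\,ds.$$ Then $P_{\mathcal D}(\lambda,f)\in[0,1]$ and for every Borel $A\subset\mathbb{R}^2$, $$M^{(2)}(A)=P_{\mathcal D}(\lambda,f)\,\lambda\,\mathcal S(A),\qquad M^{(1)}(A)=\big(1-P_{\mathcal D}(\lambda,f)\big)\lambda\,\mathcal S(A).$$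
   Context: $\mathbb{H}^3=\{(x,y,z):z>0\}$; for $a=(x,y,z)$, $\hat a=(x,y)$. $d_{\mathbb{H}^3}(a,b)=\operatorname{acosh}\big(\frac{|\hat a-\hat b|^2}{2z\tilde z}+\frac12(\frac{z}{\tilde z}+\frac{\tilde z}{z})\big)$ for marks $z,\tilde z$. $\Phi$ is a Poisson point process on $\mathbb{R}^2\times(0,\infty)$ with intensity $\lambda\,dx\,dy\,f(z)dz$, $\lambda>0$, $f$ a probability density on $(0,\infty)$. $\mathcal D\subset(0,\infty)^2$ is Borel and symmetric. $a\xrightarrow{\phi}b$: $b$ is the unique minimizer of $d_{\mathbb{H}^3}(a,\cdot)$ on $\phi\setminus\{a\}$. $a\overset{\phi,\mathcal D}{\leftrightarrow}b$: $a\xrightarrow{\phi}b$, $b\xrightarrow{\phi}a$, and marks $(z,\tilde z)\in\mathcal D$. $\Phi^{(2)}=\{a\in\Phi:\exists b\in\Phi\setminus\{a\},a\overset{\Phi,\mathcal D}{\leftrightarrow}b\}$, $\Phi^{(1)}=\Phi\setminus\Phi^{(2)}$. $F(s,z,\tilde z)$: with $R=\operatorname{acosh}\big(\frac{s^2}{2z\tilde z}+\frac12(\frac{z}{\tilde z}+\frac{\tilde z}{z})\big)$, $d=\sqrt{s^2+(z-\tilde z)^2\cosh^2R}$, $r=z\sinh R$, $\tilde r=\tilde z\sinh R$, $c=z\cosh R$, $\tilde c=\tilde z\cosh R$, $h=\frac{(\tilde r-r+d)(r+\tilde r-d)}{2d}$, $\tilde h=\frac{(r-\tilde r+d)(r+\tilde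 r-d)}{2d}$, $\delta=\frac\pi2-\arcsin\frac{\tilde c-c}{d}$, $\tilde\delta=\frac\pi2-\arcsin\frac{c-\tilde c}{d}$, $F(s,z,\tilde z)=\pi\int_{-r}^{r}f(w+c)(r^2-w^2)dw+\pi\int_{-\tilde r}^{\tilde r}f(w+\tilde c)(\tilde r^2-w^2)dw-\int_{r-h}^{r}\int_0^{2\pi}\int_0^{\sqrt{r^2-w^2}}f(c+w\cos\delta-\rho\cos\theta\sin\delta)\rho\,d\rho\,d\theta\,dw-\int_{\tilde r-\tilde h}^{\tilde r}\int_0^{2\pi}\int_0^{\sqrt{\tilde r^2-w^2}}f(\tilde c+w\cos\tilde\delta-\rho\cos\theta\sin\tilde\delta)\rho\,d\rho\,d\theta\,dw$. *)

(* Defs.v *)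
From HB Require Import structures.
From mathcomp Require Import all_boot all_order all_algebra.
From mathcomp Require Import all_classical all_reals all_analysis.
From mathcomp Require Import measurable_realfun lebesgue_measure lebesgue_integral.
Set Implicit Arguments.
Unset Strict Implicit.
Unset Printing Implicit Defensive.
Import Order.TTheory GRing.Theory Num.Theory.
Import numFieldNormedType.Exports.
Local Open Scope classical_set_scope.
Local Open Scope ring_scope.

Section Hyperbolic.
Variable R : realType.

(* points of R^2 x (0,oo) are represented as ((x, y), z) ; hat a = a.1, mark z = a.2 *)
Definition pt := ((R * R) * R)%type.

Definition coshR (x : R) : R := (expR x + expR (- x)) / 2.
Definition sinhR (x : R) : R := (expR x - expR (- x)) / 2.
Definition acoshR (x : R) : R := ln (x + Num.sqrt (x ^+ 2 - 1)).

Definition sqdist2 (u v : R * R) : R := (u.1 - v.1) ^+ 2 + (u.2 - v.2) ^+ 2.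

(* hyperbolic distance in the upper half space H^3 *)
Definition dH3 (a b : pt) : R :=
  acoshR (sqdist2 a.1 b.1 / (2 * a.2 * b.2) + (a.2 / b.2 + b.2 / a.2) / 2).

Definition nn_to (phi : set pt) (a b : pt) : Prop :=
  phi b /\ b <> a /\ forall c, phi c -> c <> a -> c <> b -> dH3 a b < dH3 a c.

Definition mutual_nn (D : set (R * R)) (phi : set pt) (a b : pt) : Prop :=
  nn_to phi a b /\ nn_to phi b a /\ D (a.2, b.2).

Definition Phi2 (D : set (R * R)) (phi : set pt) : set pt :=
  [set a | phi a /\ exists b, phi b /\ b <> a /\ mutual_nn D phi a b].

Definition Phi1 (D : set (R * R)) (phi : set pt) : set pt :=
  phi `\` Phi2 D phi.

Definition fext (f : R -> R) (z : R) : R := if 0 < z then f z else 0.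

Definition pos : set R := [set x | 0 < x].

Definition leb := (@lebesgue_measure R).

Definition Rint (a b : R) (g : R -> R) : R := Rintegral leb `[a, b] g.

Definition Ffun (f : R -> R) (s z zt : R) : R :=
  let RR := acoshR (s ^+ 2 / (2 * z * zt) + (z / zt + zt / z) / 2) in
  let d := Num.sqrt (s ^+ 2 + (z - zt) ^+ 2 * (coshR RR) ^+ 2) in
  let r := z * sinhR RR in
  let rt := zt * sinhR RR in
  let c := z * coshR RR in
  let ct := zt * coshR RR in
  let h := (rt - r + d) * (r + rt - d) / (2 * d) in
  let ht := (r - rt + d) * (r + rt - d) / (2 * d) in
  let delta := pi / 2 - asin ((ct - c) / d) in
  let deltat := pi / 2 - asin ((c - ct) / d) in
  pi * Rint (- r) r (fun w => fext f (w + c) * (r ^+ 2 - w ^+ 2))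
  + pi * Rint (- rt) rt (fun w => fext f (w + ct) * (rt ^+ 2 - w ^+ 2))
  - Rint (r - h) r (fun w => Rint 0 (2 * pi) (fun th =>
      Rint 0 (Num.sqrt (r ^+ 2 - w ^+ 2)) (fun rho =>
        fext f (c + w * cos delta - rho * cos th * sin delta) * rho)))
  - Rint (rt - ht) rt (fun w => Rint 0 (2 * pi) (fun th =>
      Rint 0 (Num.sqrt (rt ^+ 2 - w ^+ 2)) (fun rho =>
        fext f (ct + w * cos deltat - rho * cos th * sin deltat) * rho))).

(* P_D(lambda, f) = 2 pi lambda int_0^oo E[exp(-lambda F(s,Z,Zt)) 1_D(Z,Zt)] s ds,
   with Z, Zt independent with density f, so that the expectation is the
   integral against f(z) f(zt) dz dzt over (0,oo)^2 *)
Definition PD (D : set (R * R)) (lam : R) (f : R -> R) : \bar R :=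
  ((2 * pi * lam)%:E *
   \int[leb]_(s in pos)
     ((\int[leb]_(z in pos) \int[leb]_(zt in pos)
         (expR (- lam * Ffun f s z zt) * \1_D (z, zt) * f z * f zt)%:E)
      * s%:E))%E.

Definition leb2 := (leb \x leb)%E.

Definition intensity (lam : R) (f : R -> R) (B : set pt) : \bar R :=
  (lam%:E * \int[leb2 \x leb]_(p in B) (fext f p.2)%:E)%E.

Definition count (phi : set pt) (B : set pt) : \bar R :=
  (\esum_(x in phi `&` B) 1)%E.

Definition poisson_pmf (m : R) (k : nat) : R := expR (- m) * m ^+ k / (k`!)%:R.

Definition is_poisson_pp (d : measure_display) (Omega : measurableType d)
  (P : probability Omega R) (Phi : Omega -> set pt)
  (Lam : set pt -> \bar R) : Prop :=
  [/\ (forall B, measurable B -> measurable_fun [set: Omega] (fun w : Omega => (count (Phi w) B : \bar R))),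
      (forall B, measurable B -> (Lam B < +oo)%E -> forall k : nat,
          P [set w | count (Phi w) B = k%:R%:E] = (poisson_pmf (fine (Lam B)) k)%:E),
      (forall B, measurable B -> Lam B = +oo%E ->
          P [set w | count (Phi w) B = +oo%E] = 1%E) &
      (forall (n : nat) (B : 'I_n -> set pt) (k : 'I_n -> \bar R),
          (forall i, measurable (B i)) ->
          (forall i j, i != j -> B i `&` B j = set0) ->
          P (\bigcap_(i in [set: 'I_n]) [set w | count (Phi w) (B i) = k i]) =
          (\big[*%E/1%E]_(i < n) P [set w | count (Phi w) (B i) = k i])%E)].

Definition M2 (d : measure_display) (Omega : measurableType d)
  (P : probability Omega R) (Phi : Omega -> set pt) (D : set (R * R))
  (A : set (R * R)) : \bar R :=
  (\int[P]_w count (Phi2 D (Phi w)) [set a | A a.1])%E.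

Definition M1 (d : measure_display) (Omega : measurableType d)
  (P : probability Omega R) (Phi : Omega -> set pt) (D : set (R * R))
  (A : set (R * R)) : \bar R :=
  (\int[P]_w count (Phi1 D (Phi w)) [set a | A a.1])%E.

End Hyperbolic.

(* Main.v *)
(** Two points [a], [b] of a configuration are mutually nearest iff no other point lies in
    the union of the two closed hyperbolic balls centred at [a] and [b] of radius
    [dH3 a b].  These are Euclidean balls of radii [z sinh R] and [zt sinh R]; removing from
    their total weight the two spherical caps cut out by the radical plane shows that the
    union has intensity [lam * F (|a - b|, z, zt)].  Since each point has at most one mutual
    nearest neighbour, [M2 A] is the expected number of mutually nearest ordered pairs
    [(a, b)] with [a] above [A] and marks in [D], which the two-point Mecke formula turns
    into the double integral of [exp (- lam F)] against the intensity; translation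
    invariance and polar coordinates give [PD * lam * area A].

    The Mecke formula comes from a discretisation.  For cells [Q i], [Q j] of a fine grid, the
    event "exactly one point in each of [Q i] and [Q j], and no further point in these
    cells or in a slight enlargement of the two balls" has an explicit Poisson probability;
    summing over [i], [j] and letting the mesh vanish yields the formula on rectangles by
    dominated convergence, and uniqueness of measures extends it to all measurable sets of
    pairs.

    Finally, [Phi2] is contained in [Phi], so [PD <= 1] by comparing means over the unit
    square, and [M1] is obtained by subtraction over bounded sets. *)

Require Import Defs.
From HB Require Import structures.
From mathcomp Require Import finmap.
From mathcomp Require Import all_boot all_order all_algebra.
From mathcomp Require Import all_classical all_reals all_analysis.
From mathcomp Require Import measurable_realfun lebesgue_measure lebesgue_integral.
From mathcomp Require Import ring lra zify.
Set Implicit Arguments.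
Unset Strict Implicit.
Unset Printing Implicit Defensive.
Import Order.TTheory GRing.Theory Num.Theory.
Import numFieldNormedType.Exports.
Local Open Scope classical_set_scope.
Local Open Scope ring_scope.

Local Notation count := Defs.count.

(** * Translations, shears and rotations of the plane *)

(** The hypothesis on [Phi] speaks only of counts in fixed measurable sets: their laws, and their
    independence over disjoint sets. The configuration is a bare set without a measurable
    enumeration, so not even the measurability of the number of mutually nearest pairs is given. The
    grid yields it along with the formula: cell counts are measurable, and for each configuration
    the number of good pairs of cells eventually equals the number of pairs of points. To reach this
    eventual equality, [acoshR] is removed by monotonicity, so that comparisons of distances become
    signs of the polynomial [hdefect]. Evaluating it at cell corners costs an error of the order of
    the cell side, [(n + 1)^-2], and a slack of [(n + 1)^-1] absorbs it even on the boundary of the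
    closed region. Finiteness holds only over bounded parts of the plane, hence the strips. A second
    obstacle is that [Ffun] nests real integrals of a possibly unbounded [f], where an infinite
    inner value counts as 0. Almost everywhere finiteness identifies it with an extended real
    weight, from which measurability in the marks and the distance is inherited. *)

Section plane.
Context {R : realType}.
Local Notation mu := (@lebesgue_measure R).
Local Open Scope ereal_scope.

Lemma lebesgue_measure_shift (t : R) (A : set R) : measurable A ->
  pushforward mu ((fun x => x + t)%R : _ -> measurableTypeR R) A = mu A.
Proof.
move=> mA; have mt : measurable_fun [set: R] (fun x : R => x + t)%R by exact: measurable_funD.
apply/esym/lebesgue_measure_unique => //=.
move=> _ [[a b]] _ <-.
rewrite /pushforward.
have -> : (fun x : R => x + t)%R @^-1` `]a, b]%classic = `](a - t)%R, (b - t)%R]%classic.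
  by apply/seteqP; split=> x /=; rewrite !in_itv/=; lra.
by rewrite !lebesgue_measure_itv/= !lte_fin ltrD2r -!EFinB; congr (if _ then _%:E else _); lra.
Qed.

Lemma ge0_integral_shift (t : R) (f : R -> \bar R) :
  measurable_fun setT f -> (forall x, 0 <= f x) ->
  \int[mu]_x f (x + t)%R = \int[mu]_x f x.
Proof.
move=> mf f0.
have mt : measurable_fun [set: R] (fun x : R => x + t)%R by exact: measurable_funD.
transitivity (\int[pushforward mu ((fun x => x + t)%R : R -> measurableTypeR R)]_x f x).
  by rewrite ge0_integral_pushforward.
by apply: eq_measure_integral => A mA _; exact: lebesgue_measure_shift.
Qed.

Lemma ge0_integral_opp (f : R -> \bar R) :
  measurable_fun setT f -> (forall x, 0 <= f x) ->
  \int[mu]_x f (- x)%R = \int[mu]_x f x.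
Proof.
move=> mf f0.
transitivity (\int[pushforward mu (-%R : R -> measurableTypeR R)]_x f x).
  by rewrite ge0_integral_pushforward.
by apply: eq_measure_integral => A mA _; exact: lebesgue_measureN.
Qed.

Lemma ge0_integral_sub (t : R) (f : R -> \bar R) :
  measurable_fun setT f -> (forall x, 0 <= f x) ->
  \int[mu]_x f (t - x)%R = \int[mu]_x f x.
Proof.
move=> mf f0; rewrite -[RHS](ge0_integral_shift t)// -[RHS]ge0_integral_opp//.
  by apply: eq_integral => x _; rewrite addrC.
by apply: measurableT_comp => //; exact: measurable_funD.
Qed.

Local Notation mu2 := (mu \x mu)%E.
Implicit Types f : R * R -> \bar R.

Lemma ge0_integral_shearl (a : R) f :
  measurable_fun setT f -> (forall x, 0 <= f x) ->
  \int[mu2]_p f (p.1 + a * p.2, p.2)%R = \int[mu2]_p f p.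
Proof.
move=> mf f0.
have mg : measurable_fun setT (fun p : R * R => f (p.1 + a * p.2, p.2)%R).
  apply: measurableT_comp => //; apply: measurable_fun_pair => //.
  by apply: measurable_funD => //; exact: measurable_funM.
rewrite fubini_tonelli2// fubini_tonelli2//.
apply: eq_integral => y _; rewrite /fubini_G /=.
rewrite -[RHS](ge0_integral_shift (a * y))//.
by apply: measurableT_comp => //; exact: measurable_fun_pair.
Qed.

Lemma ge0_integral_shearr (a : R) f :
  measurable_fun setT f -> (forall x, 0 <= f x) ->
  \int[mu2]_p f (p.1, p.2 + a * p.1)%R = \int[mu2]_p f p.
Proof.
move=> mf f0.
have mg : measurable_fun setT (fun p : R * R => f (p.1, p.2 + a * p.1)%R).
  apply: measurableT_comp => //; apply: measurable_fun_pair => //.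
  by apply: measurable_funD => //; exact: measurable_funM.
rewrite fubini_tonelli1// fubini_tonelli1//.
apply: eq_integral => y _; rewrite /fubini_F /=.
rewrite -[RHS](ge0_integral_shift (a * y))//.
by apply: measurableT_comp => //; exact: measurable_fun_pair.
Qed.

Lemma ge0_integral_shift2 (u : R * R) f :
  measurable_fun setT f -> (forall x, 0 <= f x) ->
  \int[mu2]_p f (p.1 + u.1, p.2 + u.2)%R = \int[mu2]_p f p.
Proof.
move=> mf f0.
have mg : measurable_fun setT (fun p : R * R => f (p.1 + u.1, p.2 + u.2)%R).
  apply: measurableT_comp => //.
  by apply: measurable_fun_pair => //; exact: measurable_funD.
rewrite fubini_tonelli1// fubini_tonelli1// /fubini_F /=.
rewrite -[RHS](ge0_integral_shift u.1)//; last 2 first.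
- exact: measurable_fun_fubini_tonelli_F.
- by move=> x; exact: integral_ge0.
apply: eq_integral => x _; rewrite -[RHS](ge0_integral_shift u.2)//.
by apply: measurableT_comp => //; exact: measurable_fun_pair.
Qed.

Lemma ge0_integral_opp2 f :
  measurable_fun setT f -> (forall x, 0 <= f x) ->
  \int[mu2]_p f (- p.1, - p.2)%R = \int[mu2]_p f p.
Proof.
move=> mf f0.
have mg : measurable_fun setT (fun p : R * R => f (- p.1, - p.2)%R).
  apply: measurableT_comp => //.
  by apply: measurable_fun_pair => //; exact: measurableT_comp.
rewrite fubini_tonelli1// fubini_tonelli1// /fubini_F /=.
rewrite -[RHS]ge0_integral_opp//; last 2 first.
- exact: measurable_fun_fubini_tonelli_F.
- by move=> x; exact: integral_ge0.
apply: eq_integral => x _; rewrite -[RHS]ge0_integral_opp//.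
by apply: measurableT_comp => //; exact: measurable_fun_pair.
Qed.

Definition rot (c s : R) (p : R * R) : R * R := (c * p.1 - s * p.2, s * p.1 + c * p.2)%R.

Lemma measurable_rot c s : measurable_fun setT (rot c s).
Proof.
apply: measurable_fun_pair.
  by apply: measurable_funB; exact: measurable_funM.
by apply: measurable_funD; exact: measurable_funM.
Qed.

(* A rotation other than the half turn is a product of three shears. *)
Lemma ge0_integral_rot (c s : R) f : (c ^+ 2 + s ^+ 2 = 1)%R ->
  measurable_fun setT f -> (forall x, 0 <= f x) ->
  \int[mu2]_p f (rot c s p) = \int[mu2]_p f p.
Proof.
move=> cs1 mf f0.
have [c1|c1] := eqVneq (1 + c)%R 0%R.
  have {c1}cE : (c = -1)%R by lra.
  have sE : (s = 0)%R by apply/eqP; rewrite -sqrf_eq0; apply/eqP; move: cs1; rewrite cE; lra.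
  rewrite -[RHS]ge0_integral_opp2//; apply: eq_integral => p _; rewrite /rot cE sE.
  by congr (f (_, _)); lra.
(* For [c = cos t] and [s = sin t] this is [- tan (t / 2)]; the shears have parameters [a], [s],
   [a]. *)
pose a := (- (s / (1 + c)))%R.
have mfs : measurable_fun setT (fun p : R * R => f (p.1 + a * p.2, p.2)%R).
  apply: measurableT_comp => //; apply: measurable_fun_pair => //.
  by apply: measurable_funD => //; exact: measurable_funM.
rewrite -[RHS](ge0_integral_shearl a)// -[RHS](ge0_integral_shearr s)//.
rewrite -[RHS](ge0_integral_shearl a)/=.
- apply: eq_integral => p _; rewrite /rot; congr (f (_, _)).
    have -> : (s * p.2 = p.2 * s * 1)%R by ring.
    have H : (c = 1 + a * s)%R.
      rewrite /a; apply/(mulIf c1); rewrite mulrDl mulNr mul1r mulNr mulrAC divfK//.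
      by move: cs1; lra.
    have H' : (- s = 2 * a + a * a * s)%R.
      have -> : (2 * a + a * a * s = a * (1 + c))%R by rewrite H; ring.
      by rewrite /a mulNr divfK.
    by rewrite {1}H mulr1 -mulrN H'; ring.
  have H : (c = 1 + a * s)%R.
    rewrite /a; apply/(mulIf c1); rewrite mulrDl mulNr mul1r mulNr mulrAC divfK//.
    by move: cs1; lra.
  by rewrite H; ring.
- have mh : measurable_fun setT (fun p : R * R => (p.1, p.2 + s * p.1)%R).
    by apply: measurable_fun_pair => //; apply: measurable_funD => //; exact: measurable_funM.
  exact: measurableT_comp mfs mh.
- by move=> x; exact: f0.
Qed.

End plane.

(** * Densities and radial integrals *)

Section density.
Context d (T : measurableType d) (R : realType).
Variables (m : {measure set T -> \bar R}) (g : T -> R).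
Hypotheses (mg : measurable_fun setT g) (g0 : forall x, (0 <= g x)%R).
Local Open Scope ereal_scope.

Definition mdensity (A : set T) : \bar R := \int[m]_(x in A) (g x)%:E.

Let mdensity0 : mdensity set0 = 0.
Proof. exact: integral_set0. Qed.

Let mdensity_ge0 A : 0 <= mdensity A.
Proof. by apply: integral_ge0 => x _; rewrite lee_fin. Qed.

Let mdensity_sigma_additive : semi_sigma_additive mdensity.
Proof.
move=> F mF tF mUF; rewrite /mdensity ge0_integral_bigcup//.
- by apply: is_cvg_nneseries => n _ _; exact: mdensity_ge0.
- by apply/measurable_EFinP; exact: measurable_funTS.
- by move=> x _; rewrite lee_fin.
Qed.

HB.instance Definition _ := isMeasure.Build _ _ _ mdensity
  mdensity0 mdensity_ge0 mdensity_sigma_additive.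

Definition density_measure : {measure set T -> \bar R} := mdensity.

Import HBNNSimple.

Lemma ge0_integral_mdensity (f : T -> \bar R) :
  measurable_fun setT f -> (forall x, 0 <= f x) ->
  \int[mdensity]_x f x = \int[m]_x (f x * (g x)%:E).
Proof.
move=> mf f0; pose f_ := nnsfun_approx measurableT mf.
have fgE x : f x * (g x)%:E = limn (fun n => (f_ n x)%:E * (g x)%:E).
  apply/esym/cvg_lim => //; apply: cvgeZr => //.
  exact: @cvg_nnsfun_approx _ _ _ _ measurableT _ mf (fun x _ => f0 x) x I.
under [RHS]eq_integral do rewrite fgE.
have mEg : measurable_fun setT (EFin \o g) by exact/measurable_EFinP.
rewrite monotone_convergence//; last 3 first.
- move=> n; apply: emeasurable_funM => //.
  exact/measurable_EFinP/measurable_funP.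
- by move=> n x _; rewrite mule_ge0// lee_fin.
- move=> x _ a b ab; rewrite lee_wpmul2r ?lee_fin//.
  exact/lefP/nd_nnsfun_approx.
transitivity (limn (fun n => \int[mdensity]_x (f_ n x)%:E)).
  rewrite -monotone_convergence//; last 3 first.
  - by move=> n; exact/measurable_EFinP/measurable_funP.
  - by move=> n x _; rewrite lee_fin.
  - by move=> x _ a b ab; rewrite lee_fin; exact/lefP/nd_nnsfun_approx.
  apply: eq_integral => x _; apply/esym/cvg_lim => //.
  exact: @cvg_nnsfun_approx _ _ _ _ measurableT _ mf (fun x _ => f0 x) x I.
congr (limn _); apply/funext => n.
under [LHS]eq_integral do rewrite fimfunE -fsumEFin//.
rewrite ge0_integral_fsum//; last 2 first.
- by move=> y; exact/measurable_EFinP/measurable_funM.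
- by move=> y x _; rewrite nnfun_muleindic_ge0.
rewrite [RHS](eq_integral (fun x => \sum_(k \in range (f_ n))
    ((k * \1_(f_ n @^-1` [set k]) x)%:E * (g x)%:E))); last first.
  move=> x _; rewrite fimfunE -fsumEFin// ge0_mule_fsuml// => i.
  by rewrite nnfun_muleindic_ge0.
rewrite ge0_integral_fsum//; last 2 first.
- move=> y; apply: emeasurable_funM => //.
  exact/measurable_EFinP/measurable_funM.
- by move=> y x _; rewrite mule_ge0 ?nnfun_muleindic_ge0// lee_fin.
apply: eq_fsbigr => r _.
have [r0|r0] := ltP r 0%R.
  rewrite preimage_nnfun0// !integral0_eq// => x _; first by rewrite indic0 mulr0 mul0e.
  by rewrite indic0 mulr0.
rewrite [LHS]integralZl_indic_nnsfun// [in LHS]integral_indic// setIT.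
under [RHS]eq_integral do rewrite EFinM -muleA.
rewrite ge0_integralZl//; last 2 first.
- by apply: emeasurable_funM => //; exact/measurable_EFinP.
- by move=> x _; rewrite mule_ge0// lee_fin.
congr (_ * _); rewrite /= /mdensity integral_mkcond.
apply: eq_integral => x _; rewrite patchE indicE.
by case: (x \in _); rewrite ?mul1e ?mul0e.
Qed.
End density.

Section disc.
Context {R : realType}.
Local Notation mu := (@lebesgue_measure R).
Local Notation mu2 := (mu \x mu)%E.
Local Open Scope ereal_scope.

(** Open left rays are stable under intersection, generate the Borel sets and exhaust the line. The
    lemma identifies the law of the norm under planar Lebesgue measure. *)
Lemma measure_unique_ray (m1 m2 : {measure set (measurableTypeR R) -> \bar R}) :
  (forall x : R, m1 `]-oo, x[%classic = m2 `]-oo, x[%classic) ->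
  (forall x : R, m1 `]-oo, x[%classic < +oo) ->
  forall A : set R, measurable A -> m1 A = m2 A.
Proof.
move=> m12 m1oo; apply: (@measure_unique _ R (measurableTypeR R) (@RGenInftyO.G R) (fun n => `]-oo, n%:R[%classic)).
- exact: RGenInftyO.measurableE.
- move=> _ _ [x ->] [y ->]; exists (Num.min x y).
  apply/seteqP; split => z /=; rewrite !in_itv/= lt_min; first by move=> [-> ->].
  by move=> /andP[-> ->].
- by move=> n; exists n%:R.
- rewrite -subTset => x _ /=; exists (Num.bound `|x|) => //=.
  by rewrite in_itv/= (le_lt_trans (ler_norm x))// archi_boundP.
- by move=> _ [x ->].
- by move=> k; exact: m1oo.
Qed.

(** The flag treats open and closed discs together: open ones are the preimages of rays under the
    norm, closed ones the slices of closed balls. For [u < 0] the set is empty and [Num.sqrt u] is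
    0. *)
Lemma lebesgue_sqr_lteif (b : bool) (u : R) :
  mu [set y : R | (y ^+ 2 < u ?<= if b)%R] = (2 * Num.sqrt u)%:E :> \bar R.
Proof.
have [u0|u0] := ltP u 0%R.
  rewrite ler0_sqrtr ?ltW// mulr0 (_ : [set _ | _] = set0) ?measure0//.
  apply/seteqP; split => y //= /lteifW; move: (sqr_ge0 y); lra.

suff -> : [set y : R | (y ^+ 2 < u ?<= if b)%R] =
    [set` Interval (BSide b (- Num.sqrt u)%R) (BSide (~~ b) (Num.sqrt u))].
  rewrite lebesgue_measure_itv/=; have := sqrtr_ge0 u.
  rewrite le_eqVlt => /predU1P[<-|su]; first by rewrite oppr0 ltxx mulr0.
  by rewrite lte_fin ifT; [rewrite -EFinB; congr EFin; lra|lra].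
have sqE (y : R) : (y ^+ 2 = `|y| ^+ 2)%R by rewrite real_normK// num_real.
have le (y : R) : (y ^+ 2 <= u = (`|y| <= Num.sqrt u))%R.
  by rewrite -[in RHS]sqrtr_sqr ler_sqrt.
have lt (y : R) : (y ^+ 2 < u = (`|y| < Num.sqrt u))%R.
  by rewrite [in RHS]ltNge -sqrtr_sqr ler_sqrt ?sqr_ge0// -ltNge.
by apply/seteqP; split => y /=; case: b => /=;
  rewrite in_itv/= ?le ?lt ?ler_norml ?ltr_norml.
Qed.

Lemma lebesgue2_disc_slices (b : bool) (t : R) :
  mu2 [set p : R * R | (p.1 ^+ 2 + p.2 ^+ 2 < t ?<= if b)%R] =
  \int[mu]_x (2 * Num.sqrt (t - x ^+ 2))%:E.
Proof.
rewrite /product_measure1; apply: eq_integral => x _ /=.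
rewrite -(lebesgue_sqr_lteif b); congr (mu _).
by apply/seteqP; split => y /=; rewrite xsectionP/=; case: b => /=; lra.
Qed.

Lemma integral_sqrt_disc (t : R) : (0 <= t)%R ->
  \int[mu]_x (2 * Num.sqrt (t - x ^+ 2))%:E = (pi * t)%:E.
Proof.
move=> t0.
have cG : continuous (fun x : R => 2 * Num.sqrt (t - x ^+ 2))%R.
  move=> x; apply: cvgM; first exact: cvg_cst.
  apply: (@continuous_comp _ _ _ (fun x : R => t - x ^+ 2)%R (@Num.sqrt R)); last exact: sqrt_continuous.
  apply: cvgB; first exact: cvg_cst.
  exact: exprn_continuous.
have mG : measurable_fun setT (fun x : R => 2 * Num.sqrt (t - x ^+ 2))%R.
  exact: continuous_measurable_fun.
pose st : R := Num.sqrt t.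
have stt : (st ^+ 2 = t)%R by rewrite sqr_sqrtr.
transitivity (\int[mu]_(x in `[(- st)%R, st]%classic) (2 * Num.sqrt (t - x ^+ 2))%:E).
  rewrite [RHS]integral_mkcond; apply: eq_integral => x _; rewrite patchE.
  case: ifPn => //; rewrite notin_setE/= in_itv/= => h; rewrite ler0_sqrtr ?mulr0//.
  have : (~~ (`|x| <= st))%R by rewrite ler_norml; apply/negP.
  by rewrite -ltNge -ltr_sqr ?nnegrE ?sqrtr_ge0// real_normK ?num_real// stt; lra.
(* The substitution below must be strictly increasing, which fails for radius 0. *)
have [t_0|t_0] := eqVneq t 0%R.
  by rewrite /st t_0 sqrtr0 oppr0 set_itv1 integral_set1 mulr0.
have st0 : (0 < st)%R by rewrite sqrtr_gt0 lt_neqAle eq_sym t_0.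
(* Substitution [x = st * sin th] for [th] between [- pi / 2] and [pi / 2]. *)
pose F : R -> R := (fun th : R => st * sin th)%R.
have dF (x : R) : is_derive x 1%R F (st * cos x)%R.
  exact: is_derive_eq.
have F'E : (F^`())%classic = (fun x => st * cos x)%R.
  by apply/funext => x; rewrite derive1E derive_val.
have cF : continuous F.
  by move=> x; apply: cvgM; [exact: cvg_cst|exact: continuous_sin].
have cF' : continuous (F^`())%classic.
  by rewrite F'E => x; apply: cvgM; [exact: cvg_cst|exact: continuous_cos].
have pi0 := pi_gt0 R.
rewrite (_ : - st = F (- (pi / 2)))%R; last by rewrite /F sinN sin_pihalf mulrN1.
rewrite [X in `[_, X]](_ : st = F (pi / 2))%R; last by rewrite /F sin_pihalf mulr1.
rewrite integration_by_substitution_increasing; last 7 first.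
- lra.
- move=> x y xI yI xy; rewrite /F ltr_pM2l// ltr_sin//.
- by move=> x _; exact: cF'.
- by apply: cvgP; apply: cvg_at_right_filter; exact: cF'.
- by apply: cvgP; apply: cvg_at_left_filter; exact: cF'.
- split.
  + by move=> x _; exact: ex_derive.
  + by apply: cvg_at_right_filter; exact: cF.
  + by apply: cvg_at_left_filter; exact: cF.
- by apply: continuous_subspaceT.
transitivity (\int[mu]_(x in `[(- (pi / 2))%R, (pi / 2)%R]%classic) (2 * t * cos x ^+ 2)%:E).
  apply: eq_integral => x; rewrite inE/= in_itv/= => xI; congr EFin.
  have cx0 : (0 <= st * cos x)%R by rewrite mulr_ge0 ?cos_ge0_pihalf// ltW.
  rewrite F'E; change (2 * Num.sqrt (t - (st * sin x) ^+ 2) * (st * cos x) = 2 * t * cos x ^+ 2)%R.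
  have -> : (t - (st * sin x) ^+ 2 = (st * cos x) ^+ 2)%R.
    by rewrite !exprMn stt (cos2sin2 x); lra.
  by rewrite sqrtr_sqr ger0_norm// -stt; ring.
(* An antiderivative of [2 * t * cos th ^+ 2]. *)
pose H : R -> R := (fun th : R => t * (th + sin th * cos th))%R.
have dH (x : R) : is_derive x 1%R H (2 * t * cos x ^+ 2)%R.
  apply: is_derive_eq; rewrite /GRing.scale/=; have := cos2Dsin2 x => h.
  have -> : (sin x * - sin x = cos x ^+ 2 - 1)%R by rewrite -h; ring.
  by ring.
have cH : continuous H.
  by move=> x; apply: differentiable_continuous; apply/derivable1_diffP; exact: ex_derive.
rewrite (@continuous_FTC2 _ _ H).
- by rewrite /H -EFinB cosN sinN !cos_pihalf; congr EFin; lra.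
- lra.
- apply: continuous_subspaceT => x; apply: cvgM; first exact: cvg_cst.
  apply: (@continuous_comp _ _ _ (@cos R) (fun x : R => x ^+ 2)%R); first exact: continuous_cos.
  exact: exprn_continuous.
- split.
  + by move=> x _; exact: ex_derive.
  + by apply: cvg_at_right_filter; exact: cH.
  + by apply: cvg_at_left_filter; exact: cH.
- by move=> x _; rewrite derive1E derive_val.
Qed.

Lemma lebesgue2_disc (b : bool) (t : R) : (0 <= t)%R ->
  mu2 [set p : R * R | (p.1 ^+ 2 + p.2 ^+ 2 < t ?<= if b)%R] = (pi * t)%:E.
Proof. by move=> t0; rewrite lebesgue2_disc_slices integral_sqrt_disc. Qed.

Definition norm2 (p : R * R) : R := Num.sqrt (p.1 ^+ 2 + p.2 ^+ 2)%R.

Lemma measurable_norm2 : measurable_fun setT norm2.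
Proof.
apply: measurableT_comp; last first.
  by apply: measurable_funD; apply: measurable_funX.
by apply: continuous_measurable_fun; exact: sqrt_continuous.
Qed.

(** Density of the image of planar Lebesgue measure under [norm2]; [Num.max] makes it nonnegative on
    the whole line, as [density_measure] demands. *)
Let radial_density (s : R) : R := (2 * pi * Num.max s 0)%R.

Let measurable_radial_density : measurable_fun setT radial_density.
Proof.
by apply: measurable_funM => //; apply: measurable_maxr.
Qed.

Let radial_density_ge0 s : (0 <= radial_density s)%R.
Proof. by rewrite mulr_ge0 ?le_max ?lexx ?orbT// mulr_ge0 ?pi_ge0. Qed.

Let radial_measure : {measure set (measurableTypeR R) -> \bar R} := density_measure mu measurable_radial_density radial_density_ge0.

Let norm_measure : {measure set (measurableTypeR R) -> \bar R} :=
  @measure_function_pushforward__canonical__measure_function_Measure _ _ _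
    (measurableTypeR R) R (mu \x mu) norm2 measurable_norm2.

Let norm_measure_ray x :
  norm_measure `]-oo, x[%classic = (pi * (Num.max x 0) ^+ 2)%:E.
Proof.
rewrite -(lebesgue2_disc false) ?sqr_ge0//=; congr (mu2 _).
apply/seteqP; split => p /=; rewrite in_itv/= /norm2 => h.
  have x0 : (0 < x)%R by rewrite (le_lt_trans _ h)// sqrtr_ge0.
  rewrite max_l ?ltW//.
  by rewrite -(sqr_sqrtr (addr_ge0 (sqr_ge0 p.1) (sqr_ge0 p.2))) ltr_pXn2r// nnegrE ?sqrtr_ge0// ltW.
have x0 : (0 < x)%R.
  rewrite ltNge; apply/negP => x0; move: h; rewrite max_r//.
  have := sqr_ge0 p.1; have := sqr_ge0 p.2; lra.
move: h; rewrite max_l ?ltW// => h.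
by rewrite -(ltr_pXn2r (ltn0Sn 1)) ?nnegrE ?sqrtr_ge0 ?ltW// sqr_sqrtr// addr_ge0 ?sqr_ge0.
Qed.

Let radial_measure_ray x :
  radial_measure `]-oo, x[%classic = (pi * (Num.max x 0) ^+ 2)%:E.
Proof.
rewrite /radial_measure /= /mdensity.
have [x0|x0] := leP x 0%R.
  rewrite integral0_eq ?max_r// ?expr0n ?mulr0// => y /=; rewrite in_itv/= => yx.
  by rewrite /radial_density max_r ?mulr0// (le_trans (ltW yx)).
transitivity (\int[mu]_(s in `[0%R, x]) (2 * pi * s)%:E).
  rewrite -integral_itv_bndo_bndc; last first.
    by apply/measurable_EFinP; apply: measurable_funM.
  rewrite integral_mkcond [RHS]integral_mkcond; apply: eq_integral => y _; rewrite !patchE.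
  have [y0|y0] := ltP y 0%R; last first.
    rewrite /radial_density max_l//.
    case: ifPn => [|]; rewrite ?inE ?notin_setE/= in_itv/=; case: ifPn; rewrite ?inE ?notin_setE/= in_itv/= y0 //.
  rewrite /radial_density max_r ?ltW// mulr0 if_same.
  by case: ifPn => //; rewrite inE/= in_itv/= leNgt y0.
have dH (y : R) : is_derive y 1%R (fun s : R => pi * s ^+ 2)%R (2 * pi * y)%R.
  by apply: is_derive_eq; rewrite /GRing.scale/=; ring.
have cH : continuous (fun s : R => pi * s ^+ 2)%R.
  by move=> y; apply: cvgM; [exact: cvg_cst|exact: exprn_continuous].
rewrite (@continuous_FTC2 _ _ (fun s : R => pi * s ^+ 2)%R)//.
- by rewrite expr0n mulr0 sube0.
- by apply: continuous_subspaceT => y; apply: cvgM; [exact: cvg_cst|exact: cvg_id].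
- split.
  + by move=> y _; exact: ex_derive.
  + by apply: cvg_at_right_filter; exact: cH.
  + by apply: cvg_at_left_filter; exact: cH.
- by move=> y _; rewrite derive1E derive_val.
Qed.

(** The image measure under [norm2] and the measure of density [radial_density] both give the ray
    below [x > 0] the area [pi * x ^+ 2] of a disc, and 0 to the other rays. *)
Lemma ge0_integral_radial (g : R -> \bar R) : measurable_fun setT g -> (forall x, 0 <= g x) ->
  \int[mu2]_p g (norm2 p) = (2 * pi)%:E * \int[mu]_(s in `[0%R, +oo[) (g s * s%:E).
Proof.
move=> mg g0.
transitivity (\int[norm_measure]_x g x).
  by rewrite [RHS]ge0_integral_pushforward//; exact: measurable_norm2.
transitivity (\int[radial_measure]_x g x).
  apply: eq_measure_integral => A mA _.
  apply: measure_unique_ray => // x; first by rewrite norm_measure_ray radial_measure_ray.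
  by rewrite norm_measure_ray ltry.
rewrite [LHS]ge0_integral_mdensity//.
rewrite -ge0_integralZl//=; last 3 first.
- by apply: emeasurable_funM; [exact: measurable_funTS|exact/measurable_EFinP/measurable_funTS].
- by move=> x; rewrite in_itv/= andbT => x0; rewrite mule_ge0.
- by rewrite lee_fin mulr_ge0// pi_ge0.
rewrite [RHS]integral_mkcond; apply: eq_integral => x _; rewrite patchE.
rewrite /radial_density; case: ifPn => [|].
  rewrite inE/= in_itv/= andbT => x0; rewrite max_l//.
  by rewrite EFinM muleCA.
rewrite notin_setE/= in_itv/= andbT => /negP; rewrite -ltNge => x0.
by rewrite max_r ?ltW// mulr0 mule0.
Qed.

End disc.

(** * Iterated integrals and polar coordinates *)

Section tonelli.
Context d1 d2 (T1 : measurableType d1) (T2 : measurableType d2) (R : realType).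
Variable m1 : {sigma_finite_measure set T1 -> \bar R}.
Variable m2 : {sigma_finite_measure set T2 -> \bar R}.
Local Open Scope ereal_scope.

Let patchX (f : T1 * T2 -> \bar R) D1 D2 x y :
  (f \_ (D1 `*` D2)) (x, y) = ((fun x => ((fun y => f (x, y)) \_ D2) y) \_ D1) x.
Proof.
by rewrite !patchE in_setX; case: (x \in D1); case: (y \in D2).
Qed.

Lemma integral_prod_in (f : T1 * T2 -> \bar R) D1 D2 :
  measurable D1 -> measurable D2 -> measurable_fun setT f -> (forall x, 0 <= f x) ->
  \int[m1]_(x in D1) \int[m2]_(y in D2) f (x, y) =
  \int[m1 \x m2]_p (f \_ (D1 `*` D2)) p.
Proof.
move=> mD1 mD2 mf f0.
have mg : measurable_fun setT (f \_ (D1 `*` D2)).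
  by apply/(measurable_restrictT _ _).1; [exact: measurableX|exact: measurable_funTS].
have g0 x : 0 <= (f \_ (D1 `*` D2)) x by rewrite patchE; case: ifPn.
rewrite fubini_tonelli1// integral_mkcond; apply: eq_integral => x _.
rewrite /fubini_F; under [RHS]eq_integral do rewrite patchX.
rewrite [in LHS]patchE; case: ifPn => xD1.
  by rewrite [LHS]integral_mkcond; apply: eq_integral => y _; rewrite [RHS]patchE xD1.
by rewrite integral0_eq// => y _; rewrite [LHS]patchE (negbTE xD1).
Qed.

Lemma tonelli_in (f : T1 * T2 -> \bar R) D1 D2 :
  measurable D1 -> measurable D2 -> measurable_fun setT f -> (forall x, 0 <= f x) ->
  \int[m1]_(x in D1) \int[m2]_(y in D2) f (x, y) =
  \int[m2]_(y in D2) \int[m1]_(x in D1) f (x, y).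
Proof.
move=> mD1 mD2 mf f0; rewrite integral_prod_in//.
have mg : measurable_fun setT (f \_ (D1 `*` D2)).
  by apply/(measurable_restrictT _ _).1; [exact: measurableX|exact: measurable_funTS].
have g0 x : 0 <= (f \_ (D1 `*` D2)) x by rewrite patchE; case: ifPn.
rewrite fubini_tonelli2// [RHS]integral_mkcond; apply: eq_integral => y _.
rewrite /fubini_G; under [LHS]eq_integral do rewrite patchX.
rewrite [in RHS]patchE; case: ifPn => yD2.
  by rewrite [RHS]integral_mkcond; apply: eq_integral => x _; rewrite !patchE yD2.
by rewrite integral0_eq// => x _; rewrite !patchE (negbTE yD2) if_same.
Qed.

Lemma measurable_integral_in (f : T1 * T2 -> \bar R) D2 :
  measurable D2 -> measurable_fun setT f -> (forall x, 0 <= f x) ->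
  measurable_fun setT (fun x => \int[m2]_(y in D2) f (x, y)).
Proof.
move=> mD2 mf f0.
have mg : measurable_fun setT (f \_ (setT `*` D2)).
  by apply/(measurable_restrictT _ _).1; [exact: measurableX|exact: measurable_funTS].
have g0 x : 0 <= (f \_ (setT `*` D2)) x by rewrite patchE; case: ifPn.
have := measurable_fun_fubini_tonelli_F (m2 := m2) _ mg g0.
apply: eq_measurable_fun => x _; rewrite /fubini_F [RHS]integral_mkcond.
by apply: eq_integral => y _; rewrite patchX patchE in_setT.
Qed.
End tonelli.

Section sigma_finite_product.
Context d1 d2 (T1 : measurableType d1) (T2 : measurableType d2) (R : realType).
Variable m1 : {sigma_finite_measure set T1 -> \bar R}.
Variable m2 : {sigma_finite_measure set T2 -> \bar R}.
Local Open Scope ereal_scope.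

(* An alias of [m1 \x m2] on which the sigma-finite structure is inferable. *)
Definition sfprod : set (T1 * T2) -> \bar R := m1 \x m2.

HB.instance Definition _ := Measure.on sfprod.

Let sfprod_sigma_finite : sigma_finite setT sfprod.
Proof.
have [F FT Foo] := sigma_finiteT m1; have [G GT Goo] := sigma_finiteT m2.
exists (fun n => if unpickle n is Some (i, j) then F i `*` G j else set0).
  apply/esym; rewrite -subTset => -[x y] _.
  have [i _ Fix] : (\bigcup_i F i) x by rewrite -FT.
  have [j _ Gjy] : (\bigcup_i G i) y by rewrite -GT.
  by exists (pickle (i, j)) => //=; rewrite pickleK.
move=> n; case: (unpickle n) => [[i j]|]; last by split => //; rewrite measure0.
have [mF Fi] := Foo i; have [mG Gj] := Goo j.
split; first exact: measurableX.
by rewrite /sfprod product_measure1E// lte_mul_pinfty// ge0_fin_numE.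
Qed.

HB.instance Definition _ := Measure_isSigmaFinite.Build _ _ _ sfprod sfprod_sigma_finite.

End sigma_finite_product.

Definition leb2M (R : realType) := sfprod (@lebesgue_measure R) (@lebesgue_measure R).
HB.instance Definition _ (R : realType) := SigmaFiniteMeasure.on (@leb2M R).

Section polar.
Context {R : realType}.
Local Notation mu := (@lebesgue_measure R).
Local Notation mu2 := (mu \x mu)%E.
Local Open Scope ereal_scope.

Lemma measurable_cos : measurable_fun [set: R] cos.
Proof. by apply: continuous_measurable_fun; exact: continuous_cos. Qed.

Lemma measurable_sin : measurable_fun [set: R] sin.
Proof. by apply: continuous_measurable_fun; exact: continuous_sin. Qed.

Lemma polar_angle (p : R * R) : exists2 a : R, (0 <= a <= 2 * pi)%R &
  p = (norm2 p * cos a, norm2 p * sin a)%R.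
Proof.
case: p => x y; rewrite /norm2 /=; set n := Num.sqrt _.
have n0 : (0 <= n)%R by exact: sqrtr_ge0.
have nn : (n ^+ 2 = x ^+ 2 + y ^+ 2)%R by rewrite sqr_sqrtr// addr_ge0 ?sqr_ge0.
have pi0 := pi_gt0 R.
have [n_0|n_0] := eqVneq n 0%R.
  exists 0%R; first by apply/andP; lra.
  have : (x ^+ 2 + y ^+ 2 = 0)%R by rewrite -nn n_0 expr0n.
  move/eqP; rewrite paddr_eq0 ?sqr_ge0// !sqrf_eq0 => /andP[/eqP-> /eqP->].
  by rewrite n_0 !mul0r.
have ngt0 : (0 < n)%R by rewrite lt_neqAle eq_sym n_0.
have xn : (-1 <= x / n <= 1)%R.
  rewrite ler_pdivlMr// ler_pdivrMr// mulN1r mul1r -ler_norml.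
  rewrite -(@ler_pXn2r _ 2)// ?nnegrE// real_normK ?num_real// nn.
  by have := sqr_ge0 y; lra.
have [/andP[a0 api] ca] := acos_def xn.
have sa : (n * sin (acos (x / n)) = `|y|)%R.
  rewrite sin_acos// -[in RHS]sqrtr_sqr -{1}(ger0_norm n0) -sqrtr_sqr -sqrtrM ?sqr_ge0//.
  congr Num.sqrt; rewrite mulrBr mulr1 -exprMn mulrC divfK// nn; lra.
have [y0|y0] := leP 0%R y.
  exists (acos (x / n)); first by apply/andP; lra.
  by rewrite ca sa mulrC divfK// ger0_norm.
exists (2 * pi - acos (x / n))%R; first by apply/andP; lra.
have -> : (2 * pi - acos (x / n) = - acos (x / n) + pi *+ 2)%R by rewrite mulr2n; lra.
by rewrite cosD2pi sinD2pi cosN sinN mulrN sa ca ltr0_norm// opprK mulrC divfK.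
Qed.

Lemma ge0_integral_periodic (k : R -> \bar R) (a : R) :
  measurable_fun setT k -> (forall x, 0 <= k x) ->
  (forall x, k (x + 2 * pi)%R = k x) -> (0 <= a <= 2 * pi)%R ->
  \int[mu]_(t in `[0%R, (2 * pi)%R]) k (t + a)%R = \int[mu]_(t in `[0%R, (2 * pi)%R]) k t.
Proof.
move=> mk k0 per /andP[a0 api].
have shiftE (u v t : R) : \int[mu]_(x in `[u, v[) k (x + t)%R =
    \int[mu]_(x in `[(u + t)%R, (v + t)%R[) k x.
  rewrite integral_mkcond [RHS]integral_mkcond -[RHS](ge0_integral_shift t)//.
  - by apply: eq_integral => x _; rewrite !patchE !mem_setE !in_itv/= lerD2r ltrD2r.
  - by apply/(measurable_restrictT _ _).1 => //; exact: measurable_funTS.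
  - by move=> x; rewrite patchE; case: ifPn.
have mkt (t : R) : measurable_fun setT (fun x : R => k (x + t)%R).
  by apply: measurableT_comp => //; exact: measurable_funD.
rewrite -!integral_itv_bndo_bndc; [|exact: measurable_funTS|exact: measurable_funTS].
rewrite shiftE add0r.
have split3 (u v w : R) : (u <= v <= w)%R -> \int[mu]_(x in `[u, w[) k x =
    \int[mu]_(x in `[u, v[) k x + \int[mu]_(x in `[v, w[) k x.
  move=> /andP[uv vw]; rewrite -ge0_integral_setU//.
  - congr (integral _ _ _); apply/seteqP; split => x/=; rewrite !in_itv/=.
      by move=> /andP[-> ->]; rewrite andbT/=; case: (ltP x v); [left|right].
    by move=> [/andP[-> xv]|/andP[vx ->]]; rewrite ?andbT/= ?(lt_le_trans xv)// (le_trans uv).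
  - exact: measurable_funTS.
  - apply/disj_setPLR => x /=; rewrite !in_itv/= => /andP[_ xv]; apply/negP.
    by rewrite negb_and -ltNge xv.
(* The window [[a, 2 pi + a[] differs from [[0, 2 pi[] by losing [[0, a[] and gaining its translate
   by one period. *)
rewrite (split3 _ (2 * pi)%R) ?api/=; last by lra.
rewrite [RHS](split3 _ a) ?a0// [RHS]addeC; congr (_ + _).
rewrite -{1}(add0r (2 * pi)%R) (addrC (2 * pi)%R a) -shiftE.
by apply: eq_integral => x _; rewrite per.
Qed.

Lemma measurable_polar (G : R * R -> \bar R) : measurable_fun setT G ->
  measurable_fun setT (fun q : R * R => G (q.2 * cos q.1, q.2 * sin q.1)%R).
Proof.
move=> mG; apply: measurableT_comp => //; apply: measurable_fun_pair.
  by apply: measurable_funM => //; apply: measurableT_comp => //; exact: measurable_cos.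
by apply: measurable_funM => //; apply: measurableT_comp => //; exact: measurable_sin.
Qed.

(* Averaging G over all rotations makes it radial, which reduces the formula to the radial case. *)
Lemma ge0_integral_polar (G : R * R -> \bar R) :
  measurable_fun setT G -> (forall p, 0 <= G p) ->
  \int[mu2]_p G p = \int[mu]_(t in `[0%R, (2 * pi)%R])
    \int[mu]_(r in `[0%R, +oo[) (G (r * cos t, r * sin t)%R * r%:E).
Proof.
move=> mG G0.
have pi0 := pi_gt0 R.
pose H s := \int[mu]_(t in `[0%R, (2 * pi)%R]) G (s * cos t, s * sin t)%R.
have mH : measurable_fun setT H.
  apply: (@measurable_integral_in _ _ _ _ _ mu (fun q : R * R => G (q.1 * cos q.2, q.1 * sin q.2)%R)) => //.
  exact: (measurableT_comp (measurable_polar mG) (measurable_fun_pair _ _)).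
have H0 s : 0 <= H s by exact: integral_ge0.
have avg : (2 * pi)%:E * \int[mu2]_p G p = \int[mu2]_p H (norm2 p).
  transitivity (\int[mu]_(t in `[0%R, (2 * pi)%R]) \int[mu2]_p G (rot (cos t) (sin t) p)).
    transitivity (\int[mu]_(t in `[0%R, (2 * pi)%R]) (cst (\int[mu2]_p G p) t)); last first.
      by apply: eq_integral => t _; exact/esym/(ge0_integral_rot (cos2Dsin2 t) mG G0).
    have -> : (2 * pi)%:E = mu `[0%R, (2 * pi)%R].
      by rewrite lebesgue_measure_itv/= lte_fin ifT ?sube0//; lra.
    by rewrite [RHS]integral_cst// muleC.
  rewrite (@tonelli_in _ _ _ _ _ mu (@leb2M R) (fun q : R * (R * R) => G (rot (cos q.1) (sin q.1) q.2)) _ setT)//; last first.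
    apply: measurableT_comp => //; apply: measurable_fun_pair => /=.
      apply: measurable_funB; apply: measurable_funM; apply: measurableT_comp => //.
      - exact: measurable_cos.
      - exact: measurable_sin.
    apply: measurable_funD; apply: measurable_funM; apply: measurableT_comp => //.
    - exact: measurable_sin.
    - exact: measurable_cos.
  apply: eq_integral => p _.
  (* Rotating [p] by [t] adds [t] to its polar angle [a], and a full period of [t] makes the shift
     by [a] invisible. *)
  have [a aI pE] := polar_angle p.
  rewrite /H -(ge0_integral_periodic _ _ _ aI)//=.
  - apply: eq_integral => t _; congr G; rewrite [in LHS]pE /rot/= cosD sinD.
    by congr (_, _); ring.
  - exact: (measurableT_comp (measurable_polar mG) (measurable_fun_pair _ _)).
  - by move=> x; rewrite mulr_natl cosD2pi sinD2pi.
(* The equality follows from [avg] by the radial formula and division by [2 pi]. *)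
have [-> //|] := eqVneq (\int[mu2]_p G p) (\int[mu]_(s in `[0%R, +oo[) (H s * s%:E)); last first.
  move: avg; rewrite ge0_integral_radial// => /(congr1 (fun z => (2 * pi)^-1%:E * z)).
  rewrite !muleA -!EFinM mulVf ?mul1e; last by lra.
  by move=> -> /eqP.
have mp : measurable_fun setT (fun q : R * R => G (q.1 * cos q.2, q.1 * sin q.2)%R).
  exact: (measurableT_comp (measurable_polar mG) (measurable_fun_pair _ _)).
pose K (q : R * R) : \bar R := G (q.1 * cos q.2, q.1 * sin q.2)%R * (Num.max q.1 0)%:E.
have mK : measurable_fun setT K.
  by apply: emeasurable_funM => //; apply/measurable_EFinP; exact: measurable_maxr.
have K0 q : 0 <= K q by rewrite mule_ge0// lee_fin le_max lexx orbT.
transitivity (\int[mu]_(r in `[0%R, +oo[) \int[mu]_(t in `[0%R, (2 * pi)%R]) K (r, t)).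
  apply: eq_integral => r; rewrite inE/= in_itv/= andbT => r0.
  rewrite /H -ge0_integralZr//; last first.
    apply: measurable_funTS.
    have mr : measurable_fun setT (fun t : R => (r, t)) by exact: measurable_fun_pair.
    exact: measurableT_comp mp mr.
  by apply: eq_integral => t _; rewrite /K/= max_l.
transitivity (\int[mu]_(t in `[0%R, (2 * pi)%R]) \int[mu]_(r in `[0%R, +oo[) K (r, t)).
  exact: (@tonelli_in _ _ _ _ _ mu mu K).
apply: eq_integral => t _; apply: eq_integral => r.
by rewrite inE/= in_itv/= andbT => r0; rewrite /K/= max_l.
Qed.
End polar.

(** * Weight of balls and spherical caps *)

Lemma eq_indic (R : pzRingType) (T U : Type) (A : set T) (B : set U) x y :
  (A x <-> B y) -> \1_A x = \1_B y :> R.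
Proof. by move=> AB; rewrite !indicE (_ : (x \in A) = (y \in B))//; apply/idP/idP; rewrite !inE => /AB. Qed.

Section slices.
Context {R : realType}.
Local Notation mu := (@lebesgue_measure R).
Local Notation mu2 := (@leb2M R).
Variable phi : R -> R.
Hypotheses (mphi : measurable_fun setT phi) (phi0 : forall z, 0 <= phi z).
Local Open Scope ereal_scope.

Lemma ge0_integralZl_indic d (T : measurableType d) (m : {measure set T -> \bar R}) (k : R) (A : set T) :
  measurable A -> (0 <= k)%R -> \int[m]_x (k * \1_A x)%:E = k%:E * m A.
Proof.
move=> mA k0; under eq_integral do rewrite EFinM.
rewrite ge0_integralZl//; last exact/measurable_EFinP/measurable_indic.
by rewrite integral_indic// setIT.
Qed.

(** The intensity without its factor [lam], for any mark density [phi]. *)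
Definition weight (Y : set (R * R * R)) : \bar R :=
  \int[mu2 \x mu]_(p in Y) (phi p.2)%:E.

Lemma weight_iter (Y : set (R * R * R)) : measurable Y ->
  weight Y = \int[mu]_z \int[mu2]_q (phi z * \1_Y (q, z))%:E.
Proof.
move=> mY; rewrite /weight integral_mkcond.
transitivity (\int[mu2 \x mu]_p (phi p.2 * \1_Y p)%:E).
  apply: eq_integral => p _; rewrite patchE indicE; case: (p \in Y).
    by rewrite mulr1.
  by rewrite mulr0.
rewrite (@fubini_tonelli2 _ _ _ _ _ mu2 mu)//.
- apply/measurable_EFinP; apply: measurable_funM; first exact: measurableT_comp.
  exact: measurable_indic.
- by move=> p; rewrite lee_fin mulr_ge0.
Qed.

Lemma measurable_sqdist_le (u : R * R) (t : R) :
  measurable [set q : R * R | (sqdist2 q u <= t)%R].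
Proof.
rewrite -[X in measurable X]setTI; apply: measurable_fun_ler => //.
apply: measurable_funD; apply: measurable_funX; exact: measurable_funB.
Qed.

Lemma leb2_disc (u : R * R) (t : R) :
  mu2 [set q : R * R | (sqdist2 q u <= t)%R] = (pi * Num.max t 0)%:E.
Proof.
have mD : measurable [set q : R * R | (sqdist2 q u <= t)%R] by exact: measurable_sqdist_le.
transitivity (\int[mu2]_q (\1_[set q : R * R | (sqdist2 q u <= t)%R] q)%:E).
  by rewrite integral_indic// setIT.
transitivity (\int[mu2]_q (\1_[set q : R * R | (sqdist2 q u <= t)%R] (q.1 + u.1, q.2 + u.2)%R)%:E).
  apply/esym/(@ge0_integral_shift2 _ u (fun q => (\1_[set q : R * R | (sqdist2 q u <= t)%R] q)%:E)).
    exact/measurable_EFinP/measurable_indic.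
  by move=> x; rewrite lee_fin.
transitivity (\int[mu2]_q (\1_[set q : R * R | (q.1 ^+ 2 + q.2 ^+ 2 <= t)%R] q)%:E).
  apply: eq_integral => q _; congr EFin; apply: eq_indic.
  by rewrite /sqdist2/= !addrK.
have mD' : measurable [set q : R * R | (q.1 ^+ 2 + q.2 ^+ 2 <= t)%R].
  rewrite -[X in measurable X]setTI; apply: measurable_fun_ler => //.
  by apply: measurable_funD; exact: measurable_funX.
rewrite integral_indic// setIT.
have [t0|t0] := leP t 0%R; last first.
  by rewrite -(lebesgue2_disc true) ?ltW.
move: t0; rewrite le_eqVlt => /predU1P[->|t0]; first exact: (lebesgue2_disc true).
rewrite mulr0 (_ : [set _ | _] = set0) ?measure0//; apply/seteqP; split => // q /=.
by have := sqr_ge0 q.1; have := sqr_ge0 q.2; lra.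
Qed.

Definition eball (u : R * R) (c r : R) : set (R * R * R) :=
  [set p | (sqdist2 p.1 u + (p.2 - c) ^+ 2 <= r ^+ 2)%R].

Lemma measurable_eball u c r : measurable (eball u c r).
Proof.
rewrite -[X in measurable X]setTI; apply: measurable_fun_ler => //.
apply: measurable_funD; last by apply: measurable_funX; exact: measurable_funB.
by apply: measurable_funD; apply: measurable_funX; apply: measurable_funB => //;
  exact: measurableT_comp.
Qed.

(** The slice of the ball at height [w + c] is a disc of area [pi * (r ^+ 2 - w ^+ 2)]. *)
Lemma weight_eball u c r : (0 <= r)%R ->
  weight (eball u c r) =
  pi%:E * \int[mu]_(w in `[(- r)%R, r]) (phi (w + c) * (r ^+ 2 - w ^+ 2))%:E.
Proof.
move=> r0; rewrite weight_iter; last exact: measurable_eball.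
pose g z := (phi z * (pi * Num.max (r ^+ 2 - (z - c) ^+ 2) 0))%R.
have g0 z : (0 <= g z)%R.
  by rewrite mulr_ge0 ?mulr_ge0 ?pi_ge0// le_max lexx orbT.
have mg : measurable_fun setT g.
  apply: measurable_funM => //; apply: measurable_funM => //.
  apply: measurable_maxr => //; apply: measurable_funB => //.
  by apply: measurable_funX; exact: measurable_funB.
transitivity (\int[mu]_z (g z)%:E).
  apply: eq_integral => z _.
  rewrite /g EFinM -(leb2_disc u) -ge0_integralZl_indic//; last exact: measurable_sqdist_le.
  apply: eq_integral => q _; congr (_ * _)%:E; apply: eq_indic.
  by rewrite /eball/= lerBrDr.
rewrite -[LHS](ge0_integral_shift c)//; last exact/measurable_EFinP.
rewrite -ge0_integralZl//; last 3 first.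
- apply/measurable_EFinP; apply: measurable_funTS; apply: measurable_funM.
    by apply: measurableT_comp => //; exact: measurable_funD.
  by apply: measurable_funB => //; exact: measurable_funX.
- move=> x; rewrite /= in_itv/= -ler_norml => xr; rewrite lee_fin mulr_ge0// subr_ge0.
  by rewrite -(real_normK (num_real x)) ler_pXn2r// nnegrE.
- by rewrite lee_fin pi_ge0.
rewrite [RHS]integral_mkcond; apply: eq_integral => w _; rewrite patchE mem_setE in_itv/=.
rewrite /g addrK -ler_norml; case: ifPn => wr.
  rewrite max_l; first by rewrite -EFinM mulrCA.
  by rewrite subr_ge0 -(real_normK (num_real w)) ler_pXn2r// nnegrE.
rewrite max_r ?mulr0// subr_le0 -(real_normK (num_real w)) ler_pXn2r ?nnegrE//.
by rewrite ltW// ltNge.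
Qed.
End slices.

Section cap.
Context {R : realType}.
Local Notation mu := (@lebesgue_measure R).
Local Notation mu2 := (@leb2M R).
Variable phi : R -> R.
Hypotheses (mphi : measurable_fun setT phi) (phi0 : forall z, 0 <= phi z).
Variables (c r p q w0 : R) (b : bool).
Hypotheses (r0 : 0 <= r) (pq1 : q ^+ 2 + p ^+ 2 = 1).
Local Open Scope ereal_scope.

(** The part of the ball of radius [r] around [(0, 0, c)] beyond the plane at signed distance [w0]
    from the centre in the unit direction [(p, 0, q)]; [b] tells whether the plane itself is
    included. *)
Definition cap : set (R * R * R) :=
  [set x | (x.1.1 ^+ 2 + x.1.2 ^+ 2 + (x.2 - c) ^+ 2 <= r ^+ 2)%R /\
           (w0 < x.1.1 * p + (x.2 - c) * q ?<= if b)%R].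

(** The inner double integral of [Ffun]: the slice orthogonal to the axis is a disc, here in polar
    coordinates. *)
Definition cap_slice (w : R) : \bar R :=
  \int[mu]_(th in `[0%R, (2 * pi)%R]) \int[mu]_(rho in `[0%R, Num.sqrt (r ^+ 2 - w ^+ 2)])
    (phi (c + w * q - rho * cos th * p) * rho)%:E.

Lemma measurable_lteif d (T : measurableType d) (f g : T -> R) :
  measurable_fun setT f -> measurable_fun setT g ->
  measurable [set x | (f x < g x ?<= if b)%R].
Proof.
move=> mf mg; rewrite -[X in measurable X]setTI; case: b => /=.
  exact: measurable_fun_ler.
exact: measurable_fun_ltr.
Qed.

Ltac mea := repeat first [by [] | apply: measurable_funD | apply: measurable_funB
  | apply: measurable_funM | apply: measurable_funX | apply: measurableT_comp mphi _
  | apply: measurable_fun_pair | apply: measurableT_comp].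

Lemma measurable_cap : measurable cap.
Proof.
apply: measurableI; last by apply: measurable_lteif => //; mea.
by rewrite -[X in measurable X]setTI; apply: measurable_fun_ler; mea.
Qed.

Let mI : measurable_fun setT (\1_cap : R * R * R -> R).
Proof. exact: measurable_indic measurable_cap. Qed.

(** The cap in rotated coordinates, where its axis is the first coordinate. *)
Let S : set (R * R * R) :=
  [set x | (x.1.1 ^+ 2 + x.1.2 ^+ 2 + x.2 ^+ 2 <= r ^+ 2)%R /\ (w0 < x.1.1 ?<= if b)%R].

Let mS : measurable S.
Proof.
apply: measurableI; last by apply: measurable_lteif => //; mea.
by rewrite -[X in measurable X]setTI; apply: measurable_fun_ler; mea.
Qed.

Let K (x : R * R * R) : \bar R := (phi (c + x.1.1 * q - x.1.2 * p) * \1_S x)%:E.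

Let mK : measurable_fun setT K.
Proof.
apply/measurable_EFinP; apply: measurable_funM; last exact: measurable_indic.
by apply: measurableT_comp => //; mea.
Qed.

Let K0 x : 0 <= K x. Proof. by rewrite lee_fin mulr_ge0. Qed.

Let mKw w : measurable_fun setT (fun uv : R * R => K ((w, uv.1), uv.2)).
Proof.
have m1 : measurable_fun setT (fun uv : R * R => ((w, uv.1), uv.2)) by mea.
exact: measurableT_comp mK m1.
Qed.

Let cap_sliceE w : (w0 < w ?<= if b)%R ->
  cap_slice w = \int[mu2]_uv K ((w, uv.1), uv.2).
Proof.
move=> w0w; rewrite [RHS]ge0_integral_polar//.
apply: eq_integral => th _; rewrite integral_mkcond [RHS]integral_mkcond.
apply: eq_integral => rho _; rewrite !patchE !mem_setE !in_itv/= andbT.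
have [rho0|//] := leP 0%R rho; rewrite /=.
(* When [r ^+ 2 < w ^+ 2] the square root is 0, so [rho = 0] satisfies the bound although the slice
   is empty; the factor [rho] makes both sides vanish there. *)
have [->|rhoN0] := eqVneq rho 0%R; first by rewrite !mulr0 mule0 if_same.
have {rhoN0}rho_gt0 : (0 < rho)%R by rewrite lt_neqAle eq_sym rhoN0.
have -> : (rho <= Num.sqrt (r ^+ 2 - w ^+ 2))%R = (((w, rho * cos th), rho * sin th)%R \in S).
  have -> : (((w, rho * cos th), rho * sin th)%R \in S) = (rho ^+ 2 <= r ^+ 2 - w ^+ 2)%R.
    have E : (w ^+ 2 + (rho * cos th) ^+ 2 + (rho * sin th) ^+ 2 = w ^+ 2 + rho ^+ 2)%R.
      by rewrite !exprMn (cos2sin2 th); ring.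
    by apply/idP/idP; rewrite inE /S/= E lerBrDl// => -[].
  have [u0|u0] := ltP (r ^+ 2 - w ^+ 2)%R 0%R.
    by rewrite ler0_sqrtr; [rewrite !leNgt rho_gt0 (lt_le_trans u0)// sqr_ge0|exact: ltW].
  by rewrite -(ler_sqrt _ u0) sqrtr_sqr ger0_norm.
by rewrite /K/= indicE; case: ifPn => _; rewrite ?mulr1 ?mulr0 ?mul0e// -EFinM.
Qed.

Let D : set R := [set` Interval (BSide b w0) (BRight r)].

Let cap_slice_out w : ~ D w -> \int[mu2]_uv K ((w, uv.1), uv.2) = 0.
Proof.
move=> Dw; rewrite integral0_eq// => -[u v] _; rewrite /K/= indicE memNset ?mulr0//.
move=> [/= h w0w]; apply: Dw; rewrite /D/= itv_boundlr/=; apply/andP; split.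
  by move: w0w; case: b.
rewrite bnd_simp.
have : (w ^+ 2 <= r ^+ 2)%R by have := sqr_ge0 u; have := sqr_ge0 v; lra.
rewrite -(real_normK (num_real w)) ler_pXn2r ?nnegrE// => wr.
exact: le_trans (ler_norm w) wr.
Qed.

Let L (zx : R * R) : \bar R := \int[mu]_v (phi (zx.1 + c) * \1_cap ((zx.2, v), zx.1 + c)%R)%:E.

Let mC : measurable_fun setT (fun x : R * R * R =>
  (phi (x.1.1 + c) * \1_cap ((x.1.2, x.2), x.1.1 + c)%R)%:E).
Proof.
apply/measurable_EFinP; apply: measurable_funM; first by apply: measurableT_comp => //; mea.
have m1 : measurable_fun setT (fun x : R * R * R => ((x.1.2, x.2), x.1.1 + c)%R) by mea.
exact: measurableT_comp mI m1.
Qed.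

Let mL : measurable_fun setT L.
Proof.
apply: (@measurable_integral_in _ _ _ _ _ mu (fun x : R * R * R =>
  (phi (x.1.1 + c) * \1_cap ((x.1.2, x.2), x.1.1 + c)%R)%:E)) => // x.
by rewrite lee_fin mulr_ge0.
Qed.

(** The rotation [rot q p] acts on the pair formed by the height relative to [c] and the first
    coordinate. It carries the axis of the cap to a coordinate axis, after which Tonelli cuts the
    cap into the discs of [cap_slice]. *)
Lemma weight_cap : weight phi cap = \int[mu]_(w in D) cap_slice w.
Proof.
transitivity (\int[mu]_w \int[mu2]_uv K ((w, uv.1), uv.2)); last first.
  rewrite [RHS]integral_mkcond; apply: eq_integral => w _; rewrite patchE.
  case: ifPn; rewrite ?inE ?notin_setE => wD; last exact: cap_slice_out.
  rewrite cap_sliceE//; move: wD; rewrite /D/= itv_boundlr/= => /andP[+ _].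
  by case: b.
transitivity (\int[mu2]_wu \int[mu]_v K (wu, v)); last first.
  have mKv : measurable_fun setT (fun wu : R * R => \int[mu]_v K (wu, v)).
    exact: (@measurable_integral_in _ _ _ _ _ mu K).
  have Kv0 (wu : R * R) : 0 <= \int[mu]_v K (wu, v) by exact: integral_ge0.
  apply: etrans (@fubini_tonelli1 _ _ _ _ _ mu mu _ mKv Kv0) _.
  apply: eq_integral => w _; rewrite /fubini_F.
  exact/esym/(@fubini_tonelli1 _ _ _ _ _ mu mu _ (mKw w) (fun uv => K0 _)).
transitivity (\int[mu2]_wu L (rot q p wu)); last first.
  apply: eq_integral => -[w u] _; apply: eq_integral => v _; rewrite /K /rot/=.
  congr EFin; congr (_ * _)%R; first by congr phi; ring.
  apply: eq_indic; rewrite /cap /S/= addrK.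
  have -> : ((p * w + q * u) ^+ 2 + v ^+ 2 + (q * w - p * u) ^+ 2 = (w ^+ 2 + u ^+ 2) * (q ^+ 2 + p ^+ 2) + v ^+ 2)%R.
    by ring.
  have -> : ((p * w + q * u) * p + (q * w - p * u) * q = w * (q ^+ 2 + p ^+ 2))%R by ring.
  by rewrite pq1 !mulr1.
rewrite [RHS](ge0_integral_rot pq1 mL); last first.
  by move=> x; apply: integral_ge0 => v _; rewrite lee_fin mulr_ge0.
have L0 x : 0 <= L x by apply: integral_ge0 => v _; rewrite lee_fin mulr_ge0.
apply/esym; apply: etrans (@fubini_tonelli1 _ _ _ _ _ mu mu L mL L0) _; apply/esym.
rewrite weight_iter//; last exact: measurable_cap.
have mJ : measurable_fun setT (fun x : R * (R * R) => (phi x.1 * \1_cap (x.2, x.1))%:E).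
  apply/measurable_EFinP; apply: measurable_funM; first exact: measurableT_comp.
  have m1 : measurable_fun setT (fun x : R * (R * R) => (x.2, x.1)) by mea.
  exact: measurableT_comp mI m1.
rewrite -[LHS](ge0_integral_shift c); last 2 first.
- apply: (@measurable_integral_in _ _ _ _ _ mu2 (fun x : R * (R * R) => (phi x.1 * \1_cap (x.2, x.1))%:E)) => // x.
  by rewrite lee_fin mulr_ge0.
- by move=> z; apply: integral_ge0 => v _; rewrite lee_fin mulr_ge0.
apply: eq_integral => z _; rewrite /fubini_F /L.
apply: (@fubini_tonelli1 _ _ _ _ _ mu mu (fun xv => (phi (z + c) * \1_cap (xv, z + c)%R)%:E)).
  apply/measurable_EFinP; apply: measurable_funM => //.
  have m1 : measurable_fun setT (fun x : R * R => (x, z + c)%R) by mea.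
  exact: measurableT_comp mI m1.
by move=> xv; rewrite lee_fin mulr_ge0.
Qed.
End cap.

(** * Real-valued iterated integrals *)

Section fine_integral.
Context d (T : measurableType d) (R : realType) (m : {measure set T -> \bar R}).
Local Open Scope ereal_scope.

Lemma ge0_integral_lty_ae (D : set T) (H : T -> \bar R) : measurable D ->
  measurable_fun D H -> (forall x, D x -> 0 <= H x) -> \int[m]_(x in D) H x < +oo ->
  {ae m, forall x, D x -> H x \is a fin_num}.
Proof.
move=> mD mH H0 Hoo; apply: integrable_ae => //; apply/integrableP; split => //.
by under eq_integral => x /[!inE] Dx do rewrite gee0_abs ?H0//.
Qed.

(** [fine] alters [H] only where it is infinite, a null set since the total is finite. *)
Lemma integral_fine_lty (D : set T) (H : T -> \bar R) : measurable D ->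
  measurable_fun D H -> (forall x, D x -> 0 <= H x) -> \int[m]_(x in D) H x < +oo ->
  \int[m]_(x in D) (fine (H x))%:E = \int[m]_(x in D) H x.
Proof.
move=> mD mH H0 Hoo; apply: ae_eq_integral => //.
  by apply/measurable_EFinP; exact: measurableT_comp (fine_measurable measurableT) mH.
have := ge0_integral_lty_ae mD mH H0 Hoo.
by apply: filterS => x /[swap] /[dup] Dx + /(_ Dx) => _ /fineK.
Qed.
End fine_integral.

Section Rint_cap.
Context {R : realType}.
Local Notation mu := (@lebesgue_measure R).
Variable phi : R -> R.
Hypotheses (mphi : measurable_fun setT phi) (phi0 : forall z, 0 <= phi z).
Variables (c r p q : R).
Local Open Scope ereal_scope.

Let h (wt : R * R) : \bar R :=
  \int[mu]_(rho in `[0%R, Num.sqrt (r ^+ 2 - wt.1 ^+ 2)])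
    (phi (c + wt.1 * q - rho * cos wt.2 * p) * rho)%:E.

Let h0 wt : 0 <= h wt.
Proof.
apply: integral_ge0 => rho /=; rewrite in_itv/= => /andP[rho0 _].
by rewrite lee_fin mulr_ge0.
Qed.

Ltac mea := repeat first [by [] | apply: measurable_funD | apply: measurable_funB
  | apply: measurable_funM | apply: measurable_funX | apply: measurable_fun_pair
  | apply: (measurableT_comp measurable_cos) | apply: measurableT_comp].

Let mh : measurable_fun setT h.
Proof.
pose A : set (R * R * R) := [set x | (0 <= x.2)%R /\ (x.2 <= Num.sqrt (r ^+ 2 - x.1.1 ^+ 2))%R].
have mA : measurable A.
  apply: measurableI; rewrite -[X in measurable X]setTI; apply: measurable_fun_ler => //.
  apply: (measurableT_comp (continuous_measurable_fun (@sqrt_continuous R))); mea.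
pose k (x : R * R * R) : \bar R :=
  (phi (c + x.1.1 * q - x.2 * cos x.1.2 * p) * Num.max x.2 0 * \1_A x)%:E.
have mk : measurable_fun setT k.
  apply/measurable_EFinP; apply: measurable_funM; last exact: measurable_indic.
  apply: measurable_funM; last exact: measurable_maxr.
  by apply: (measurableT_comp mphi); mea.
have k0 x : 0 <= k x by rewrite lee_fin !mulr_ge0// le_max lexx orbT.
have := @measurable_integral_in _ _ _ _ _ mu k setT measurableT mk k0.
apply: eq_measurable_fun => wt _; rewrite /h [RHS]integral_mkcond.
apply: eq_integral => rho _; rewrite patchE /k mem_setE in_itv/= indicE.
case: ifPn => [/andP[h1 h2]|hn]; first by rewrite mem_set//= mulr1 max_l.
by rewrite memNset ?mulr0// => -[/= h1 h2]; move: hn; rewrite h1 h2.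
Qed.

Let H w : \bar R := \int[mu]_(t in `[0%R, (2 * pi)%R]) h (w, t).

Let mH : measurable_fun setT H.
Proof. exact: (@measurable_integral_in _ _ _ _ _ mu h). Qed.

Lemma measurable_cap_slice : measurable_fun setT (cap_slice phi c r p q).
Proof. exact: mH. Qed.

Lemma cap_slice_ge0 w : 0 <= cap_slice phi c r p q w.
Proof. by apply: integral_ge0 => t _; exact: (h0 (w, t)). Qed.

Lemma Rint_cap w0 : \int[mu]_(w in `[w0, r]) cap_slice phi c r p q w < +oo ->
  (Defs.Rint w0 r (fun w => Defs.Rint 0 (2 * pi) (fun th =>
    Defs.Rint 0 (Num.sqrt (r ^+ 2 - w ^+ 2)) (fun rho =>
      phi (c + w * q - rho * cos th * p) * rho))))%R =
  fine (\int[mu]_(w in `[w0, r]) cap_slice phi c r p q w).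
Proof.
move=> Hoo; congr fine.
have mfh : measurable_fun setT (fun x : R * R => (fine (h x))%:E).
  by apply/measurable_EFinP; exact: measurableT_comp (fine_measurable measurableT) mh.
have mfh' : measurable_fun setT (fun w => \int[mu]_(t in `[0%R, (2 * pi)%R]) (fine (h (w, t)))%:E).
  apply: (@measurable_integral_in _ _ _ _ _ mu (fun x : R * R => (fine (h x))%:E)) => // x.
  by rewrite lee_fin fine_ge0.
apply: ae_eq_integral => //.
- apply/measurable_EFinP; apply: measurable_funTS.
  exact: measurableT_comp (fine_measurable measurableT) mfh'.
- exact: measurable_funTS measurable_cap_slice.
- have : {ae mu, forall x, `[w0, r]%classic x -> cap_slice phi c r p q x \is a fin_num}.
    apply: ge0_integral_lty_ae => //; first exact: measurable_funTS measurable_cap_slice.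
    by move=> x _; exact: cap_slice_ge0.
  apply: (@filterS _ _ (ae_filter_ringOfSetsType mu)) => w /[swap] /[dup] Dw + /(_ Dw) => _ Hw.
  rewrite -[RHS](fineK Hw); congr (fine _)%:E.
  apply: (@integral_fine_lty _ _ _ mu _ (fun t => h (w, t))) => //.
  + have m1 : measurable_fun setT (fun t : R => (w, t)) by mea.
    exact: measurable_funTS (measurableT_comp mh m1).
  + by move: Hw; rewrite ge0_fin_numE// cap_slice_ge0.
Qed.

End Rint_cap.

Section weight_measure.
Context {R : realType}.
Local Notation mu := (@lebesgue_measure R).
Local Notation mu2 := (@leb2M R).
Variable phi : R -> R.
Hypotheses (mphi : measurable_fun setT phi) (phi0 : forall z, 0 <= phi z).
Local Open Scope ereal_scope.

Let msnd : measurable_fun setT (fun p : R * R * R => phi p.2).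
Proof. exact: measurableT_comp. Qed.

Definition weight_measure := density_measure (sfprod mu2 mu) msnd (fun p => phi0 p.2).

Lemma weight_measureE Y : weight_measure Y = weight phi Y. Proof. by []. Qed.

(** The density depends on the height alone, so it does not see a measure-preserving map of the
    plane. *)
Lemma weight_transport (h : R * R -> R * R) (Y : set (R * R * R)) :
  measurable_fun setT h ->
  (forall g : R * R -> \bar R, measurable_fun setT g -> (forall x, 0 <= g x) ->
     \int[mu2]_x g (h x) = \int[mu2]_x g x) ->
  measurable Y -> weight phi [set p | Y (h p.1, p.2)] = weight phi Y.
Proof.
move=> mh hE mY.
have mY' : measurable [set p : R * R * R | Y (h p.1, p.2)].
  have m1 : measurable_fun setT (fun p : R * R * R => (h p.1, p.2)).
    by apply: measurable_fun_pair => //; exact: measurableT_comp.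
  by rewrite -[X in measurable X]setTI; exact: m1.
rewrite !weight_iter//; apply: eq_integral => z _.
transitivity (\int[mu2]_q (phi z * \1_Y (h q, z))%:E).
  by apply: eq_integral => q _; congr (_ * _)%:E; exact: eq_indic.
apply: (hE (fun q => (phi z * \1_Y (q, z))%:E)); last first.
  by move=> x; rewrite lee_fin mulr_ge0.
have m1 : measurable_fun setT (fun x : R * R => (x, z)) by exact: measurable_fun_pair.
have m2 : measurable_fun setT (\1_Y : R * R * R -> R) by exact: measurable_indic.
apply/measurable_EFinP; apply: measurable_funM => //.
exact: measurableT_comp m2 m1.
Qed.

Lemma ge0_integral_reflect (s : R) (g : R * R -> \bar R) :
  measurable_fun setT g -> (forall x, 0 <= g x) ->
  \int[mu2]_x g (s - x.1, x.2)%R = \int[mu2]_x g x.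
Proof.
move=> mg g0.
have m1 : measurable_fun setT (fun x : R * R => (s - x.1, x.2)%R).
  by apply: measurable_fun_pair => //; exact: measurable_funB.
apply: etrans (@fubini_tonelli2 _ _ _ _ _ mu mu _ (measurableT_comp mg m1) (fun x => g0 _)) _.
apply/esym; apply: etrans (@fubini_tonelli2 _ _ _ _ _ mu mu _ mg g0) _; apply/esym.
apply: eq_integral => y _; apply: (@ge0_integral_sub _ s (fun x => g (x, y))) => //.
have m2 : measurable_fun setT (fun x : R => (x, y)) by exact: measurable_fun_pair.
exact: measurableT_comp mg m2.
Qed.

Lemma weight_eball_lty u c r : (0 <= r)%R -> \int[mu]_z (phi z)%:E < +oo ->
  weight phi (eball u c r) < +oo.
Proof.
move=> r0 phioo; rewrite weight_eball//.
rewrite lte_mul_pinfty// ?lee_fin ?pi_ge0//.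
have msh : measurable_fun setT (fun w : R => phi (w + c)).
  by apply: measurableT_comp => //; exact: measurable_funD.
apply: (@le_lt_trans _ _ (\int[mu]_w ((phi (w + c))%:E * (r ^+ 2)%:E))).
  rewrite integral_mkcond; apply: ge0_le_integral => //.
  - move=> w _; rewrite patchE mem_setE in_itv/= -ler_norml; case: ifPn => // wr.
    rewrite lee_fin mulr_ge0// subr_ge0 -(real_normK (num_real w)).
    by rewrite ler_pXn2r// nnegrE.
  - apply/(measurable_restrictT _ _).1 => //; apply/measurable_EFinP; apply: measurable_funTS.
    by apply: measurable_funM => //; apply: measurable_funB => //; exact: measurable_funX.
  - by apply: emeasurable_funM => //; exact/measurable_EFinP.
  - move=> w _; rewrite patchE; case: ifPn => _.
      by rewrite lee_fin ler_wpM2l// lerBlDr lerDl sqr_ge0.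
    by rewrite -EFinM lee_fin mulr_ge0// sqr_ge0.
have msE : measurable_fun setT (fun w : R => (phi (w + c))%:E) by exact/measurable_EFinP.
rewrite ge0_integralZr//; last by rewrite lee_fin sqr_ge0.
  rewrite (ge0_integral_shift c (f := fun z => (phi z)%:E))//; last exact/measurable_EFinP.
  have i0 : 0 <= \int[mu]_z (phi z)%:E by apply: integral_ge0 => x _; rewrite lee_fin.
  by rewrite lte_mul_pinfty ?ge0_fin_numE ?ltry.
by move=> x _; rewrite lee_fin.
Qed.

End weight_measure.

(** * Union of two hyperbolic balls *)

Lemma fine_pmulEFin (R : realType) (k : R) (x : \bar R) : 0 < k ->
  fine (k%:E * x)%E = k * fine x.
Proof.
move=> k0; case: x => [x| |] //=; first by rewrite mulry gtr0_sg// mul1e mulr0.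
by rewrite mulrNy gtr0_sg// mul1e mulr0.
Qed.

Section lens.
Context {R : realType}.
Local Notation mu := (@lebesgue_measure R).
Variable phi : R -> R.
Hypotheses (mphi : measurable_fun setT phi) (phi0 : forall z, 0 <= phi z).
Hypothesis phioo : (\int[mu]_z (phi z)%:E < +oo)%E.
Variables (s d c ct r rt : R).
Hypotheses (r0 : 0 <= r) (rt0 : 0 <= rt) (d0 : 0 < d) (dE : d ^+ 2 = s ^+ 2 + (ct - c) ^+ 2).

Let p := s / d.
Let q := (ct - c) / d.
Let h := (rt - r + d) * (r + rt - d) / (2 * d).
Let ht := (r - rt + d) * (r + rt - d) / (2 * d).

Let B1 := eball (0, 0) c r.
Let B2 := eball (s, 0) ct rt.
Let C1 := cap c r p q (r - h) true.
(** The reflection [x1 -> s - x1] brings the second centre above the origin, with the direction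
    [(p, 0, - q)] towards the first one: the standard position of [cap]. The flags [true] and
    [false] give the radical plane to [C1] alone, which makes the caps disjoint. *)
Let C2 := [set x : R * R * R | cap ct rt p (- q) (rt - ht) false ((s - x.1.1, x.1.2), x.2)].

Let dp : p * d = s. Proof. by rewrite /p divfK// gt_eqF. Qed.
Let dq : q * d = ct - c. Proof. by rewrite /q divfK// gt_eqF. Qed.

Lemma lens_unit : q ^+ 2 + p ^+ 2 = 1.
Proof.
have d2 : d ^+ 2 != 0 by rewrite expf_neq0// gt_eqF.
by apply: (mulIf d2); rewrite mulrDl mul1r -!exprMn dp dq dE addrC.
Qed.

(** Thus [r - h] is the signed distance from the first centre to the radical plane. *)
Let w0E : 2 * d * (r - h) = d ^+ 2 + r ^+ 2 - rt ^+ 2.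
Proof.
have d2 : 2 * d != 0 by rewrite gt_eqF// mulr_gt0.
by rewrite mulrBr /h mulrC [X in _ - X]mulrC divfK//; ring.
Qed.

Let wt0E : 2 * d * (rt - ht) = d ^+ 2 + rt ^+ 2 - r ^+ 2.
Proof.
have d2 : 2 * d != 0 by rewrite gt_eqF// mulr_gt0.
by rewrite mulrBr /ht mulrC [X in _ - X]mulrC divfK//; ring.
Qed.

Let dpos : 0 < 2 * d. Proof. by rewrite mulr_gt0. Qed.

(* Both caps are cut out by the radical plane of the two spheres. *)
Let radical (x1 x2 z : R) : 2 * d * (x1 * p + (z - c) * q - (r - h)) =
  (x1 ^+ 2 + x2 ^+ 2 + (z - c) ^+ 2 - r ^+ 2) -
  ((x1 - s) ^+ 2 + x2 ^+ 2 + (z - ct) ^+ 2 - rt ^+ 2).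
Proof.
have -> : 2 * d * (x1 * p + (z - c) * q - (r - h)) =
  2 * x1 * (p * d) + 2 * (z - c) * (q * d) - 2 * d * (r - h) by ring.
by rewrite w0E dp dq dE; ring.
Qed.

Let radicalt (x1 x2 z : R) : 2 * d * ((s - x1) * p + (z - ct) * - q - (rt - ht)) =
  ((x1 - s) ^+ 2 + x2 ^+ 2 + (z - ct) ^+ 2 - rt ^+ 2) -
  (x1 ^+ 2 + x2 ^+ 2 + (z - c) ^+ 2 - r ^+ 2).
Proof.
have -> : 2 * d * ((s - x1) * p + (z - ct) * - q - (rt - ht)) =
  2 * (s - x1) * (p * d) - 2 * (z - ct) * (q * d) - 2 * d * (rt - ht) by ring.
by rewrite wt0E dp dq dE; ring.
Qed.

(** A point is in both balls iff the larger of its powers with respect to the two spheres is at most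
    0, and the side of the radical plane tells which power is larger. *)
Let lensE : B1 `&` B2 = C1 `|` C2.
Proof.
apply/seteqP; split => [[[x1 x2] z]|[[x1 x2] z]];
  rewrite /B1 /B2 /C1 /C2 /eball /cap /sqdist2 /= ?subr0;
  have := radical x1 x2 z; have := radicalt x1 x2 z;
  set A := x1 * p + _; set A' := (s - x1) * p + _ => E E'.
- move=> [h1 h2]; have [h3|h3] := leP (r - h) A; [by left|right; split; first by lra].
  have : 2 * d * (A - (r - h)) < 0 by rewrite pmulr_rlt0// subr_lt0.
  rewrite E' => h4; have : 0 < 2 * d * (A' - (rt - ht)) by rewrite E; lra.
  by rewrite pmulr_rgt0// subr_gt0.
- move=> [[h1 h2]|[h1 h2]].
    split => //; have : 0 <= 2 * d * (A - (r - h)) by rewrite pmulr_rge0// subr_ge0.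
    by rewrite E'; lra.
  have : 0 < 2 * d * (A' - (rt - ht)) by rewrite pmulr_rgt0// subr_gt0.
  by rewrite E => h3; split; lra.
Qed.

Let lens_disj : [disjoint C1 & C2].
Proof.
apply/disj_setPLR => -[[x1 x2] z]; rewrite /C1 /C2 /cap /=.
have := radical x1 x2 z; have := radicalt x1 x2 z.
set A := x1 * p + _; set A' := (s - x1) * p + _ => E E' [_ h1] [_ h2].
have : 0 <= 2 * d * (A - (r - h)) by rewrite pmulr_rge0// subr_ge0.
have : 0 < 2 * d * (A' - (rt - ht)) by rewrite pmulr_rgt0// subr_gt0.
by rewrite E E'; lra.
Qed.

Let mrefl : measurable_fun setT (fun x : R * R => (s - x.1, x.2)).
Proof. by apply: measurable_fun_pair => //; exact: measurable_funB. Qed.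

Let mC1 : measurable C1. Proof. exact: measurable_cap. Qed.
Let mC2 : measurable C2.
Proof.
have m1 : measurable_fun setT (fun x : R * R * R => ((s - x.1.1, x.1.2), x.2)).
  by apply: measurable_fun_pair => //; apply: (measurableT_comp mrefl).
by rewrite -[X in measurable X]setTI; apply: m1 => //; exact: measurable_cap.
Qed.

Let unitt : (- q) ^+ 2 + p ^+ 2 = 1. Proof. by rewrite sqrrN lens_unit. Qed.

Local Open Scope ereal_scope.

Let wC1 : weight phi C1 = \int[mu]_(w in `[(r - h)%R, r]) cap_slice phi c r p q w.
Proof. exact: (weight_cap mphi phi0 c (r - h)%R true r0 lens_unit). Qed.

Let wC2 : weight phi C2 = \int[mu]_(w in `[(rt - ht)%R, rt]) cap_slice phi ct rt p (- q) w.
Proof.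
rewrite (weight_transport mphi phi0 mrefl (@ge0_integral_reflect R s)); last exact: measurable_cap.
rewrite (weight_cap mphi phi0 ct (rt - ht)%R false rt0 unitt).
apply: (@integral_itv_obnd_cbnd _ (rt - ht)%R (BRight rt)).
exact: measurable_funTS (measurable_cap_slice mphi phi0 ct rt p (- q)%R).
Qed.

Let wB1oo : weight phi B1 < +oo. Proof. exact: weight_eball_lty. Qed.
Let wB2oo : weight phi B2 < +oo. Proof. exact: weight_eball_lty. Qed.

Lemma weight_lens_union : weight phi (B1 `|` B2) =
 (pi * Defs.Rint (- r) r (fun w => phi (w + c) * (r ^+ 2 - w ^+ 2))
  + pi * Defs.Rint (- rt) rt (fun w => phi (w + ct) * (rt ^+ 2 - w ^+ 2))
  - Defs.Rint (r - h) r (fun w => Defs.Rint 0 (2 * pi) (fun th =>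
      Defs.Rint 0 (Num.sqrt (r ^+ 2 - w ^+ 2)) (fun rho =>
        phi (c + w * q - rho * cos th * p) * rho)))
  - Defs.Rint (rt - ht) rt (fun w => Defs.Rint 0 (2 * pi) (fun th =>
      Defs.Rint 0 (Num.sqrt (rt ^+ 2 - w ^+ 2)) (fun rho =>
        phi (ct + w * - q - rho * cos th * p) * rho))))%:E.
Proof.
pose W := weight_measure mphi phi0.
have mB1 : measurable B1 by exact: measurable_eball.
have mB2 : measurable B2 by exact: measurable_eball.
have Wfin Y : measurable Y -> Y `<=` B1 `|` B2 -> W Y \is a fin_num.
  move=> mY YB; rewrite ge0_fin_numE//; apply: (@le_lt_trans _ _ (W (B1 `|` B2))).
    by apply: le_measure; rewrite ?inE//; exact: measurableU.
  by rewrite (le_lt_trans (measureU2 _ _ _))// lte_add_pinfty.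
have sub1 : C1 `<=` B1 `|` B2 by move=> x Cx; left; have [] : (B1 `&` B2) x by rewrite lensE; left.
have sub2 : C2 `<=` B1 `|` B2 by move=> x Cx; left; have [] : (B1 `&` B2) x by rewrite lensE; right.
have W1 := Wfin _ mB1 (@subsetUl _ _ _); have W2 := Wfin _ mB2 (@subsetUr _ _ _).
have WC1 := Wfin _ mC1 sub1; have WC2 := Wfin _ mC2 sub2.
have WU : W (B1 `|` B2) = W B1 + W B2 - (W C1 + W C2).
  rewrite measureUfinr//.
  by rewrite lensE measureU//; apply/disj_set2P.
rewrite -weight_measureE -/W WU.
rewrite -(fineK W1) -(fineK W2) -(fineK WC1) -(fineK WC2) -!EFinD; congr EFin.
rewrite opprD addrA; congr (_ + _ - _ - _)%R.
- by rewrite [W B1](weight_eball mphi phi0 (0, 0)%R c r0) fine_pmulEFin ?pi_gt0.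
- by rewrite [W B2](weight_eball mphi phi0 (s, 0)%R ct rt0) fine_pmulEFin ?pi_gt0.
- rewrite -[LHS]/(fine (weight phi C1)) wC1; apply/esym/Rint_cap => //.
  by rewrite -wC1 -ge0_fin_numE// integral_ge0// => x _; rewrite lee_fin.
- rewrite -[LHS]/(fine (weight phi C2)) wC2; apply/esym/Rint_cap => //.
  by rewrite -wC2 -ge0_fin_numE// integral_ge0// => x _; rewrite lee_fin.
Qed.
End lens.

(** * Hyperbolic cosine of the distance *)

Section hyperbolic.
Context {R : realType}.
Implicit Types (x s z zt : R).

Lemma acosh_arg_ge1 x : 1 <= x -> 1 <= x + Num.sqrt (x ^+ 2 - 1).
Proof. by move=> x1; have := sqrtr_ge0 (x ^+ 2 - 1); lra. Qed.

Lemma expR_acosh x : 1 <= x -> expR (acoshR x) = x + Num.sqrt (x ^+ 2 - 1).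
Proof.
by move=> x1; rewrite lnK// posrE (lt_le_trans ltr01)// acosh_arg_ge1.
Qed.

Lemma expRN_acosh x : 1 <= x -> expR (- acoshR x) = x - Num.sqrt (x ^+ 2 - 1).
Proof.
move=> x1; have h := acosh_arg_ge1 x1.
rewrite expRN expR_acosh//; apply: (@mulfI _ (x + Num.sqrt (x ^+ 2 - 1))); first by lra.
rewrite divff; last by lra.
rewrite mulrC -subr_sqr sqr_sqrtr; first by ring.
by rewrite subr_ge0 -(expr1n _ 2) ler_pXn2r ?nnegrE//; lra.
Qed.

Lemma coshK x : 1 <= x -> coshR (acoshR x) = x.
Proof. by move=> x1; rewrite /coshR expR_acosh// expRN_acosh//; lra. Qed.

Lemma sinh_acosh x : 1 <= x -> sinhR (acoshR x) = Num.sqrt (x ^+ 2 - 1).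
Proof. by move=> x1; rewrite /sinhR expR_acosh// expRN_acosh//; lra. Qed.

Definition cosh_dist s z zt := s ^+ 2 / (2 * z * zt) + (z / zt + zt / z) / 2.

Lemma cosh_distE s z zt : 0 < z -> 0 < zt ->
  cosh_dist s z zt = 1 + (s ^+ 2 + (z - zt) ^+ 2) / (2 * z * zt).
Proof. by move=> z0 zt0; rewrite /cosh_dist; field; rewrite !gt_eqF. Qed.

Lemma cosh_dist_ge1 s z zt : 0 < z -> 0 < zt -> 1 <= cosh_dist s z zt.
Proof.
move=> z0 zt0; rewrite cosh_distE// lerDl divr_ge0// ?addr_ge0 ?sqr_ge0//.
by rewrite !mulr_ge0// ltW.
Qed.

Lemma cosh_distC s z zt : cosh_dist s z zt = cosh_dist s zt z.
Proof. by rewrite /cosh_dist -!mulrA (mulrC z zt) (addrC (z / zt)). Qed.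

Lemma acoshR_mono x y : 1 <= x -> 1 <= y -> (acoshR x < acoshR y) = (x < y).
Proof.
move=> x1 y1; apply/idP/idP => [|xy].
  apply: contraTT; rewrite -!leNgt => yx.
  rewrite ler_ln ?posrE ?(lt_le_trans ltr01) ?acosh_arg_ge1//.
  rewrite lerD// ler_wsqrtr// lerB// ler_pXn2r ?nnegrE//; lra.
rewrite ltr_ln ?posrE ?(lt_le_trans ltr01) ?acosh_arg_ge1//.
rewrite ltr_leD// ler_wsqrtr// lerB// ler_pXn2r ?nnegrE//; lra.
Qed.

End hyperbolic.

Section nn_region.
Context {R : realType}.
Local Notation mu := (@lebesgue_measure R).
Implicit Types (a b c : pt R).

Definition sqdist3 a b : R := sqdist2 a.1 b.1 + (a.2 - b.2) ^+ 2.

(* For positive marks, c is at most as far from a as b is iff hdefect a b c <= 0. *)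
Definition hdefect a b c : R := sqdist3 a c * b.2 - sqdist3 a b * c.2.

Definition nn_region a b : set (pt R) :=
  [set c | hdefect a b c <= 0 \/ hdefect b a c <= 0].

Lemma sqdist2C u v : sqdist2 u v = sqdist2 v u :> R.
Proof. by rewrite /sqdist2; ring. Qed.

Lemma sqdist2_ge0 u v : 0 <= sqdist2 u v :> R.
Proof. by rewrite addr_ge0 ?sqr_ge0. Qed.

Lemma dH3E a b : dH3 a b = acoshR (cosh_dist (Num.sqrt (sqdist2 a.1 b.1)) a.2 b.2).
Proof. by rewrite /cosh_dist sqr_sqrtr// sqdist2_ge0. Qed.

(** [acoshR] increases on [[1, +oo[], and [cosh_dist] is 1 plus [sqdist3] divided by twice the
    product of the marks. Clearing the positive denominators leaves a polynomial inequality. *)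
Lemma dH3_lt a b c : 0 < a.2 -> 0 < b.2 -> 0 < c.2 ->
  (dH3 a b < dH3 a c) = (0 < hdefect a b c).
Proof.
move=> a0 b0 c0; rewrite !dH3E acoshR_mono ?cosh_dist_ge1// !cosh_distE// ltrD2l.
rewrite !sqr_sqrtr ?sqdist2_ge0// -!/(sqdist3 _ _) /hdefect subr_gt0.
rewrite ltr_pdivrMr ?mulr_gt0// mulrAC ltr_pdivlMr ?mulr_gt0//.
have -> : sqdist3 a b * (2 * a.2 * c.2) = (2 * a.2) * (sqdist3 a b * c.2) by ring.
have -> : sqdist3 a c * (2 * a.2 * b.2) = (2 * a.2) * (sqdist3 a c * b.2) by ring.
by rewrite ltr_pM2l// mulr_gt0.
Qed.

(** Completing the square in the height of [c] lifts the centre from [a.2] to [a.2 * X], where [X]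
    is the hyperbolic cosine of the radius. *)
Lemma hdefect_eball a b c : 0 < a.2 -> 0 < b.2 ->
  let X := cosh_dist (Num.sqrt (sqdist2 a.1 b.1)) a.2 b.2 in
  (hdefect a b c <= 0) = (sqdist2 c.1 a.1 + (c.2 - a.2 * X) ^+ 2 <= (a.2 * Num.sqrt (X ^+ 2 - 1)) ^+ 2).
Proof.
move=> a0 b0 X; have X1 : 1 <= X by exact: cosh_dist_ge1.
rewrite exprMn sqr_sqrtr; last first.
  by rewrite subr_ge0 -(expr1n _ 2) ler_pXn2r ?nnegrE//; lra.
have bX : b.2 * (2 * a.2 * (X - 1)) = sqdist3 a b.
  rewrite /X cosh_distE// sqr_sqrtr ?sqdist2_ge0// -/(sqdist3 a b).
  by field; rewrite !gt_eqF.
rewrite -[RHS]subr_le0 -[RHS](pmulr_rle0 _ b0).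
congr (_ <= 0); rewrite /hdefect -bX /sqdist3 (sqdist2C a.1); ring.
Qed.

Definition pt2 (x y z : R) : pt R := ((x, y), z).

Section canonical.
Variable f : R -> R.
Hypotheses (mphi : measurable_fun setT (fext f)) (phi0 : forall z, 0 <= fext f z).
Hypothesis phioo : (\int[mu]_z (fext f z)%:E < +oo)%E.

Lemma weight_nn_region0 (s z zt : R) : 0 < s -> 0 < z -> 0 < zt ->
  weight (fext f) (nn_region (pt2 0 0 z) (pt2 s 0 zt)) = (Ffun f s z zt)%:E.
Proof.
move=> s0 z0 zt0.
rewrite /Ffun -/(cosh_dist s z zt).
have X1 := cosh_dist_ge1 s z0 zt0.
rewrite !coshK// !sinh_acosh//.
set X := cosh_dist s z zt in X1 *; set S := Num.sqrt (X ^+ 2 - 1).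
have S0 : 0 <= S by exact: sqrtr_ge0.
set d := Num.sqrt (s ^+ 2 + (z - zt) ^+ 2 * X ^+ 2).
have dd : d ^+ 2 = s ^+ 2 + (zt * X - z * X) ^+ 2.
  rewrite sqr_sqrtr; first by ring.
  exact: addr_ge0 (sqr_ge0 _) (mulr_ge0 (sqr_ge0 _) (sqr_ge0 _)).
have d0 : 0 < d.
  rewrite sqrtr_gt0; apply: ltr_pwDl; first by rewrite exprn_gt0.
  by rewrite mulr_ge0 ?sqr_ge0.
have sE : Num.sqrt (sqdist2 (0 : R, 0 : R) (s, 0)) = s.
  have -> : sqdist2 (0 : R, 0 : R) (s, 0) = s ^+ 2 by rewrite /sqdist2/=; ring.
  by rewrite sqrtr_sqr gtr0_norm.
have -> : nn_region (pt2 0 0 z) (pt2 s 0 zt) =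
    eball (0, 0) (z * X) (z * S) `|` eball (s, 0) (zt * X) (zt * S).
  have H1 c : (hdefect (pt2 0 0 z) (pt2 s 0 zt) c <= 0) =
      (sqdist2 c.1 (0, 0) + (c.2 - z * X) ^+ 2 <= (z * S) ^+ 2).
    by rewrite (hdefect_eball c (a := pt2 0 0 z) (b := pt2 s 0 zt) z0 zt0) /= sE.
  have H2 c : (hdefect (pt2 s 0 zt) (pt2 0 0 z) c <= 0) =
      (sqdist2 c.1 (s, 0) + (c.2 - zt * X) ^+ 2 <= (zt * S) ^+ 2).
    rewrite (hdefect_eball c (a := pt2 s 0 zt) (b := pt2 0 0 z) zt0 z0) /=.
    by rewrite (sqdist2C (s, 0)) sE (cosh_distC s zt z).
  by apply/seteqP; split=> c; [case; rewrite ?H1 ?H2; [left|right]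
    |case=> h; [left; rewrite H1|right; rewrite H2]].
rewrite (weight_lens_union mphi phi0 phioo (mulr_ge0 (ltW z0) S0) (mulr_ge0 (ltW zt0) S0) d0 dd).
have unit := lens_unit d0 dd.
have unitt : ((z * X - zt * X) / d) ^+ 2 + (s / d) ^+ 2 = 1.
  by rewrite -[RHS]unit -(opprB (zt * X)) mulNr sqrrN.
have bound (q p : R) : q ^+ 2 + p ^+ 2 = 1 -> -1 <= q <= 1.
  move=> qp; rewrite -ler_norml -(@ler_pXn2r _ 2) ?nnegrE// real_normK ?num_real// expr1n.
  by have := sqr_ge0 p; lra.
(* The angle [pi / 2 - asin q] of [Ffun] has cosine [q] and sine [p], the components of the unit
   axis of the cap; the sine needs [p] nonnegative, here [s / d]. *)
have cosd (q p : R) : q ^+ 2 + p ^+ 2 = 1 -> cos (pi / 2 - asin q) = q.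
  by move=> qp; rewrite cosB cos_pihalf sin_pihalf mul0r add0r mul1r asinK// in_itv/= (bound _ _ qp).
have sind (q p : R) : 0 <= p -> q ^+ 2 + p ^+ 2 = 1 -> sin (pi / 2 - asin q) = p.
  move=> p0 qp; rewrite sinB cos_pihalf sin_pihalf mul0r subr0 mul1r cos_asin ?(bound _ _ qp)//.
  have -> : 1 - q ^+ 2 = p ^+ 2 by lra.
  by rewrite sqrtr_sqr ger0_norm.
have sd0 : 0 <= s / d by rewrite divr_ge0// ltW.
rewrite (cosd _ _ unit) (cosd _ _ unitt) (sind _ _ sd0 unit) (sind _ _ sd0 unitt).
by rewrite -(opprB (zt * X) (z * X)) mulNr.
Qed.

Lemma measurable_nn_region a b : measurable (nn_region a b).
Proof.
have mT a' b' : measurable [set c | hdefect a' b' c <= 0].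
  rewrite -[X in measurable X]setTI; apply: measurable_fun_ler => //.
  apply: measurable_funB; last exact: measurable_funM.
  apply: measurable_funM => //; apply: measurable_funD.
    by apply: measurable_funD; apply: measurable_funX; apply: measurable_funB => //;
      exact: measurableT_comp.
  by apply: measurable_funX; exact: measurable_funB.
by apply: measurableU; exact: mT.
Qed.

Lemma weight_nn_region a b : 0 < a.2 -> 0 < b.2 -> a.1 != b.1 ->
  weight (fext f) (nn_region a b) = (Ffun f (Num.sqrt (sqdist2 a.1 b.1)) a.2 b.2)%:E.
Proof.
move=> a0 b0 ab; set s := Num.sqrt _.
have ss : s ^+ 2 = sqdist2 a.1 b.1 by rewrite sqr_sqrtr// sqdist2_ge0.
have s0 : 0 < s.
  rewrite sqrtr_gt0 lt_neqAle sqdist2_ge0 andbT eq_sym; apply: contra ab.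
  rewrite paddr_eq0 ?sqr_ge0// !sqrf_eq0 !subr_eq0 => /andP[/eqP h1 /eqP h2].
  by rewrite (surjective_pairing a.1) h1 h2 -surjective_pairing.
pose e1 := (b.1.1 - a.1.1) / s; pose e2 := (b.1.2 - a.1.2) / s.
have e1s : e1 * s = b.1.1 - a.1.1 by rewrite /e1 divfK// gt_eqF.
have e2s : e2 * s = b.1.2 - a.1.2 by rewrite /e2 divfK// gt_eqF.
have s2 : s ^+ 2 != 0 by rewrite expf_neq0// gt_eqF.
have ee : e1 ^+ 2 + e2 ^+ 2 = 1.
  by apply: (mulIf s2); rewrite mulrDl -!exprMn e1s e2s mul1r ss /sqdist2; ring.
(* The planar isometry that takes [(0, 0)] to [a.1] and [(s, 0)] to [b.1]. *)
pose h (x : R * R) : R * R := ((rot e1 e2 x).1 + a.1.1, (rot e1 e2 x).2 + a.1.2).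
have mh : measurable_fun setT h.
  by apply: measurable_fun_pair; apply: measurable_funD => //; apply: measurableT_comp => //; exact: measurable_rot.
rewrite -weight_nn_region0//.
rewrite -(weight_transport mphi phi0 mh _ (measurable_nn_region a b)); last first.
  move=> g mg g0.
  have mg' : measurable_fun setT (fun x : R * R => g (x.1 + a.1.1, x.2 + a.1.2)).
    by apply: measurableT_comp => //; apply: measurable_fun_pair => //; exact: measurable_funD.
  rewrite -[RHS](ge0_integral_shift2 a.1)//.
  exact: (ge0_integral_rot ee mg').
congr (weight _ _); apply/seteqP.
have iso1 (x : R * R) : sqdist2 a.1 (h x) = sqdist2 (0, 0) x.
  transitivity ((e1 ^+ 2 + e2 ^+ 2) * (x.1 ^+ 2 + x.2 ^+ 2)); first by rewrite /sqdist2 /h /rot/=; ring.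
  by rewrite ee /sqdist2/=; ring.
have iso2 (x : R * R) : sqdist2 b.1 (h x) = sqdist2 (s, 0) x.
  transitivity ((e1 * s - (e1 * x.1 - e2 * x.2)) ^+ 2 + (e2 * s - (e2 * x.1 + e1 * x.2)) ^+ 2).
    by rewrite e1s e2s /sqdist2 /h /rot/=; ring.
  transitivity ((e1 ^+ 2 + e2 ^+ 2) * ((s - x.1) ^+ 2 + x.2 ^+ 2)); first by ring.
  by rewrite ee /sqdist2/=; ring.
have iso3 : sqdist2 a.1 b.1 = sqdist2 (0, 0) (s, 0) by rewrite -ss /sqdist2/=; ring.
have iso4 : sqdist2 b.1 a.1 = sqdist2 (s, 0) (0, 0) by rewrite sqdist2C -ss /sqdist2/=; ring.
by split => c; rewrite /nn_region /hdefect /sqdist3 /= iso1 iso2 iso3 iso4.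
Qed.
End canonical.
End nn_region.

(** * Point counts of a Poisson process *)

Section cardinality_as_esum.
Context {R : realType}.
Local Open Scope ereal_scope.

(** Counts not only points, as [count] does, but also pairs of points and pairs of cell indices. *)
Definition cnt (T : choiceType) (S : set T) : \bar R := \esum_(x in S) 1.

Lemma cnt_ge0 (T : choiceType) (S : set T) : 0 <= cnt S.
Proof. exact: esum_ge0. Qed.

Lemma cnt_finite (T : choiceType) (S : set T) : finite_set S ->
  cnt S = (#|` fset_set S|)%:R%:E.
Proof.
move=> fS; rewrite /cnt esum_fset// fsbig_finite//= sumEFin; congr EFin.
by rewrite big_const_seq count_predT -Monoid.iteropE.
Qed.

Lemma cnt_infinite (T : choiceType) (S : set T) : infinite_set S -> cnt S = +oo.
Proof.
move=> iS; apply/eqyP => r r0.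
have [A AS] := infinite_set_fset (Num.bound r) iS.
move=> rA; apply: esum_ge; exists [set` A]; first by split.
rewrite fsbig_finite//= sumEFin lee_fin set_fsetK.
rewrite big_const_seq count_predT -Monoid.iteropE.
apply: (@le_trans _ _ (Num.bound r)%:R).
  by rewrite ltW// archi_boundP// ltW.
by rewrite -[leRHS]/((size A)%:R) ler_nat.
Qed.

Lemma cnt_le (T : choiceType) (S S' : set T) : S `<=` S' -> cnt S <= cnt S'.
Proof.
move=> SS'; rewrite /cnt (esum_mkcond S) (esum_mkcond S'); apply: le_esum => x _.
case: ifPn => xS; first by rewrite mem_set//; apply: SS'; exact: set_mem.
by case: ifPn.
Qed.

Lemma cnt_eq0 (T : choiceType) (S : set T) : cnt S = 0 <-> S = set0.
Proof.
split => [S0|->]; last exact: esum_set0.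
apply/eqP; apply: contra_eqT (erefl true) => /set0P[x Sx].
have : cnt [set x] <= cnt S by apply: cnt_le => _ ->.
by rewrite S0 /cnt esum_set1// lee_fin ler10.
Qed.

Lemma cnt_set1 (T : choiceType) (x : T) : cnt [set x] = 1.
Proof. by rewrite /cnt esum_set1. Qed.

Lemma cnt_eq1 (T : choiceType) (S : set T) : cnt S = 1 <-> exists x, S = [set x].
Proof.
split=> [S1|[x ->]]; last by rewrite cnt_set1.
have [fS|iS] := pselect (finite_set S); last by move: S1; rewrite cnt_infinite.
move: S1; rewrite cnt_finite// => -[] /eqP; rewrite pnatr_eq1 => /cardfs1P[x Sx].
by exists x; rewrite -(fset_setK fS) Sx set_fset1.
Qed.

Lemma cnt_image (T T' : choiceType) (S : set T) (e : T -> T') : set_inj S e ->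
  cnt (e @` S) = cnt S.
Proof. by move=> einj; rewrite /cnt esum_image. Qed.

(** Writes the number of index pairs as a double series of indicators, to be integrated term by
    term. *)
Lemma cnt_natnat (J : set (nat * nat)) :
  cnt J = \sum_(i <oo) \sum_(j <oo) (\1_J (i, j))%:E.
Proof.
rewrite nneseries_esumT//; last by move=> i; apply: nneseries_ge0 => j _ _; rewrite lee_fin.
under eq_esum do rewrite nneseries_esumT//.
rewrite esum_esum//.
rewrite /cnt esum_mkcond (_ : (_ `*`` _) = setT); last by apply/seteqP; split.
by apply: eq_esum => -[i j] _; rewrite indicE; case: (_ \in J).
Qed.

End cardinality_as_esum.

Section poisson_series.
Context {R : realType}.
Local Open Scope ereal_scope.

Lemma poisson_pmf_ge0 (m : R) k : (0 <= m)%R -> (0 <= Defs.poisson_pmf m k)%R.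
Proof. by move=> m0; rewrite /Defs.poisson_pmf divr_ge0 ?mulr_ge0 ?expR_ge0 ?exprn_ge0. Qed.

Lemma poisson_pmf_sum (m : R) : (0 <= m)%R ->
  \sum_(k <oo) (Defs.poisson_pmf m k)%:E = 1.
Proof.
move=> m0.
transitivity ((expR (- m))%:E * \sum_(k <oo) (m ^+ k / k`!%:R)%:E).
  rewrite -nneseriesZl; last by move=> n _; rewrite lee_fin divr_ge0// exprn_ge0.
  by apply: eq_eseriesr => n _; rewrite /Defs.poisson_pmf -mulrA EFinM.
rewrite [X in _ * X](_ : _ = (expR m)%:E); last first.
  rewrite expRE -EFin_lim; last first.
    rewrite /pseries/=; under eq_fun do rewrite mulrC.
    exact: is_cvg_series_exp_coeff.
  apply/congr_lim/funext => n/=; rewrite /pseries/= /series/= -sumEFin//.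
  by under eq_bigr do rewrite mulrC.
by rewrite -EFinM expRN mulVf// gt_eqF// expR_gt0.
Qed.

Lemma poisson_pmf_mean (m : R) : (0 <= m)%R ->
  \sum_(k <oo) (k%:R * Defs.poisson_pmf m k)%:E = m%:E.
Proof.
move=> m0; rewrite nneseries_recl//; last first.
  by move=> k _; rewrite lee_fin mulr_ge0// poisson_pmf_ge0.
rewrite -nneseries_addn; last by move=> k; rewrite lee_fin mulr_ge0// poisson_pmf_ge0.
rewrite mul0r add0e -[RHS]mule1 -(poisson_pmf_sum m0) -nneseriesZl; last first.
  by move=> n _; rewrite lee_fin poisson_pmf_ge0.
apply: eq_eseriesr => k _; rewrite -EFinM addn1; congr EFin.
rewrite /Defs.poisson_pmf exprS factS natrM.
have h1 : (k.+1%:R != 0 :> R)%R by rewrite pnatr_eq0.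
have h2 : ((k`!)%:R != 0 :> R)%R by rewrite pnatr_eq0 -lt0n fact_gt0.
move: h1 h2; move: (k.+1%:R)%R (k`!%:R)%R => u v h1 h2.
by field; rewrite h1 h2.
Qed.

End poisson_series.

Section poisson_process.
Context {R : realType} (d : measure_display) (Omega : measurableType d).
Variables (P : probability Omega R) (Phi : Omega -> set (pt R)).
Variable Lam : {measure set (pt R) -> \bar R}.
Hypothesis pp : is_poisson_pp P Phi Lam.
Local Open Scope ereal_scope.
Implicit Type B : set (pt R).

Let mcount B : measurable B -> measurable_fun setT (fun w => count (Phi w) B).
Proof. by case: pp => + _ _ _; apply. Qed.

Lemma measurable_count_eq B (k : \bar R) : measurable B ->
  measurable [set w | count (Phi w) B = k].
Proof.
move=> mB; rewrite -[X in measurable X]setTI.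
exact: (mcount mB measurableT (emeasurable_set1 k)).
Qed.

Lemma countE w B : count (Phi w) B = cnt (Phi w `&` B). Proof. by []. Qed.

Lemma count_nat_or_oo w B : (exists k : nat, count (Phi w) B = k%:R%:E) \/ count (Phi w) B = +oo.
Proof.
rewrite countE; have [fS|iS] := pselect (finite_set (Phi w `&` B)).
  by left; rewrite cnt_finite//; eexists.
by right; rewrite cnt_infinite.
Qed.

Let pmf B (k : nat) : measurable B -> Lam B < +oo ->
  P [set w | count (Phi w) B = k%:R%:E] = (Defs.poisson_pmf (fine (Lam B)) k)%:E.
Proof. by case: pp => _ + _ _ => H mB LB; exact: H. Qed.

Lemma trivIset_count B : trivIset setT (fun k : nat => [set w | count (Phi w) B = k%:R%:E]).
Proof.
apply/trivIsetP => i j _ _ ij; apply/seteqP; split => // w [/= -> []] /eqP.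
by rewrite eqr_nat (negbTE ij).
Qed.

(** The Poisson probabilities of the finite values already sum to 1. *)
Lemma prob_count_oo B : measurable B -> Lam B < +oo -> P [set w | count (Phi w) B = +oo] = 0.
Proof.
move=> mB LB.
have LB0 : (0 <= fine (Lam B))%R by rewrite fine_ge0.
have mF k : measurable [set w | count (Phi w) B = k%:R%:E] by exact: measurable_count_eq.
have : P (\bigcup_k [set w | count (Phi w) B = k%:R%:E]) = 1.
  rewrite measure_bigcup//; last exact: trivIset_count.
  rewrite -(poisson_pmf_sum LB0) (eq_eseriesl (Q := xpredT)); last by move=> k; rewrite in_setT.
  by apply: eq_eseriesr => k _; exact: pmf.
have -> : \bigcup_k [set w | count (Phi w) B = k%:R%:E] = ~` [set w | count (Phi w) B = +oo].
  apply/seteqP; split => w /=; first by move=> [k _ /= ->].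
  by have [[k kE] _|->//] := count_nat_or_oo w B; exists k.
rewrite probability_setC; last exact: measurable_count_eq.
have /fineK <- : P [set w | count (Phi w) B = +oo] \is a fin_num.
  by rewrite fin_num_measure//; exact: measurable_count_eq.
by rewrite -EFinB => -[h]; congr EFin; lra.
Qed.

Lemma mean_count B : measurable B -> Lam B < +oo ->
  \int[P]_w count (Phi w) B = Lam B.
Proof.
move=> mB LB.
have LBfin : Lam B \is a fin_num by rewrite ge0_fin_numE.
have LB0 : (0 <= fine (Lam B))%R by rewrite fine_ge0.
have mF k : measurable [set w | count (Phi w) B = k%:R%:E] by exact: measurable_count_eq.
rewrite (ge0_negligible_integral _ _ _ _ (prob_count_oo mB LB))//; last 3 first.
- exact: measurable_count_eq.
- exact: mcount.
- by move=> w _; exact: cnt_ge0.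
rewrite (_ : _ `\` _ = \bigcup_k [set w | count (Phi w) B = k%:R%:E]); last first.
  apply/seteqP; split => w /=.
    by move=> [_]; have [[k kE] _|->//] := count_nat_or_oo w B; exists k.
  by move=> [k _ /= ->].
rewrite ge0_integral_bigcup//; last 3 first.
- by apply: measurable_funTS; exact: mcount.
- by move=> w _; exact: cnt_ge0.
- exact: trivIset_count.
rewrite -[RHS](fineK LBfin) -(poisson_pmf_mean LB0); apply: eq_eseriesr => k _.
rewrite (eq_integral (cst k%:R%:E)); last by move=> w /[!inE].
by rewrite integral_cst// EFinM -pmf.
Qed.
End poisson_process.

(** * Bounded strips and removal of exceptional configurations *)

Section strip.
Context {R : realType}.

(** The mark is left free: as [f] has total mass 1, a column over a bounded square has finite
    intensity. *)
Definition strip (n : nat) : set (pt R) :=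
  [set p | `|p.1.1| <= n%:R /\ `|p.1.2| <= n%:R].

Lemma measurable_strip n : measurable (strip n).
Proof.
by apply: measurableI; rewrite -[X in measurable X]setTI; apply: measurable_fun_ler => //;
  apply: measurableT_comp => //; exact: measurableT_comp.
Qed.

Lemma subset_strip m n : (m <= n)%N -> strip m `<=` strip n.
Proof.
by move=> mn p [h1 h2]; split; [apply: le_trans h1 _|apply: le_trans h2 _]; rewrite ler_nat.
Qed.

Lemma bigcup_strip : \bigcup_n strip n = setT.
Proof.
rewrite -subTset => p _.
have b (x : R) : `|x| <= (Num.bound `|x|)%:R by rewrite ltW// archi_boundP.
exists (maxn (Num.bound `|p.1.1|) (Num.bound `|p.1.2|)) => //.
by split; [rewrite (le_trans (b p.1.1))|rewrite (le_trans (b p.1.2))];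
  rewrite // ler_nat ?leq_maxl ?leq_maxr.
Qed.

Definition nonpos : set (pt R) := [set p | p.2 <= 0].

Lemma measurable_nonpos : measurable nonpos.
Proof. by rewrite -[X in measurable X]setTI; exact: measurable_fun_ler. Qed.

(* [is_poisson_pp] only makes these properties hold almost surely. *)
Definition clean (phi : set (pt R)) : Prop :=
  (forall p, phi p -> 0 < p.2) /\ forall n, finite_set (phi `&` strip n).

End strip.

Section cleaning.
Context {R : realType} (d : measure_display) (Omega : measurableType d).
Variables (P : probability Omega R) (Phi : Omega -> set (pt R)).
Variable Lam : {measure set (pt R) -> \bar R}.
Hypothesis pp : is_poisson_pp P Phi Lam.
Hypothesis Lam_strip : forall n, (Lam (strip n) < +oo)%E.
Hypothesis Lam_nonpos : Lam nonpos = 0%E.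
Local Open Scope ereal_scope.

Let good : set Omega := (\bigcap_n ~` [set w | count (Phi w) (strip n) = +oo]) `&`
  [set w | count (Phi w) nonpos = 0].

Lemma measurable_good : measurable good.
Proof.
apply: measurableI; last exact: (measurable_count_eq pp 0 measurable_nonpos).
apply: bigcap_measurable; first by exists 0%N.
move=> n _; apply: measurableC; exact: (measurable_count_eq pp _ (measurable_strip n)).
Qed.

Lemma prob_goodC : P (~` good) = 0.
Proof.
have mn n := measurable_count_eq pp +oo (measurable_strip n).
rewrite /good setCI setC_bigcap; apply/eqP.
rewrite eq_le measure_ge0 andbT.
have m1 : measurable (\bigcup_n ~` ~` [set w | count (Phi w) (strip n) = +oo]).
  by apply: bigcup_measurable => n _; rewrite setCK; exact: mn.
have m2 : measurable (~` [set w | count (Phi w) nonpos = 0]).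
  by apply: measurableC; exact: (measurable_count_eq pp 0 measurable_nonpos).
apply: le_trans (measureU2 _ m1 m2) _.
rewrite [X in X + _](_ : _ = 0) ?add0e; last first.
  apply/eqP; rewrite eq_le measure_ge0 andbT.
  apply: le_trans (measure_sigma_subadditive _ _ m1 (@subset_refl _ _)) _.
    by move=> n; rewrite setCK; exact: mn.
  rewrite eseries0// => n _ _; rewrite setCK.
  exact: (prob_count_oo pp (measurable_strip n) (Lam_strip n)).
rewrite [leLHS]probability_setC; last exact: (measurable_count_eq pp 0 measurable_nonpos).
case: pp => _ pmf _ _.
have := pmf _ measurable_nonpos; rewrite Lam_nonpos => /(_ (ltry _) 0%N) ->.
by rewrite /Defs.poisson_pmf/= oppr0 expR0 mulr1 fact0 divr1 subee.
Qed.

(** Empties the configuration off the almost sure event [good], so that the new process is clean for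
    every outcome. *)
Definition clean_Phi (w : Omega) : set (pt R) := [set x | Phi w x /\ good w].

Lemma clean_Phi_off_null :
  exists N, [/\ measurable N, P N = 0 & forall w, ~ N w -> clean_Phi w = Phi w].
Proof.
exists (~` good); split; [exact/measurableC/measurable_good|exact: prob_goodC|].
by move=> w /contrapT gw; apply/seteqP; split => x; [move=> []|split].
Qed.

Lemma clean_clean_Phi w : clean (clean_Phi w).
Proof.
split=> [p [Pp [_ /= g]]|n].
  rewrite ltNge; apply/negP => p0; move: g => /cnt_eq0 g.
  by have : set0 p by rewrite -g.
have [gw|ngw] := pselect (good w); last first.
  by rewrite (_ : _ `&` _ = set0); [exact: finite_set0|apply/seteqP; split => // x [[]]].
have [/(_ n I) gn _] := gw.
have -> : clean_Phi w `&` strip n = Phi w `&` strip n.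
  by apply/seteqP; split => x; [move=> [[]]|move=> [? ?]].
by apply: contrapT => inf; apply: gn => /=; exact: cnt_infinite.
Qed.

Lemma count_clean w B : count (clean_Phi w) B = if w \in good then count (Phi w) B else 0.
Proof.
case: ifPn; rewrite ?inE ?notin_setE => gw.
  by congr (esum _ _); apply/seteqP; split => x; [move=> [[]]|move=> [? ?]].
by apply/cnt_eq0; apply/seteqP; split => // x [[]].
Qed.

Lemma eq_prob_good (A A' : set Omega) : measurable A -> measurable A' ->
  A `&` good = A' `&` good -> P A = P A'.
Proof.
have mg := measurable_good.
have E (B : set Omega) : measurable B -> P B = P (B `&` good).
  move=> mB; rewrite (measureDI _ mB mg) [X in X + _](_ : _ = 0) ?add0e//.
  apply/eqP; rewrite eq_le measure_ge0 andbT -prob_goodC.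
  apply: le_measure; rewrite ?inE; [exact: measurableD|exact: measurableC|].
  by move=> x [].
by move=> mA mA' AA'; rewrite E// AA' -E.
Qed.

Lemma clean_poisson : is_poisson_pp P clean_Phi Lam.
Proof.
have mc B : measurable B -> measurable_fun setT (fun w => count (clean_Phi w) B).
  move=> mB; have [mcount _ _ _] := pp.
  rewrite (_ : (fun w => _) = (fun w => count (Phi w) B) \_ good); last first.
    by apply/funext => w; rewrite count_clean patchE.
  apply/(measurable_restrictT _ measurable_good).1.
  by apply: measurable_funTS; exact: mcount.
have mcE B k : measurable B -> measurable [set w | count (clean_Phi w) B = k].
  move=> mB; rewrite -[X in measurable X]setTI.
  exact: (mc _ mB measurableT _ (emeasurable_set1 k)).
have mE B k : measurable B -> measurable [set w | count (Phi w) B = k].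
  by move=> mB; exact: (measurable_count_eq pp).
have E B k : measurable B -> P [set w | count (clean_Phi w) B = k] = P [set w | count (Phi w) B = k].
  move=> mB; apply: eq_prob_good; [exact: mcE|exact: mE|].
  by apply/seteqP; split => w /= []; rewrite count_clean => + gw; rewrite mem_set.
case: pp => _ pp2 pp3 pp4; split => //.
- by move=> B mB LB k; rewrite E// pp2.
- by move=> B mB LB; rewrite E// pp3.
- move=> n B k mB dB.
  rewrite (eq_bigr (fun i => P [set w | count (Phi w) (B i) = k i])); last by move=> i _; rewrite E.
  rewrite -pp4//; apply: eq_prob_good.
  + apply: fin_bigcap_measurable => [|i _]; [exact: finite_finset|]; exact: mcE.
  + apply: fin_bigcap_measurable => [|i _]; [exact: finite_finset|]; exact: mE.
  + by apply/seteqP; split => w [h gw]; split => // i _; move: (h i I) => /=;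
      rewrite count_clean mem_set.
Qed.
End cleaning.

(** * Grid approximation of the nearest-neighbour region *)

Section cells.
Context {R : realType}.
Implicit Types (a b c p : pt R).

Definition mesh (n : nat) : R := n.+1%:R ^+ 2.

Lemma mesh_gt0 n : 0 < mesh n. Proof. by rewrite exprn_gt0. Qed.

Lemma mesh_ge n : n.+1%:R <= mesh n.
Proof. by rewrite /mesh expr2 ler_peMr// ler1n. Qed.

Definition grid n (x : R) : int := Num.floor (x * mesh n).

Lemma grid_itv n x : (grid n x)%:~R / mesh n <= x < (grid n x)%:~R / mesh n + (mesh n)^-1.
Proof.
have := floor_itv (x * mesh n); rewrite -/(grid n x) intrD mulr1z => /andP[h1 h2].
rewrite ler_pdivrMr ?mesh_gt0// h1/= -[X in _ + X]mul1r -mulrDl ltr_pdivlMr ?mesh_gt0//.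
Qed.

(** One natural number codes the three grid coordinates, so that sums over cells become series; a
    number that codes no triple has an empty cell. *)
Definition cell_index n p : nat := pickle (grid n p.1.1, grid n p.1.2, grid n p.2).

Definition cell n k : set (pt R) := [set p | cell_index n p = k].

Definition cell_corner n k : pt R :=
  if unpickle k is Some (i, j, l) then
    ((i%:~R / mesh n, j%:~R / mesh n), l%:~R / mesh n) else ((0, 0), 0).

Definition corner n p : pt R := cell_corner n (cell_index n p).

Lemma cornerE n p : corner n p = (((grid n p.1.1)%:~R / mesh n, (grid n p.1.2)%:~R / mesh n),
  (grid n p.2)%:~R / mesh n).
Proof. by rewrite /corner /cell_corner /cell_index pickleK. Qed.

Lemma measurable_grid n i : measurable [set x : R | grid n x = i].
Proof.
have -> : [set x : R | grid n x = i] =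
    [set x | i%:~R <= x * mesh n] `&` [set x | x * mesh n < (i + 1)%:~R].
  apply/seteqP; split => x /=; first by move=> <-; exact/andP/floor_itv.
  by move=> /andP; exact: floor_def.
apply: measurableI; rewrite -[X in measurable X]setTI.
  by apply: measurable_fun_ler => //; exact: measurable_funM.
by apply: measurable_fun_ltr => //; exact: measurable_funM.
Qed.

Lemma measurable_cell n k : measurable (cell n k).
Proof.
case E : (unpickle k : option (int * int * int)) => [[[i j] l]|]; last first.
  rewrite (_ : cell n k = set0)//; apply/seteqP; split => // p /= pk.
  by move: E; rewrite -pk pickleK.
have [kE|kE] := eqVneq (pickle (i, j, l)) k; last first.
  rewrite (_ : cell n k = set0)//; apply/seteqP; split => // p /= pk.
  by move: E; rewrite -pk pickleK => -[ei ej el]; move: kE; rewrite -pk /cell_index ei ej el eqxx.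
rewrite (_ : cell n k = [set p | grid n p.1.1 = i] `&` [set p | grid n p.1.2 = j] `&` [set p | grid n p.2 = l]).
  have m1 : measurable_fun setT (fun p : pt R => p.1.1) by exact: measurableT_comp.
  have m2 : measurable_fun setT (fun p : pt R => p.1.2) by exact: measurableT_comp.
  have m3 : measurable_fun setT (fun p : pt R => p.2) by exact: measurable_snd.
  apply: measurableI; first apply: measurableI; rewrite -[X in measurable X]setTI.
  - exact: (m1 measurableT _ (measurable_grid n i)).
  - exact: (m2 measurableT _ (measurable_grid n j)).
  - exact: (m3 measurableT _ (measurable_grid n l)).
apply/seteqP; split => p /=.
  by rewrite /cell /= -kE => /(pcan_inj (@pickleK _)) [-> -> ->].
by move=> [[h1 h2] h3]; rewrite /cell/= /cell_index h1 h2 h3.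
Qed.

Lemma trivIset_cell n : trivIset setT (cell n).
Proof. by move=> i j _ _ [p [<- <-]]. Qed.

Lemma bigcup_cell n : \bigcup_k cell n k = setT.
Proof. by rewrite -subTset => p _; exists (cell_index n p). Qed.

(** Convergence at the rate of the cell side. It is stable under sums and products, hence passes
    from the coordinates of corners to [hdefect]. *)
Definition meshclose (u : nat -> R) (l : R) : Prop :=
  exists2 C, 0 <= C & forall n, `|u n - l| <= C / mesh n.

Lemma meshclose_cst l : meshclose (fun=> l) l.
Proof. by exists 0 => // n; rewrite subrr normr0 mul0r. Qed.

Lemma meshcloseD u v l m : meshclose u l -> meshclose v m ->
  meshclose (fun n => u n + v n) (l + m).
Proof.
move=> [C C0 uC] [D D0 vD]; exists (C + D) => [|n]; first exact: addr_ge0.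
by rewrite opprD addrACA mulrDl (le_trans (ler_normD _ _))// lerD.
Qed.

Lemma meshcloseN u l : meshclose u l -> meshclose (fun n => - u n) (- l).
Proof. by move=> [C C0 uC]; exists C => // n; rewrite -opprD normrN. Qed.

Lemma meshcloseB u v l m : meshclose u l -> meshclose v m ->
  meshclose (fun n => u n - v n) (l - m).
Proof. by move=> ul vm; apply: meshcloseD => //; exact: meshcloseN. Qed.

Lemma mesh_inv_le1 n : (mesh n)^-1 <= 1.
Proof. by rewrite invf_le1 ?mesh_gt0// (le_trans _ (mesh_ge n))// ler1n. Qed.

Lemma meshclose_bounded u l : meshclose u l -> exists2 C, 0 <= C & forall n, `|u n - l| <= C.
Proof.
move=> [C C0 uC]; exists C => // n; apply: le_trans (uC n) _.
by rewrite ler_piMr// mesh_inv_le1.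
Qed.

Lemma meshcloseM u v l m : meshclose u l -> meshclose v m ->
  meshclose (fun n => u n * v n) (l * m).
Proof.
move=> [C C0 uC] [D D0 vD]; exists (C * (`|m| + D) + `|l| * D) => [|n].
  by rewrite addr_ge0// mulr_ge0// addr_ge0.
have -> : u n * v n - l * m = (u n - l) * v n + l * (v n - m) by ring.
rewrite (le_trans (ler_normD _ _))// !normrM [leRHS]mulrDl; apply: lerD.
  rewrite mulrAC ler_pM//.
  have -> : v n = m + (v n - m) by ring.
  rewrite (le_trans (ler_normD _ _))// lerD2l (le_trans (vD n))//.
  by rewrite ler_piMr// mesh_inv_le1.
by rewrite -mulrA ler_wpM2l.
Qed.

Lemma meshcloseX2 u l : meshclose u l -> meshclose (fun n => u n ^+ 2) (l ^+ 2).
Proof. by move=> ul; rewrite expr2; apply: meshcloseM. Qed.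

Lemma meshclose_grid x : meshclose (fun n => (grid n x)%:~R / mesh n) x.
Proof.
exists 1 => // n; have /andP[h1 h2] := grid_itv n x.
by rewrite mul1r ler_norml; apply/andP; split; [lra|rewrite (@le_trans _ _ 0)//; [lra|rewrite invr_ge0 ltW// mesh_gt0]].
Qed.

Lemma meshclose_corner a : [/\ meshclose (fun n => (corner n a).1.1) a.1.1,
  meshclose (fun n => (corner n a).1.2) a.1.2 & meshclose (fun n => (corner n a).2) a.2].
Proof.
split.
- by under eq_fun do rewrite cornerE/=; exact: meshclose_grid.
- by under eq_fun do rewrite cornerE/=; exact: meshclose_grid.
- by under eq_fun do rewrite cornerE/=; exact: meshclose_grid.
Qed.

Lemma meshclose_sqdist3 (a_ b_ : nat -> pt R) a b :
  meshclose (fun n => (a_ n).1.1) a.1.1 -> meshclose (fun n => (a_ n).1.2) a.1.2 ->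
  meshclose (fun n => (a_ n).2) a.2 ->
  meshclose (fun n => (b_ n).1.1) b.1.1 -> meshclose (fun n => (b_ n).1.2) b.1.2 ->
  meshclose (fun n => (b_ n).2) b.2 ->
  meshclose (fun n => sqdist3 (a_ n) (b_ n)) (sqdist3 a b).
Proof.
move=> a1 a2 a3 b1 b2 b3; rewrite /sqdist3 /sqdist2.
by apply: meshcloseD; [apply: meshcloseD|]; apply: meshcloseX2; exact: meshcloseB.
Qed.

Lemma meshclose_hdefect a b c :
  meshclose (fun n => hdefect (corner n a) (corner n b) c) (hdefect a b c).
Proof.
have [a1 a2 a3] := meshclose_corner a; have [b1 b2 b3] := meshclose_corner b.
apply: meshcloseB; apply: meshcloseM => //.
- by apply: (meshclose_sqdist3 (b_ := fun=> c)) => //; exact: meshclose_cst.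
- exact: meshclose_sqdist3.
- exact: meshclose_cst.
Qed.

Lemma near_infty_inv (e : R) : 0 < e -> exists N : nat, forall n, (N <= n)%N -> n.+1%:R^-1 < e.
Proof.
move=> e0; exists (Num.bound e^-1) => n Nn.
have h : e^-1 < (Num.bound e^-1)%:R by rewrite archi_boundP// invr_ge0 ltW.
rewrite invf_plt ?posrE//; apply: lt_le_trans h _.
by rewrite ler_nat (leq_trans Nn).
Qed.

(** If [l <= 0], then [u n] is at most [C / mesh n], which drops below the slack once [n] exceeds
    [C]. If [l > 0], both the slack and the error become small against [l]. Without slack the case
    [l = 0] would stay undecided. *)
Lemma meshclose_sign u l : meshclose u l ->
  exists N : nat, forall n, (N <= n)%N -> (u n <= n.+1%:R^-1) = (l <= 0).
Proof.
move=> [C C0 uC].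
have Cm n : C / mesh n <= C * n.+1%:R^-1.
  by rewrite ler_wpM2l// lef_pV2 ?posrE ?mesh_gt0// mesh_ge.
have [l0|l0] := leP l 0.
  have [N HN] : exists N : nat, forall n, (N <= n)%N -> n.+1%:R^-1 < (C + 1)^-1.
    by apply: near_infty_inv; rewrite invr_gt0; lra.
  exists N => n /HN h.
  have := uC n; rewrite ler_norml => /andP[_ h2].
  have mE : (mesh n)^-1 = n.+1%:R^-1 * n.+1%:R^-1 by rewrite /mesh expr2 invfM.
  have n0 : 0 < n.+1%:R^-1 :> R by rewrite invr_gt0.
  have Cn : C * n.+1%:R^-1 <= 1.
    have : (C + 1) * n.+1%:R^-1 < 1.
      by rewrite mulrC -ltr_pdivlMr ?div1r//; lra.
    by move=> h'; apply: ltW; apply: le_lt_trans h'; rewrite ler_wpM2r ?(ltW n0)//; lra.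
  have h3 : C / mesh n <= n.+1%:R^-1.
    by rewrite mE mulrA ler_piMl// ltW.
  by apply: le_trans h3; apply: le_trans h2; rewrite lerBrDl; lra.
have [N HN] : exists N : nat, forall n, (N <= n)%N -> n.+1%:R^-1 < l / (C + 1).
  by apply: near_infty_inv; rewrite divr_gt0//; lra.
exists N => n /HN; rewrite ltr_pdivlMr; last by lra.
have := uC n; rewrite ler_norml => /andP[h1 _]; have := Cm n.
rewrite mulrDr mulr1 (mulrC _ C) => h2 h3; apply/negbTE; rewrite -ltNge.
move: h1 h2 h3; move: (C / mesh n) (C * n.+1%:R^-1) (n.+1%:R^-1 : R) => x y z; lra.
Qed.

(* The slack [n.+1%:R^-1] dominates the error of order [(mesh n)^-1 = n.+1%:R^-2] made by
   replacing points by cell corners, so for each point membership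
   eventually agrees with that in [nn_region]. *)
Definition approx_region n i j : set (pt R) :=
  [set c | 0 < c.2 /\
    (hdefect (cell_corner n i) (cell_corner n j) c <= n.+1%:R^-1 \/
     hdefect (cell_corner n j) (cell_corner n i) c <= n.+1%:R^-1)].

Lemma approx_region_lim a b c : exists N : nat, forall n, (N <= n)%N ->
  approx_region n (cell_index n a) (cell_index n b) c <-> (0 < c.2 /\ nn_region a b c).
Proof.
have [N1 H1] := meshclose_sign (meshclose_hdefect a b c).
have [N2 H2] := meshclose_sign (meshclose_hdefect b a c).
exists (maxn N1 N2) => n; rewrite geq_max => /andP[/H1 h1 /H2 h2].
by rewrite /approx_region /= -/(corner n a) -/(corner n b) h1 h2.
Qed.

End cells.

Section cell_limits.
Context {R : realType}.
Local Notation mesh := (@mesh R).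
Local Notation cell := (@cell R).
Local Notation approx_region := (@approx_region R).
Implicit Types (a b c p : pt R).

Lemma cell_index_close n a c : cell_index n a = cell_index n c ->
  [/\ `|a.1.1 - c.1.1| <= (mesh n)^-1, `|a.1.2 - c.1.2| <= (mesh n)^-1 & `|a.2 - c.2| <= (mesh n)^-1].
Proof.
move=> /(pcan_inj (@pickleK _)) [e1 e2 e3].
have h (x y : R) : grid n x = grid n y -> `|x - y| <= (mesh n)^-1.
  move=> e; have /andP[h1 h2] := grid_itv n x; have := grid_itv n y; rewrite -e => /andP[h3 h4].
  by rewrite ler_norml; apply/andP; split; lra.
by split; exact: h.
Qed.

Lemma cell_index_neq a c : a <> c -> exists N : nat, forall n, (N <= n)%N ->
  cell_index n a <> cell_index n c.
Proof.
move=> ac.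
pose e := `|a.1.1 - c.1.1| + `|a.1.2 - c.1.2| + `|a.2 - c.2|.
have e0 : 0 < e.
  rewrite lt_neqAle !addr_ge0// andbT; apply/negP => /eqP; rewrite /e => /esym/eqP.
  rewrite !paddr_eq0 ?addr_ge0// !normr_eq0 !subr_eq0 => /andP[/andP[/eqP h1 /eqP h2] /eqP h3].
  apply: ac; rewrite (surjective_pairing a) (surjective_pairing a.1) h1 h2 h3.
  by rewrite -!surjective_pairing.
(* Points of one cell differ by at most the cell side in each of three coordinates, so a side below
   [e / 4] would give [e <= 3 * e / 4]. *)
have [N HN] : exists N : nat, forall n, (N <= n)%N -> n.+1%:R^-1 < e / 4.
  by apply: near_infty_inv; rewrite divr_gt0.
exists N => n /HN h /cell_index_close[h1 h2 h3].
have : (mesh n)^-1 <= n.+1%:R^-1 by rewrite lef_pV2 ?posrE ?mesh_gt0// mesh_ge.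
have mp : 0 < (mesh n)^-1 by rewrite invr_gt0 mesh_gt0.
by move: h mp h1 h2 h3; rewrite /e; move: (mesh n)^-1 (n.+1%:R^-1 : R) => x y; lra.
Qed.

Lemma strip_bound (x y M : R) : 0 <= M -> `|x| <= M -> `|y| <= M ->
  forall z, strip (Num.bound M) ((x, y), z).
Proof.
move=> M0 xM yM z; have h : M < (Num.bound M)%:R by exact: archi_boundP.
by split => /=; rewrite ltW// (le_lt_trans _ h).
Qed.

Lemma cell_bounded a : exists M : nat, forall n, cell n (cell_index n a) `<=` strip M.
Proof.
pose M := `|a.1.1| + `|a.1.2| + 1.
exists (Num.bound M) => n c ce; have [h1 h2 _] := cell_index_close ce.
have m1 := @mesh_inv_le1 R n.
have h (x y : R) : `|x - y| <= (mesh n)^-1 -> `|x| <= `|y| + 1.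
  move=> xy; have -> : x = y + (x - y) by ring.
  by rewrite (le_trans (ler_normD _ _))// lerD2l (le_trans xy).
case: c ce h1 h2 => [[x y] z] _ /= h1 h2; apply: strip_bound.
- by rewrite !addr_ge0.
- by rewrite (le_trans (h _ _ h1))// /M; have := normr_ge0 a.1.2; lra.
- by rewrite (le_trans (h _ _ h2))// /M; have := normr_ge0 a.1.1; lra.
Qed.

Lemma quadratic_bound (t z E F : R) : 0 <= z -> 0 <= E -> 0 <= F -> 0 < t ->
  t ^+ 2 <= (2 * z + E) * t + F -> t <= 2 * z + E + F + 1.
Proof.
move=> z0 E0 F0 t0 h; rewrite leNgt; apply/negP => h2.
have t1 : 1 <= t by lra.
have : (2 * z + E + F + 1) * t < t ^+ 2 by rewrite expr2 ltr_pM2r.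
have : F <= F * t by rewrite ler_peMr.
nra.
Qed.

(** On the region the squared distance to the corner is at most an affine function of the height
    [c.2], whereas it grows quadratically in it. This bounds the height, then the horizontal
    coordinates, uniformly in [n]. A single strip therefore serves all large [n], both for
    finiteness of configurations and for dominated convergence. *)
Lemma approx_region_bounded a b : 0 < a.2 -> 0 < b.2 ->
  exists M N : nat, forall n, (N <= n)%N ->
    approx_region n (cell_index n a) (cell_index n b) `<=` strip M.
Proof.
have half a' b' : 0 < b'.2 -> exists M N : nat, forall n, (N <= n)%N -> forall c, 0 < c.2 ->
    hdefect (corner n a') (corner n b') c <= n.+1%:R^-1 -> strip M c.
  clear a b => b0; have [a1 a2 a3] := meshclose_corner a'; have [b1 b2 b3] := meshclose_corner b'.
  have [C C0 HC] := meshclose_bounded (meshclose_sqdist3 a1 a2 a3 b1 b2 b3).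
  have [A1 A10 HA1] := meshclose_bounded a1; have [A2 A20 HA2] := meshclose_bounded a2.
  have [A3 A30 HA3] := meshclose_bounded a3.
  (* The corners of [b'] eventually have height at least [be], so the defining inequality can be
     divided by that height; [E] and [F] are the resulting coefficients. *)
  pose be := b'.2 / 2; have be0 : 0 < be by rewrite divr_gt0.
  have [N HN] : exists N : nat, forall n, (N <= n)%N -> be <= (corner n b').2.
    have [C3 C30 HC3] := b3.
    have [N HN] : exists N : nat, forall n, (N <= n)%N -> n.+1%:R^-1 < be / (C3 + 1).
      by apply: near_infty_inv; rewrite divr_gt0//; lra.
    exists N => n /HN; rewrite ltr_pdivlMr; last by lra.
    have := HC3 n; rewrite ler_norml => /andP[h1 _].
    have h2 : C3 / mesh n <= C3 * n.+1%:R^-1.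
      by rewrite ler_wpM2l// lef_pV2 ?posrE ?mesh_gt0// mesh_ge.
    have n0 : 0 < n.+1%:R^-1 :> R by rewrite invr_gt0.
    rewrite mulrDr mulr1 (mulrC _ C3) => h3; move: h1 h2 h3 n0; rewrite /be.
    by move: (C3 / mesh n) (C3 * n.+1%:R^-1) (n.+1%:R^-1 : R) => x y z; lra.
  pose D := sqdist3 a' b' + C.
  have D0 : 0 <= D by rewrite !addr_ge0 ?sqr_ge0.
  pose E := D / be; pose F := be^-1.
  have E0 : 0 <= E by rewrite divr_ge0// ltW.
  have F0 : 0 <= F by rewrite invr_ge0 ltW.
  pose z := `|a'.2| + A3; have z0 : 0 <= z by rewrite addr_ge0.
  pose T := 2 * z + E + F + 1; have T0 : 0 <= T by rewrite /T; lra.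
  pose H := E * T + F; have H0 : 0 <= H by rewrite addr_ge0// mulr_ge0.
  pose M := `|a'.1.1| + `|a'.1.2| + A1 + A2 + H + 1.
  exists (Num.bound M), N => n /HN bn c c0 hc.
  pose q := corner n a'.
  have n1 : n.+1%:R^-1 <= 1 :> R by rewrite invf_le1// ler1n.
  have qc : sqdist3 q c <= E * c.2 + F.
    have s0 : 0 <= sqdist3 q c by rewrite !addr_ge0 ?sqr_ge0.
    have h1 : be * sqdist3 q c <= D * c.2 + 1.
      apply: (@le_trans _ _ (sqdist3 q c * (corner n b').2)).
        by rewrite mulrC ler_wpM2l.
      have : sqdist3 q (corner n b') * c.2 <= D * c.2.
        rewrite ler_wpM2r ?(ltW c0)//; have := HC n; rewrite ler_norml => /andP[_].
        by rewrite -/q /D lerBlDl.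
      have h4 : sqdist3 q c * (corner n b').2 <= sqdist3 q (corner n b') * c.2 + 1.
        by rewrite -lerBlDl; apply: le_trans hc n1.
      by move=> h5; apply: le_trans h4 _; rewrite lerD2r.
    have -> : E * c.2 + F = (D * c.2 + 1) / be by rewrite /E /F; ring.
    by rewrite ler_pdivlMr// mulrC.
  have qz : `|q.2| <= z.
    have -> : q.2 = a'.2 + (q.2 - a'.2) by ring.
    by rewrite (le_trans (ler_normD _ _))// lerD2l; exact: HA3.
  have cT : c.2 <= T.
    apply: quadratic_bound => //.
    have : (q.2 - c.2) ^+ 2 <= sqdist3 q c by rewrite lerDr addr_ge0 ?sqr_ge0.
    have : q.2 * c.2 <= z * c.2 by rewrite ler_wpM2r ?(ltW c0)// (le_trans (ler_norm _)).
    have := sqr_ge0 q.2; nra.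
  have qH : sqdist3 q c <= H.
    by rewrite (le_trans qc)// lerD2r ler_wpM2l.
  have sq1 (x : R) : x ^+ 2 <= H -> `|x| <= H + 1.
    move=> xH; rewrite leNgt; apply/negP => h.
    have : (H + 1) ^+ 2 < `|x| ^+ 2 by rewrite ltr_pXn2r ?nnegrE//; lra.
    rewrite real_normK ?num_real//; nra.
  have coord (x y w A : R) : `|y - w| <= A -> (y - x) ^+ 2 <= H -> `|x| <= `|w| + A + H + 1.
    move=> h1 /sq1 h2; have -> : x = w + (y - w) - (y - x) by ring.
    rewrite (le_trans (ler_normB _ _))// -addrA lerD//.
    by rewrite (le_trans (ler_normD _ _))// lerD2l.
  have q1 : (q.1.1 - c.1.1) ^+ 2 <= H.
    apply: le_trans qH; rewrite /sqdist3 /sqdist2 -addrA lerDl addr_ge0 ?sqr_ge0//.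
  have q2 : (q.1.2 - c.1.2) ^+ 2 <= H.
    apply: le_trans qH; rewrite /sqdist3 /sqdist2 addrAC lerDr addr_ge0 ?sqr_ge0//.
  have c1 := coord _ _ _ _ (HA1 n) q1; have c2 := coord _ _ _ _ (HA2 n) q2.
  case: c {c0 hc qc cT qH q1 q2} c1 c2 => [[x y] w] /= c1 c2; apply: strip_bound.
  - by rewrite /M; have := normr_ge0 a'.1.1; have := normr_ge0 a'.1.2; lra.
  - by rewrite (le_trans c1)// /M; have := normr_ge0 a'.1.2; lra.
  - by rewrite (le_trans c2)// /M; have := normr_ge0 a'.1.1; lra.
move=> a0 b0; have [M1 [N1 H1]] := half a b b0; have [M2 [N2 H2]] := half b a a0.
exists (maxn M1 M2), (maxn N1 N2) => n; rewrite geq_max => /andP[n1 n2] c [c0 [hc|hc]].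
  by apply: (subset_strip (leq_maxl M1 M2)); exact: H1 n1 c c0 hc.
by apply: (subset_strip (leq_maxr M1 M2)); exact: H2 n2 c c0 hc.
Qed.

Lemma measurable_approx_region n i j : measurable (approx_region n i j : set (pt R)).
Proof.
have mT a' b' : measurable [set c | hdefect a' b' c <= (n.+1%:R : R)^-1].
  rewrite -[X in measurable X]setTI; apply: measurable_fun_ler => //.
  apply: measurable_funB; last exact: measurable_funM.
  apply: measurable_funM => //; apply: measurable_funD.
    by apply: measurable_funD; apply: measurable_funX; apply: measurable_funB => //;
      exact: measurableT_comp.
  by apply: measurable_funX; exact: measurable_funB.
apply: measurableI; last by apply: measurableU; exact: mT.
by rewrite -[X in measurable X]setTI; exact: measurable_fun_ltr.
Qed.

End cell_limits.

(** * The Mecke formula for mutual nearest neighbours *)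

Lemma finite_eventually (T : choiceType) (A : set T) (Q : T -> nat -> Prop) :
  finite_set A -> (forall x, A x -> exists N : nat, forall n, (N <= n)%N -> Q x n) ->
  exists N : nat, forall n, (N <= n)%N -> forall x, A x -> Q x n.
Proof.
move=> fA AQ.
have /choice[N HN] : forall x, exists N : nat, A x -> forall n, (N <= n)%N -> Q x n.
  by move=> x; have [Ax|nAx] := pselect (A x); [have [N HN] := AQ x Ax; exists N|exists 0%N].
exists (\max_(x <- fset_set A) N x)%N => n Nn x Ax; apply: HN => //.
apply: leq_trans Nn; apply: (@leq_bigmax_seq _ _ xpredT N x) => //.
by rewrite in_fset_set// mem_set.
Qed.

Section cell_integral.
Context {R : realType}.
Local Notation cell := (@cell R).
Local Open Scope ereal_scope.

Lemma measurable_cell_index n (g : nat -> \bar R) :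
  measurable_fun setT (fun p : pt R => g (cell_index n p)).
Proof.
move=> _ Y mY; rewrite setTI.
rewrite (_ : _ @^-1` _ = \bigcup_(k in [set k | Y (g k)]) cell n k); last first.
  by apply/seteqP; split => p /=; [move=> h; exists (cell_index n p)|move=> [k /= h hk]; rewrite hk].
by apply: bigcup_measurable => k _; exact: measurable_cell.
Qed.

Lemma integral_cell_index (m : {measure set (pt R) -> \bar R}) n (g : nat -> \bar R) (D : set (pt R)) :
  measurable D -> (forall k, 0 <= g k) ->
  \int[m]_(x in D) g (cell_index n x) = \sum_(k <oo) g k * m (cell n k `&` D).
Proof.
move=> mD g0.
have mc k : measurable (cell n k `&` D) by apply: measurableI => //; exact: measurable_cell.
have DE : D = \bigcup_k (cell n k `&` D) by rewrite -setI_bigcupl bigcup_cell setTI.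
rewrite [in LHS]DE ge0_integral_bigcup//.
- apply: eq_eseriesr => k _; rewrite -integral_cst//.
  by apply: eq_integral => x /set_mem[/= xk _]; rewrite xk.
- exact: measurable_funTS (measurable_cell_index n g).
- by apply: trivIset_setIr; exact: trivIset_cell.
Qed.
End cell_integral.

Section mecke.
Context {R : realType} (d : measure_display) (Omega : measurableType d).
Variables (P : probability Omega R) (Phi : Omega -> set (pt R)).
Variable Lam : {sigma_finite_measure set (pt R) -> \bar R}.
Hypothesis pp : is_poisson_pp P Phi Lam.
Hypothesis Phi_clean : forall w, clean (Phi w).
Hypothesis Lam_strip : forall n, (Lam (strip n) < +oo)%E.
Local Notation cell := (@cell R).
Variables (B B' : set (pt R)) (M : nat).
Hypotheses (mB : measurable B) (mB' : measurable B').
Hypotheses (BM : B `<=` strip M) (BM' : B' `<=` strip M).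
Variable W : nat -> nat -> nat -> set (pt R).
Hypothesis mW : forall n i j, measurable (W n i j).
Variable S : Omega -> pt R -> pt R -> Prop.
Hypothesis WS : forall w a b, Phi w a -> Phi w b -> a <> b ->
  exists N : nat, forall n, (N <= n)%N ->
    Phi w `&` W n (cell_index n a) (cell_index n b) `<=` [set a; b] <-> S w a b.
Local Open Scope ereal_scope.

(** [W] and [S] stay abstract because two instances are used: [approx_region] with the
    nearest-neighbour condition, and the empty set with [True], which counts all pairs of distinct
    points. *)
Definition whole n i j := cell n i `|` cell n j `|` W n i j.

(** Disjoint from the two sets that hold one point each, so that independence applies to the three
    counts of [pair_event]. *)
Definition rest n i j := whole n i j `\` ((cell n i `&` B) `|` (cell n j `&` B')).

Definition pair_event n i j : set Omega := [set w | [/\ count (Phi w) (cell n i `&` B) = 1,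
  count (Phi w) (cell n j `&` B') = 1 & count (Phi w) (rest n i j) = 0]].

Definition index_pairs n w : set (nat * nat) :=
  [set ij | ij.1 <> ij.2 /\ pair_event n ij.1 ij.2 w].

Definition point_pairs w : set (pt R * pt R) :=
  [set ab | [/\ Phi w ab.1, Phi w ab.2, ab.1 <> ab.2, B ab.1 & B' ab.2]].

Let mwhole n i j : measurable (whole n i j).
Proof. by apply: measurableU => //; apply: measurableU; exact: measurable_cell. Qed.

Let mcB n i : measurable (cell n i `&` B).
Proof. by apply: measurableI => //; exact: measurable_cell. Qed.

Let mcB' n i : measurable (cell n i `&` B').
Proof. by apply: measurableI => //; exact: measurable_cell. Qed.

Let mrest n i j : measurable (rest n i j).
Proof. by apply: measurableD => //; apply: measurableU. Qed.

Lemma measurable_pair_event n i j : measurable (pair_event n i j).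
Proof.
have -> : pair_event n i j = [set w | count (Phi w) (cell n i `&` B) = 1] `&`
    [set w | count (Phi w) (cell n j `&` B') = 1] `&` [set w | count (Phi w) (rest n i j) = 0].
  by apply/seteqP; split => w; [move=> []|move=> [[]]].
by apply: measurableI; [apply: measurableI|]; exact: (measurable_count_eq pp).
Qed.

Lemma finite_point_pairs w : finite_set (point_pairs w).
Proof.
have [_ /(_ M) fM] := Phi_clean w.
apply: (@sub_finite_set _ _ ((Phi w `&` strip M) `*` (Phi w `&` strip M))).
  by move=> [a b] [/= pa pb _ /BM Ba /BM' Bb].
exact: finite_setX.
Qed.

Let V n w : set (pt R * pt R) := [set ab | point_pairs w ab /\
  index_pairs n w (cell_index n ab.1, cell_index n ab.2)].

Let uniq_in (D : set (pt R)) w a a' : count (Phi w) D = 1 -> Phi w a -> D a -> Phi w a' -> D a' -> a = a'.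
Proof.
move=> /cnt_eq1[x xE] pa Da pa' Da'.
have : (Phi w `&` D) a by []. have : (Phi w `&` D) a' by [].
by rewrite xE => /= -> ->.
Qed.

Let index_pairs_image n w : index_pairs n w =
  (fun ab : pt R * pt R => (cell_index n ab.1, cell_index n ab.2)) @` V n w.
Proof.
apply/seteqP; split => [[i j]|_ [ab [_ ?]] <-//].
move=> [/= ij [/[dup] h1 /cnt_eq1[a aE] /[dup] h2 /cnt_eq1[b bE] h3]].
have [pa [/= ca Ba]] : (Phi w `&` (cell n i `&` B)) a by rewrite aE.
have [pb [/= cb Bb]] : (Phi w `&` (cell n j `&` B')) b by rewrite bE.
rewrite /cell /= in ca cb.
exists (a, b) => /=; last by rewrite ca cb.
split; last by rewrite /= ca cb.
by split => //= ab; apply: ij; rewrite -ca -cb ab.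
Qed.

(** A counted index pair determines its pair of points, since the two cells hold exactly one point
    of [B] and one of [B'] respectively. *)
Lemma cnt_index_pairs n w : cnt (index_pairs n w) = cnt (V n w) :> \bar R.
Proof.
rewrite index_pairs_image; apply: cnt_image => -[a b] [a' b'] /set_mem + /set_mem.
move=> [/= [/= pa pb _ Ba Bb] [/= _ [/= h1 h2 _]]] [[/= pa' pb' _ Ba' Bb'] _] [ea eb].
congr (_, _).
  by apply: (uniq_in h1); rewrite // /setI /cell /= ?ea.
by apply: (uniq_in h2); rewrite // /setI /cell /= ?eb.
Qed.

Lemma cnt_index_pairs_le n w : cnt (index_pairs n w) <= cnt (point_pairs w) :> \bar R.
Proof. by rewrite cnt_index_pairs; apply: cnt_le => ab []. Qed.

(** All cells of [a] lie in one strip; it contains finitely many other points, and each of them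
    eventually lies in another cell. *)
Let isolated w a : Phi w a -> exists N : nat, forall n, (N <= n)%N ->
  Phi w `&` cell n (cell_index n a) = [set a].
Proof.
move=> pa; have [K HK] := cell_bounded a.
have [_ /(_ K) fK] := Phi_clean w.
have [N HN] := @finite_eventually _ ((Phi w `&` strip K) `\ a)
  (fun c n => cell_index n c <> cell_index n a) (finite_setD _ fK)
  (fun c (h : ((Phi w `&` strip K) `\ a) c) => cell_index_neq h.2).
exists N => n Nn; apply/seteqP; split => [c [pc /= cc]|_ ->] //.
by apply: contrapT => ca; apply: (HN n Nn c) => //; split => //; split => //; exact: (HK n).
Qed.

(** Finitely many pairs are concerned. For each of them, once both points are alone in distinct
    cells, [pair_event] only asks that [W] contain no third point, and [WS] turns this into [S]. *)
Lemma cnt_index_pairs_eventually w : exists N : nat, forall n, (N <= n)%N ->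
  cnt (index_pairs n w) = cnt [set ab | point_pairs w ab /\ S w ab.1 ab.2] :> \bar R.
Proof.
have [|N HN] := @finite_eventually _ (point_pairs w)
  (fun ab n => index_pairs n w (cell_index n ab.1, cell_index n ab.2) <-> S w ab.1 ab.2)
  (finite_point_pairs w); last first.
  exists N => n Nn; rewrite cnt_index_pairs; congr cnt.
  by apply/seteqP; split => ab [pab h]; split => //; apply/(HN n Nn).
move=> [a b] [/= pa pb ab Ba Bb].
have [N1 H1] := isolated pa; have [N2 H2] := isolated pb.
have [N3 H3] := cell_index_neq ab; have [N4 H4] := WS pa pb ab.
exists (maxn (maxn N1 N2) (maxn N3 N4)) => n; rewrite !geq_max.
move=> /andP[/andP[/H1 h1 /H2 h2] /andP[/H3 h3 /H4 <-]]; split.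
  move=> [_ [/= _ _ /cnt_eq0 h]] c [pc Wc]; apply: contrapT => cab.
  have : (Phi w `&` rest n (cell_index n a) (cell_index n b)) c; last by rewrite h.
  split => //; split; first by right.
  by move=> [[cc _]|[cc _]]; apply: cab; [left; rewrite -h1|right; rewrite -h2].
move=> h; split => //=; split.
- apply/cnt_eq1; exists a; apply/seteqP; split => [c [pc [cc _]]|_ ->]; first by rewrite -h1.
  by split.
- apply/cnt_eq1; exists b; apply/seteqP; split => [c [pc [cc _]]|_ ->]; first by rewrite -h2.
  by split.
- apply/cnt_eq0; apply/seteqP; split => // c [pc [wc nc]].
  have {wc}: [set a; b] c.
    case: wc => [[cc|cc]|Wc]; first by left; rewrite -h1.
    - by right; rewrite -h2.
    - exact: h.
  by move=> [ca|cb]; apply: nc; [left; rewrite ca|right; rewrite cb].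
Qed.

Let Lam_sub_lty (A : set (pt R)) : measurable A -> A `<=` strip M -> Lam A < +oo.
Proof.
move=> mA AM; apply: le_lt_trans (Lam_strip M).
by apply: le_measure => //; apply: mem_set => //; exact: measurable_strip.
Qed.

Let prob_count1 (A : set (pt R)) : measurable A -> A `<=` strip M ->
  P [set w | count (Phi w) A = 1] = Lam A * expeR (- Lam A).
Proof.
move=> mA AM; have LA := Lam_sub_lty mA AM.
have /fineK LE : Lam A \is a fin_num by rewrite ge0_fin_numE.
case: pp => _ /(_ _ mA LA 1%N) + _ _ => ->.
rewrite -LE /= /Defs.poisson_pmf expr1 (_ : 1`! = 1%N)//.
by rewrite divr1 mulrC EFinM.
Qed.

Let prob_count0 (A : set (pt R)) : measurable A ->
  P [set w | count (Phi w) A = 0] = expeR (- Lam A).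
Proof.
move=> mA; have [LA|LA] := ltP (Lam A) +oo.
  have /fineK LE : Lam A \is a fin_num by rewrite ge0_fin_numE.
  case: pp => _ /(_ _ mA LA 0%N) + _ _ => ->.
  by rewrite -LE /= /Defs.poisson_pmf expr0 fact0 divr1 mulr1.
(* With infinite intensity the count is almost surely infinite, in agreement with
   [expeR -oo = 0]. *)
have {}LA : Lam A = +oo by apply/eqP; rewrite eq_le leey.
rewrite LA/=; case: pp => _ _ /(_ _ mA LA) h _.
have mo := measurable_count_eq pp +oo mA.
apply/eqP; rewrite eq_le measure_ge0 andbT.
apply: (@le_trans _ _ (P (~` [set w | count (Phi w) A = +oo]))); last first.
  by rewrite [leLHS]probability_setC// h subee.
apply: le_measure; last by move=> w /= ->.
  by apply: mem_set; exact: (measurable_count_eq pp 0 mA).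
by apply: mem_set; exact: measurableC.
Qed.

(** The three sets of [pair_event] partition [whole], so the exponents of their independent Poisson
    probabilities add up to its intensity. *)
Lemma prob_pair_event n i j : i <> j -> P (pair_event n i j) =
  Lam (cell n i `&` B) * Lam (cell n j `&` B') * expeR (- Lam (whole n i j)).
Proof.
move=> ij.
have disj : cell n i `&` cell n j = set0.
  by apply/seteqP; split => // p [/= h1 h2]; apply: ij; rewrite -h1 -h2.
pose A0 := cell n i `&` B; pose A1 := cell n j `&` B'; pose A2 := rest n i j.
have A01 : A0 `&` A1 = set0.
  by apply/seteqP; split => // p [[ci _] [cj _]]; rewrite -disj.
have A02 : A0 `&` A2 = set0 by apply/seteqP; split => // p [h [_]]; apply; left.
have A12 : A1 `&` A2 = set0 by apply/seteqP; split => // p [h [_]]; apply; right.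
have s0 : A0 `<=` strip M by move=> p [_ /BM].
have s1 : A1 `<=` strip M by move=> p [_ /BM'].
have -> : P (pair_event n i j) = P [set w | count (Phi w) A0 = 1] *
    P [set w | count (Phi w) A1 = 1] * P [set w | count (Phi w) A2 = 0].
  pose F (k : 'I_3) := nth set0 [:: A0; A1; A2] k.
  pose v (k : 'I_3) : \bar R := nth 0 [:: 1; 1; 0] k.
  case: pp => _ _ _ /(_ 3%N F v); rewrite !big_ord_recl big_ord0 mule1 muleA /= => <-.
  - congr (P _); apply/seteqP; split => w /=.
      by move=> [h0 h1 h2] [[|[|[|//]]] hk] _ /=.
    move=> h; split; [exact: (h (@Ordinal 3 0 isT))|exact: (h (@Ordinal 3 1 isT))|].
    exact: (h (@Ordinal 3 2 isT)).
  - by move=> [[|[|[|//]]] hk]; rewrite /F /=; [exact: mcB|exact: mcB'|exact: mrest].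
  - move=> [[|[|[|//]]] hk] [[|[|[|//]]] hl] //= _; rewrite /F/=;
      by rewrite ?A01 ?A02 ?A12// setIC ?A01 ?A02 ?A12.
rewrite !prob_count1 ?prob_count0//; [|exact: mrest|exact: mcB'|exact: mcB].
have -> : Lam (whole n i j) = Lam A0 + Lam A1 + Lam A2.
  rewrite -measureU//; [|exact: mcB|exact: mcB'].
  rewrite -measureU//; [|by apply: measurableU; [exact: mcB|exact: mcB']|exact: mrest|].
    congr (Lam _); apply/esym; apply: setDUK => p [] [h _]; first by left; left.
    by left; right.
  by rewrite setIUl A02 A12 setU0.
have f0 : Lam A0 \is a fin_num by rewrite ge0_fin_numE//; exact: Lam_sub_lty (mcB n i) s0.
have f1 : Lam A1 \is a fin_num by rewrite ge0_fin_numE//; exact: Lam_sub_lty (mcB' n j) s1.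
rewrite oppeD; last by apply: fin_num_adde_defr; rewrite fin_numD f0.
rewrite oppeD; last exact: fin_num_adde_defr.
rewrite !expeRD.
by rewrite -!muleA; congr (_ * _); rewrite muleCA.
Qed.

Definition void_weight n i j : \bar R := if i == j then 0 else expeR (- Lam (whole n i j)).

Lemma void_weight_ge0 n i j : 0 <= void_weight n i j.
Proof. by rewrite /void_weight; case: ifPn => // _; exact: expeR_ge0. Qed.

Lemma void_weight_le1 n i j : void_weight n i j <= 1.
Proof. by rewrite /void_weight; case: ifPn => // _; rewrite -expeR0 lee_expeR oppe_le0. Qed.

Let index_event n i j : set Omega := if i == j then set0 else pair_event n i j.

Let indic_index_pairs n i j w :
  (\1_(index_pairs n w) (i, j))%:E = (\1_(index_event n i j) w)%:E :> \bar R.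
Proof.
congr EFin; apply: eq_indic; rewrite /index_event; split; rewrite /index_pairs /=.
  by move=> [/eqP/negbTE ->].
by case: eqVneq => // /eqP.
Qed.

Let measurable_index_event n i j : measurable (index_event n i j).
Proof. by rewrite /index_event; case: eqVneq => // _; exact: measurable_pair_event. Qed.

Let measurable_indic_index_pairs n i j :
  measurable_fun setT (fun w => (\1_(index_pairs n w) (i, j))%:E : \bar R).
Proof.
under eq_fun do rewrite indic_index_pairs.
by apply/measurable_EFinP; exact: measurable_indic.
Qed.

Lemma measurable_cnt_index_pairs n :
  measurable_fun setT (fun w => cnt (index_pairs n w) : \bar R).
Proof.
under eq_fun do rewrite cnt_natnat.
apply: ge0_emeasurable_sum => [i w _ _|i _]; first by apply: nneseries_ge0 => j _ _; rewrite lee_fin.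
by apply: ge0_emeasurable_sum => [j w _ _|j _]; [rewrite lee_fin|exact: measurable_indic_index_pairs].
Qed.

(** The series of cell probabilities is the integral of a function that is constant on products of
    cells. *)
Lemma integral_index_pairs n : \int[P]_w cnt (index_pairs n w) =
  \int[Lam]_(a in B) \int[Lam]_(b in B') void_weight n (cell_index n a) (cell_index n b).
Proof.
transitivity (\sum_(i <oo) \sum_(j <oo)
    (void_weight n i j * Lam (cell n j `&` B')) * Lam (cell n i `&` B)).
  under eq_integral do rewrite cnt_natnat.
  rewrite integral_nneseries//; last 2 first.
  - move=> i; apply: ge0_emeasurable_sum => [j w _ _|j _]; first by rewrite lee_fin.
    exact: measurable_indic_index_pairs.
  - by move=> i w _; apply: nneseries_ge0 => j _ _; rewrite lee_fin.
  apply: eq_eseriesr => i _; rewrite integral_nneseries//.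
  apply: eq_eseriesr => j _; under eq_integral do rewrite indic_index_pairs.
  rewrite integral_indic// setIT /index_event /void_weight.
  case: eqVneq => [_|/eqP ij]; first by rewrite measure0 !mul0e.
  rewrite -[LHS]/(P (pair_event n i j)) prob_pair_event//.
  by rewrite muleC (muleC (Lam (cell n i `&` B))) muleA.
rewrite (@integral_cell_index _ Lam n (fun i => \int[Lam]_(b in B') void_weight n i (cell_index n b)) _ mB); last first.
  by move=> i; apply: integral_ge0 => b _; exact: void_weight_ge0.
apply: eq_eseriesr => i _; rewrite (@integral_cell_index _ Lam n (void_weight n i) _ mB'); last first.
  exact: void_weight_ge0.
have fin : Lam (cell n i `&` B) \is a fin_num.
  by rewrite ge0_fin_numE//; apply: Lam_sub_lty (mcB n i) _ => p [_ /BM].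
rewrite muleC -[X in _ = X * _]/(Lam (cell n i `&` B)) -(fineK fin) -nneseriesZl; last by move=> j _; rewrite mule_ge0// void_weight_ge0.
by apply: eq_eseriesr => j _; rewrite muleC.
Qed.

Let cvg_index_pairs w : cnt (index_pairs n w) @[n --> \oo] -->
  (cnt [set ab | point_pairs w ab /\ S w ab.1 ab.2] : \bar R).
Proof.
have [N HN] := cnt_index_pairs_eventually w.
by apply: cvg_near_cst; exists N => // n /= Nn; exact: HN.
Qed.

Lemma measurable_cnt_pairs :
  measurable_fun setT (fun w => cnt [set ab | point_pairs w ab /\ S w ab.1 ab.2] : \bar R).
Proof.
apply: (emeasurable_fun_cvg (fun n w => cnt (index_pairs n w))) => // n.
exact: measurable_cnt_index_pairs.
Qed.

(** Fatou's lemma works before any dominating function is known. With [W] empty and [S] true it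
    shows that the number of all pairs has finite mean, so that this number can dominate in
    [mecke_rectangle]. *)
Lemma integral_cnt_pairs_le :
  \int[P]_w cnt [set ab | point_pairs w ab /\ S w ab.1 ab.2] <= Lam B * Lam B'.
Proof.
have := @fatou _ _ _ P _ measurableT (fun n w => cnt (index_pairs n w))
  measurable_cnt_index_pairs (fun n w _ => cnt_ge0 _).
rewrite (eq_integral (fun w => cnt [set ab | point_pairs w ab /\ S w ab.1 ab.2])); last first.
  by move=> w _; rewrite (cvg_limn_einf_sup (@cvg_index_pairs w)).1.
move=> /le_trans; apply; rewrite limn_einf_lim; apply: lime_le; first exact: is_cvg_einfs.
apply: nearW => n; apply: (@le_trans _ _ (\int[P]_w cnt (index_pairs n w))).
  by apply: ereal_inf_lbound; exists n => /=.
rewrite integral_index_pairs.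
apply: (@le_trans _ _ (\int[Lam]_(a in B) (cst (Lam B')) a)); last first.
  by rewrite integral_cst// muleC.
apply: ge0_le_integral => //.
- by move=> a _; apply: integral_ge0 => b _; exact: void_weight_ge0.
- exact: measurable_funTS (measurable_cell_index n (fun i => \int[Lam]_(b in B') void_weight n i (cell_index n b))).
- move=> a _; apply: (@le_trans _ _ (\int[Lam]_(b in B') (cst 1) b)); last first.
    by rewrite integral_cst// mul1e.
  apply: ge0_le_integral => //.
  + by move=> b _; exact: void_weight_ge0.
  + exact: measurable_funTS (measurable_cell_index n (void_weight n (cell_index n a))).
  + by move=> b _; exact: void_weight_le1.
Qed.

Variable g : pt R * pt R -> \bar R.
Hypotheses (mg : measurable_fun setT g) (g0 : forall ab, 0 <= g ab).
Hypothesis void_g : forall a b, B a -> B' b ->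
  void_weight n (cell_index n a) (cell_index n b) @[n --> \oo] --> g (a, b).
Hypothesis mpairs : measurable_fun setT (fun w => cnt (point_pairs w) : \bar R).
Hypothesis ipairs : \int[P]_w cnt (point_pairs w) < +oo.

Let vw n (ab : pt R * pt R) := void_weight n (cell_index n ab.1) (cell_index n ab.2).

Let mvw n : measurable_fun setT (vw n).
Proof.
move=> _ Y mY; rewrite setTI.
rewrite (_ : _ @^-1` _ = \bigcup_i \bigcup_(j in [set j | Y (void_weight n i j)]) (cell n i `*` cell n j)).
  apply: bigcupT_measurable => i; apply: bigcup_measurable => j _.
  by apply: measurableX; exact: measurable_cell.
apply/seteqP; split => [[a b] /= h|[a b] [i _ [j /= h [/= hi hj]]]].
  by exists (cell_index n a) => //; exists (cell_index n b).
by rewrite /vw /= hi hj.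
Qed.

Let vw1 ab n : `|vw n ab| <= cst 1 ab.
Proof. by rewrite gee0_abs; [exact: void_weight_le1|exact: void_weight_ge0]. Qed.

Let mBB : measurable (B `*` B'). Proof. exact: measurableX. Qed.

Let iterE (h : pt R * pt R -> \bar R) : measurable_fun setT h -> (forall x, 0 <= h x) ->
  \int[Lam]_(a in B) \int[Lam]_(b in B') h (a, b) = \int[sfprod Lam Lam]_(p in B `*` B') h p.
Proof. by move=> mh h0; rewrite [RHS]integral_mkcond; exact: integral_prod_in. Qed.

(** [integral_index_pairs] is passed to the limit on both sides. The number of all pairs dominates
    on the left; on the right the constant 1 does, as [B] and [B'] have finite intensity. *)
Lemma mecke_rectangle :
  \int[P]_w cnt [set ab | point_pairs w ab /\ S w ab.1 ab.2] =
  \int[Lam]_(a in B) \int[Lam]_(b in B') g (a, b).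
Proof.
have ip : P.-integrable setT (fun w => cnt (point_pairs w)).
  by apply/integrableP; split => //; under eq_integral do rewrite gee0_abs ?cnt_ge0//.
have dom w n : setT w -> `|cnt (index_pairs n w)| <= cnt (point_pairs w) :> \bar R.
  by move=> _; rewrite gee0_abs ?cnt_ge0//; exact: cnt_index_pairs_le.
have [_ _ c1] := dominated_convergence measurableT measurable_cnt_index_pairs
  measurable_cnt_pairs (aeW _ (fun w _ => @cvg_index_pairs w)) ip (aeW _ dom).
have LBB : sfprod Lam Lam (B `*` B') < +oo.
  rewrite /sfprod product_measure1E// lte_mul_pinfty//; last exact: Lam_sub_lty.
  by rewrite ge0_fin_numE//; exact: Lam_sub_lty.
have i1 : (sfprod Lam Lam).-integrable (B `*` B') (cst 1).
  apply/integrableP; split => //; under eq_integral do rewrite abse1.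
  by rewrite integral_cst// mul1e.
have vwg ab : (B `*` B') ab -> vw n ab @[n --> \oo] --> g ab.
  by case: ab => a b [/= Ba Bb]; exact: void_g.
have [_ _ c2] := @dominated_convergence _ _ _ (sfprod Lam Lam) _ mBB vw g (cst 1)
  (fun n => measurable_funTS (@mvw n)) (measurable_funTS mg)
  (aeW _ vwg) i1
  (aeW _ (fun ab n _ => vw1 ab n)).
rewrite iterE//.
have c1' : \int[P]_w cnt (index_pairs n w) @[n --> \oo] -->
  \int[P]_w cnt [set ab | point_pairs w ab /\ S w ab.1 ab.2] by exact: c1.
have c2' : \int[sfprod Lam Lam]_(p in B `*` B') vw n p @[n --> \oo] -->
  \int[sfprod Lam Lam]_(p in B `*` B') g p by exact: c2.
have E n : \int[P]_w cnt (index_pairs n w) = \int[sfprod Lam Lam]_(p in B `*` B') vw n p.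
  by rewrite integral_index_pairs -iterE// => x; exact: void_weight_ge0.
have {}c1' : \int[sfprod Lam Lam]_(p in B `*` B') vw n p @[n --> \oo] -->
    \int[P]_w cnt [set ab | point_pairs w ab /\ S w ab.1 ab.2].
  by under eq_fun do rewrite -E.
exact: (cvg_unique _ c1' c2').
Qed.

End mecke.

Section mecke_nn.
Context {R : realType} (d : measure_display) (Omega : measurableType d).
Variables (P : probability Omega R) (Phi : Omega -> set (pt R)).
Variable Lam : {sigma_finite_measure set (pt R) -> \bar R}.
Hypothesis pp : is_poisson_pp P Phi Lam.
Hypothesis Phi_clean : forall w, clean (Phi w).
Hypothesis Lam_strip : forall n, (Lam (strip n) < +oo)%E.
Hypothesis Lam_nonpos : Lam nonpos = 0%E.
Local Notation cell := (@cell R).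
Local Notation approx_region := (@approx_region R).
Local Open Scope ereal_scope.
Implicit Types (a b c : pt R) (B : set (pt R)).

Section bounded_pairs.
Variables (B B' : set (pt R)) (M : nat).
Hypotheses (mB : measurable B) (mB' : measurable B').
Hypotheses (BM : B `<=` strip M) (BM' : B' `<=` strip M).

Let cntT w : cnt (point_pairs Phi B B' w) =
  cnt [set ab | point_pairs Phi B B' w ab /\ True] :> \bar R.
Proof. by congr cnt; apply/seteqP; split => ab; [|move=> []]. Qed.

Lemma measurable_point_pairs :
  measurable_fun setT (fun w => cnt (point_pairs Phi B B' w) : \bar R).
Proof.
under eq_fun do rewrite cntT.
apply: (@measurable_cnt_pairs _ _ _ P _ Lam pp Phi_clean B B' M mB mB' BM BM'
  (fun _ _ _ => set0) _ (fun _ _ _ => True)) => // w a b pa pb ab.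
by exists 0%N => n _; split => // _ c [].
Qed.

Lemma integral_point_pairs_le : \int[P]_w cnt (point_pairs Phi B B' w) <= Lam B * Lam B'.
Proof.
under eq_integral do rewrite cntT.
apply: (@integral_cnt_pairs_le _ _ _ P _ Lam pp Phi_clean Lam_strip B B' M mB mB' BM BM'
  (fun _ _ _ => set0) _ (fun _ _ _ => True)) => // w a b pa pb ab.
by exists 0%N => n _; split => // _ c [].
Qed.
End bounded_pairs.

Lemma nn_region_bounded a b : (0 < a.2)%R -> (0 < b.2)%R ->
  exists M : nat, forall c, (0 < c.2)%R -> nn_region a b c -> strip M c.
Proof.
move=> a0 b0; have [M [N HM]] := approx_region_bounded a0 b0.
exists M => c c0 rc; have [N' HN'] := approx_region_lim a b c.
apply: (HM (maxn N N')); first exact: leq_maxl.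
by apply/HN'; [exact: leq_maxr|].
Qed.

(** Pointwise agreement of the two regions suffices, because only the finitely many points of the
    configuration in one strip can lie in either. *)
Lemma approx_region_config w a b : Phi w a -> Phi w b ->
  exists N : nat, forall n, (N <= n)%N ->
    Phi w `&` approx_region n (cell_index n a) (cell_index n b) `<=` [set a; b] <->
    Phi w `&` nn_region a b `<=` [set a; b].
Proof.
move=> pa pb; have [ppos fin] := Phi_clean w.
have a0 := ppos _ pa; have b0 := ppos _ pb.
have [M [N HM]] := approx_region_bounded a0 b0; have [M' HM'] := nn_region_bounded a0 b0.
have [N' HN'] := @finite_eventually _ (Phi w `&` strip (maxn M M')) (fun c n =>
   approx_region n (cell_index n a) (cell_index n b) c <-> ((0 < c.2)%R /\ nn_region a b c))
   (fin _) (fun c _ => approx_region_lim a b c).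
exists (maxn N N') => n; rewrite geq_max => /andP[Nn N'n]; split => h c [pc rc]; apply: h; split => //.
  apply/(HN' n N'n); last by split => //; exact: ppos.
  by split => //; apply: (subset_strip (leq_maxr M M')); apply: HM' => //; exact: ppos.
have sc : strip (maxn M M') c by apply: (subset_strip (leq_maxl M M')); exact: HM rc.
by have [] := (HN' n N'n c (conj pc sc)).1 rc.
Qed.

Lemma hdefect_self a b : (0 < a.2)%R -> (hdefect a b a <= 0)%R.
Proof.
move=> a0; have -> : hdefect a b a = (- (sqdist3 a b * a.2))%R.
  by rewrite /hdefect /sqdist3 /sqdist2; ring.
by rewrite oppr_le0 mulr_ge0 ?(ltW a0)// !addr_ge0 ?sqr_ge0.
Qed.

Lemma nn_region_lty a b : (0 < a.2)%R -> (0 < b.2)%R -> Lam (nn_region a b) < +oo.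
Proof.
move=> a0 b0; have [M HM] := nn_region_bounded a0 b0.
apply: (@le_lt_trans _ _ (Lam (strip M `|` nonpos))).
  apply: le_measure; last first.
    by move=> c rc; have [c0|c0] := leP c.2 0%R; [right|left; exact: HM].
  - by apply: mem_set; apply: measurableU; [exact: measurable_strip|exact: measurable_nonpos].
  - by apply: mem_set; exact: measurable_nn_region.
apply: le_lt_trans (measureU2 _ _ _) _; [exact: measurable_strip|exact: measurable_nonpos|].
have L0 : Lam nonpos < +oo by rewrite Lam_nonpos.
by apply: lte_add_pinfty; [exact: Lam_strip|exact: L0].
Qed.

Local Notation whole := (whole approx_region).

(** Dominated convergence of indicators on one strip. The two cells shrink to [a] and [b], which
    belong to [nn_region] anyway, and the heights excluded by [approx_region] form the null set
    [nonpos]. *)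
Lemma Lam_whole_cvg a b : (0 < a.2)%R -> (0 < b.2)%R ->
  Lam (whole n (cell_index n a) (cell_index n b)) @[n --> \oo] --> Lam (nn_region a b).
Proof.
move=> a0 b0.
have [M1 [N1 H1]] := approx_region_bounded a0 b0.
have [M2 H2] := nn_region_bounded a0 b0.
have [M3 H3] := cell_bounded a; have [M4 H4] := cell_bounded b.
pose M := maxn (maxn M1 M2) (maxn M3 M4).
pose X n := whole n (cell_index n a) (cell_index n b).
have mX n : measurable (X n).
  apply: measurableU; last exact: measurable_approx_region.
  by apply: measurableU; exact: measurable_cell.
have mD : measurable (strip M : set (pt R)) by exact: measurable_strip.
have mr : measurable (nn_region a b) by exact: measurable_nn_region.
have XM n : (N1 <= n)%N -> X n `<=` strip M.
  move=> Nn c [[cc|cc]|rc].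
  - by apply: (@subset_strip _ M3) (H3 n _ cc); rewrite /M !leq_max leqnn !orbT.
  - by apply: (@subset_strip _ M4) (H4 n _ cc); rewrite /M !leq_max leqnn !orbT.
  - by apply: (@subset_strip _ M1) (H1 n Nn _ rc); rewrite /M !leq_max leqnn.
have ptw c : ~ nonpos c -> exists N : nat, forall n, (N <= n)%N -> X n c <-> nn_region a b c.
  move=> /negP; rewrite -ltNge => c0.
  have [N HN] := approx_region_lim a b c.
  have [ca|ca] := eqVneq c a.
    exists 0%N => n _; rewrite ca; split => _; last by left; left.
    by left; exact: hdefect_self.
  have [cb|cb] := eqVneq c b.
    exists 0%N => n _; rewrite cb; split => _; last by left; right.
    by right; exact: hdefect_self.
  have [Na Ha] := cell_index_neq (elimN eqP ca); have [Nb Hb] := cell_index_neq (elimN eqP cb).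
  exists (maxn N (maxn Na Nb)) => n; rewrite !geq_max => /andP[/HN h /andP[/Ha ha /Hb hb]].
  split=> [[[//|//]|/h []//]|rc]; right; exact/h.
have cv : \int[Lam]_(c in strip M) (\1_(X n) c)%:E @[n --> \oo] -->
    \int[Lam]_(c in strip M) (\1_(nn_region a b) c)%:E.
  have ae1 : {ae Lam, forall c, strip M c ->
      (\1_(X n) c)%:E @[n --> \oo] --> ((\1_(nn_region a b) c)%:E : \bar R)}.
    exists nonpos; split; [exact: measurable_nonpos|exact: Lam_nonpos|].
    move=> c /= h; apply: contrapT => nc; apply: h => _.
    have [N HN] := ptw c nc; apply: cvg_near_cst; exists N => // n /= Nn.
    by congr EFin; apply: eq_indic; exact: HN.
  have i1 : Lam.-integrable (strip M) (cst 1).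
    apply/integrableP; split => //; under eq_integral do rewrite abse1.
    by rewrite integral_cst// mul1e; exact: Lam_strip.
  have mi (Y : set (pt R)) : measurable Y -> measurable_fun (strip M) (fun c => (\1_Y c)%:E : \bar R).
    by move=> mY; apply/measurable_EFinP; exact: measurable_indic.
  have dom c n : strip M c -> `|(\1_(X n) c)%:E| <= cst 1 c :> \bar R.
    by move=> _; rewrite gee0_abs ?lee_fin// indicE lern1 leq_b1.
  by have [_ _] := dominated_convergence mD (fun n => mi _ (mX n)) (mi _ mr) ae1 i1 (aeW _ dom).
rewrite (_ : Lam (nn_region a b) = \int[Lam]_(c in strip M) (\1_(nn_region a b) c)%:E); last first.
  rewrite integral_indic// [LHS](measureDI _ mr mD) [X in X + _](_ : _ = 0) ?add0e//.
  apply/eqP; rewrite eq_le measure_ge0 andbT -Lam_nonpos; apply: le_measure.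
  - by apply: mem_set; exact: measurableD.
  - by apply: mem_set; exact: measurable_nonpos.
  - move=> c [rc nsc]; rewrite /nonpos/= leNgt; apply/negP => c0; apply: nsc.
    by apply: (@subset_strip _ M2) (H2 _ c0 rc); rewrite /M !leq_max leqnn !orbT.
apply: cvg_trans cv; apply: near_eq_cvg; exists N1 => // n /= Nn.
by rewrite integral_indic//= setIidl//; exact: XM.
Qed.

(** The value 0 on the diagonal matches [void_weight], where no cell is paired with itself. *)
Definition void_prob (ab : pt R * pt R) : \bar R :=
  if ab.1 == ab.2 then 0 else expeR (- Lam (nn_region ab.1 ab.2)).

Lemma void_prob_ge0 ab : 0 <= void_prob ab.
Proof. by rewrite /void_prob; case: ifPn => // _; exact: expeR_ge0. Qed.

Lemma measurable_Lam_nn_region :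
  measurable_fun setT (fun ab : pt R * pt R => Lam (nn_region ab.1 ab.2)).
Proof.
pose Y : set (pt R * pt R * pt R) := [set x | nn_region x.1.1 x.1.2 x.2].
have msub (f g : pt R * pt R * pt R -> R) : measurable_fun setT f -> measurable_fun setT g ->
  measurable_fun setT (fun x => (f x - g x) ^+ 2)%R.
  by move=> mf mg; apply: measurable_funX; exact: measurable_funB.
have m3 (u v : pt R * pt R * pt R -> pt R) : measurable_fun setT u -> measurable_fun setT v ->
  measurable_fun setT (fun x => sqdist3 (u x) (v x)).
  move=> mu mv; have c1 (u' : pt R * pt R * pt R -> pt R) : measurable_fun setT u' ->
      [/\ measurable_fun setT (fun x => (u' x).1.1), measurable_fun setT (fun x => (u' x).1.2) &
        measurable_fun setT (fun x => (u' x).2)].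
    move=> mu'; have m1 : measurable_fun setT (fun x => (u' x).1) by exact: measurableT_comp.
    by split; exact: measurableT_comp.
  have [u1 u2 u3] := c1 _ mu; have [v1 v2 v3] := c1 _ mv.
  by apply: measurable_funD; [apply: measurable_funD|]; exact: msub.
have mY : measurable Y.
  have p1 : measurable_fun setT (fun x : pt R * pt R * pt R => x.1.1) by exact: measurableT_comp.
  have p2 : measurable_fun setT (fun x : pt R * pt R * pt R => x.1.2) by exact: measurableT_comp.
  have p3 : measurable_fun setT (fun x : pt R * pt R * pt R => x.2) by exact: measurable_snd.
  have mh (u v : pt R * pt R * pt R -> pt R) : measurable_fun setT u -> measurable_fun setT v ->
      measurable [set x | (hdefect (u x) (v x) x.2 <= 0)%R].
    move=> mu mv; rewrite -[X in measurable X]setTI; apply: measurable_fun_ler => //.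
    by apply: measurable_funB; apply: measurable_funM; try exact: m3; exact: measurableT_comp.
  by apply: measurableU; exact: mh.
have := measurable_fun_xsection Lam mY.
apply: eq_measurable_fun => ab _ /=; congr (Lam _).
by apply/seteqP; split => c; rewrite xsectionE.
Qed.

Lemma measurable_expeRN dT (T : measurableType dT) (F : T -> \bar R) :
  (forall x, 0 <= F x) -> measurable_fun setT F -> measurable_fun setT (fun x => expeR (- F x)).
Proof.
move=> F0 mF.
rewrite (_ : (fun x => _) = (fun x => if F x == +oo then 0 else (expR (- fine (F x)))%:E)).
  apply: measurable_fun_ifT => //; first exact: measurable_fun_eqe.
  have mf : measurable_fun setT (fun x => fine (F x)).
    exact: measurableT_comp (fine_measurable measurableT) mF.
  have mN : measurable_fun setT (fun x => (- fine (F x))%R) by exact: measurableT_comp.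
  apply/measurable_EFinP.
  exact: measurableT_comp (continuous_measurable_fun (@continuous_expR R)) mN.
by apply/funext => x; have := F0 x; case: (F x) => [r||].
Qed.

Lemma measurable_void_prob : measurable_fun setT void_prob.
Proof.
apply: measurable_fun_ifT => //; last first.
  by apply: measurable_expeRN => //; exact: measurable_Lam_nn_region.
under eq_fun => ab do rewrite (surjective_pairing ab.1) (surjective_pairing ab.2) xpair_eqE
  (surjective_pairing ab.1.1) (surjective_pairing ab.2.1) xpair_eqE /=.
have mc (u v : pt R * pt R -> R) : measurable_fun setT u -> measurable_fun setT v ->
  measurable_fun setT (fun x => u x == v x) by exact: measurable_fun_eqr.
have m1 : measurable_fun setT (fun ab : pt R * pt R => ab.1.1) by exact: measurableT_comp.
have m2 : measurable_fun setT (fun ab : pt R * pt R => ab.2.1) by exact: measurableT_comp.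
by apply: measurable_and; [apply: measurable_and|]; apply: mc; exact: measurableT_comp.
Qed.

Lemma void_weight_cvg a b : (0 < a.2)%R -> (0 < b.2)%R ->
  void_weight Lam approx_region n (cell_index n a) (cell_index n b) @[n --> \oo] --> void_prob (a, b).
Proof.
move=> a0 b0; rewrite /void_prob/=; have [->|ab] := eqVneq a b.
  by apply: cvg_near_cst; apply: nearW => n; rewrite /void_weight eqxx.
have [N HN] := cell_index_neq (elimN eqP ab).
have cv := Lam_whole_cvg a0 b0; have Loo := nn_region_lty a0 b0.
have Lfin : Lam (nn_region a b) \is a fin_num by rewrite ge0_fin_numE.
move: cv; rewrite -{1}(fineK Lfin) => /fine_cvgP[fin cv].
have cv' : (expR (- fine (Lam (whole n (cell_index n a) (cell_index n b)))))%:E @[n --> \oo] -->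
    (expR (- fine (Lam (nn_region a b))))%:E.
  apply: cvg_EFin; first exact: nearW.
  apply: (@cvg_comp _ _ _ (fun n => - fine (Lam (whole n (cell_index n a) (cell_index n b))))%R expR).
    exact: (cvgN cv).
  exact: continuous_expR.
rewrite -[X in expeR (- X)](fineK Lfin) /=.
apply: cvg_trans cv'; apply: near_eq_cvg; near=> n.
have fn : Lam (whole n (cell_index n a) (cell_index n b)) \is a fin_num by near: n.
rewrite /void_weight ifF; first by rewrite -[in RHS](fineK fn).
by apply/eqP; apply: HN; near: n; exists N.
Unshelve. all: by end_near.
Qed.

Lemma mecke_nn B B' (M : nat) : measurable B -> measurable B' ->
  B `<=` strip M -> B' `<=` strip M ->
  measurable_fun setT (fun w => cnt [set ab | point_pairs Phi B B' w ab /\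
    Phi w `&` nn_region ab.1 ab.2 `<=` [set ab.1; ab.2]] : \bar R) /\
  \int[P]_w cnt [set ab | point_pairs Phi B B' w ab /\
    Phi w `&` nn_region ab.1 ab.2 `<=` [set ab.1; ab.2]] =
  \int[Lam]_(a in B) \int[Lam]_(b in B') void_prob (a, b).
Proof.
move=> mB mB' BM BM'.
have mpos : measurable (~` nonpos : set (pt R)) by apply: measurableC; exact: measurable_nonpos.
(* The limits above hold at positive marks. Discarding [nonpos] changes neither side: clean
   configurations avoid it, and its intensity is 0. *)
pose C := B `\` nonpos; pose C' := B' `\` nonpos.
have mC : measurable C by apply: measurableD => //; exact: measurable_nonpos.
have mC' : measurable C' by apply: measurableD => //; exact: measurable_nonpos.
have CM : C `<=` strip M by move=> c [/BM].
have CM' : C' `<=` strip M by move=> c [/BM'].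
have ppE w : point_pairs Phi B B' w = point_pairs Phi C C' w.
  have [ppos _] := Phi_clean w.
  apply/seteqP; split => ab [pa pb nab Ba Bb]; split => //; try by case: Ba; case: Bb.
    by split => //; apply/negP; rewrite -ltNge; exact: ppos.
  by split => //; apply/negP; rewrite -ltNge; exact: ppos.
have Cpos c : C c -> (0 < c.2)%R by move=> [_ /negP]; rewrite -ltNge.
have Cpos' c : C' c -> (0 < c.2)%R by move=> [_ /negP]; rewrite -ltNge.
under eq_fun do rewrite ppE.
split.
  apply: (@measurable_cnt_pairs _ _ _ P _ Lam pp Phi_clean C C' M mC mC' CM CM' approx_region
    (@measurable_approx_region R) (fun w a b => Phi w `&` nn_region a b `<=` [set a; b])).
  by move=> w a b pa pb _; exact: approx_region_config.
rewrite (@mecke_rectangle _ _ _ P _ Lam pp Phi_clean Lam_strip C C' M mC mC' CM CM' approx_region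
    (@measurable_approx_region R) (fun w a b => Phi w `&` nn_region a b `<=` [set a; b]) _
    void_prob measurable_void_prob void_prob_ge0); last 4 first.
- by move=> w a b pa pb _; exact: approx_region_config.
- by move=> a b /Cpos a0 /Cpos' b0; exact: void_weight_cvg.
- exact: (@measurable_point_pairs C C' M).
- apply: le_lt_trans (@integral_point_pairs_le C C' M mC mC' CM CM') _.
  have LM (D : set (pt R)) : measurable D -> D `<=` strip M -> Lam D < +oo.
    move=> mD DM; apply: le_lt_trans (Lam_strip M).
    by apply: le_measure => //; apply: mem_set => //; exact: measurable_strip.
  by rewrite lte_mul_pinfty// ?ge0_fin_numE// LM.
have mg a : measurable_fun setT (fun b => void_prob (a, b)).
  have m1 : measurable_fun setT (fun b : pt R => (a, b)) by exact: measurable_fun_pair.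
  exact: measurableT_comp measurable_void_prob m1.
have mnp := @measurable_nonpos R.
rewrite [RHS](ge0_negligible_integral mnp mB _ _ Lam_nonpos); last 2 first.
- apply: measurable_funTS.
  exact: (@measurable_integral_in _ _ _ _ _ Lam void_prob _ mB' measurable_void_prob void_prob_ge0).
- by move=> a _; apply: integral_ge0 => b _; exact: void_prob_ge0.
apply: eq_integral => a _.
rewrite [RHS](ge0_negligible_integral mnp mB' _ _ Lam_nonpos)//.
- exact: measurable_funTS (mg a).
- by move=> b _; exact: void_prob_ge0.
Qed.

End mecke_nn.

(** * Extension of the Mecke formula to measurable sets of pairs *)

Section mecke_measure.
Context {R : realType} (d : measure_display) (Omega : measurableType d).
Variables (P : probability Omega R) (Phi : Omega -> set (pt R)).
Variable Lam : {sigma_finite_measure set (pt R) -> \bar R}.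
Hypothesis pp : is_poisson_pp P Phi Lam.
Hypothesis Phi_clean : forall w, clean (Phi w).
Hypothesis Lam_strip : forall n, (Lam (strip n) < +oo)%E.
Hypothesis Lam_nonpos : Lam nonpos = 0%E.
Local Open Scope ereal_scope.
Implicit Types (G : set (pt R * pt R)).

Definition mutual_pairs w : set (pt R * pt R) := [set ab | [/\ Phi w ab.1, Phi w ab.2, ab.1 <> ab.2 &
  Phi w `&` nn_region ab.1 ab.2 `<=` [set ab.1; ab.2]]].

Definition npairs w G : \bar R := cnt (mutual_pairs w `&` G).

Let strip2 M : set (pt R * pt R) := strip M `*` strip M.

Let mstrip2 M : measurable (strip2 M). Proof. by apply: measurableX; exact: measurable_strip. Qed.

Lemma cnt_bigcup (T : choiceType) (S : set T) (F : (set T)^nat) : trivIset setT F ->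
  cnt (S `&` \bigcup_k F k) = \sum_(k <oo) cnt (S `&` F k) :> \bar R.
Proof.
move=> tF; rewrite setI_bigcupr /cnt esum_bigcupT//; last exact: trivIset_setIl.
by rewrite nneseries_esumT// => k; exact: cnt_ge0.
Qed.

Lemma cntID (T : choiceType) (A B : set T) :
  cnt A = cnt (A `&` B) + cnt (A `&` ~` B) :> \bar R.
Proof. by rewrite /cnt (esumID B). Qed.

Let fin_npairs w G M : npairs w (G `&` strip2 M) \is a fin_num.
Proof.
rewrite /npairs cnt_finite//; have [_ /(_ M) fM] := Phi_clean w.
apply: (@sub_finite_set _ _ ((Phi w `&` strip M) `*` (Phi w `&` strip M))).
  by move=> [a b] [[/= pa pb _ _] [_ [sa sb]]].
exact: finite_setX.
Qed.

Let npairs_rectangle w M A B : npairs w ((A `*` B) `&` strip2 M) =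
  cnt [set ab | point_pairs Phi (A `&` strip M) (B `&` strip M) w ab /\
    Phi w `&` nn_region ab.1 ab.2 `<=` [set ab.1; ab.2]].
Proof.
rewrite /npairs; congr cnt; apply/seteqP; split => ab.
  by move=> [[pa pb nab h] [[Aa Bb] [sa sb]]].
by move=> [[pa pb nab [Aa sa] [Bb sb]] h].
Qed.

(** Dynkin induction from rectangles. The complement step subtracts counts, which the intersection
    with [strip2 M] keeps finite. *)
Let measurable_npairs_strip M G : measurable G ->
  measurable_fun setT (fun w => npairs w (G `&` strip2 M)).
Proof.
pose Q G := measurable_fun setT (fun w => npairs w (G `&` strip2 M)).
have rect A B : measurable A -> measurable B -> Q (A `*` B).
  move=> mA mB; rewrite /Q; under eq_fun do rewrite npairs_rectangle.
  have mA' : measurable (A `&` strip M) by apply: measurableI => //; exact: measurable_strip.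
  have mB' : measurable (B `&` strip M) by apply: measurableI => //; exact: measurable_strip.
  exact: (mecke_nn pp Phi_clean Lam_strip Lam_nonpos mA' mB' (@subIsetr _ _ _) (@subIsetr _ _ _)).1.
move=> mG; apply: (@dynkin_induction _ _ [set A `*` B | A in measurable & B in measurable] Q).
- by rewrite measurable_prod_measurableType.
- move=> _ _ [A mA [B mB <-]] [A' mA' [B' mB' <-]]; exists (A `&` A'); first exact: measurableI.
  by exists (B `&` B'); [exact: measurableI|rewrite setXI].
- by rewrite -setXTT; exact: rect.
- by move=> _ [A mA [B mB <-]]; exact: rect.
- move=> S mS QS; rewrite /Q.
  rewrite (_ : (fun w => _) = (fun w => npairs w (setT `&` strip2 M) - npairs w (S `&` strip2 M))).
    apply: emeasurable_funB => //; rewrite -setXTT; exact: rect.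
  apply/funext => w; have fin := fin_npairs w S M; move: fin; rewrite /npairs => fin.
  rewrite (cntID (mutual_pairs w `&` (setT `&` strip2 M)) S).
  rewrite [X in X + _ + _](_ : _ = cnt (mutual_pairs w `&` (S `&` strip2 M))); last first.
    by congr cnt; apply/seteqP; split => x [] => [[? [? ?]] ?|? [? ?]].
  rewrite addeAC subee// add0e; congr cnt.
  by apply/seteqP; split => x /=; rewrite /setI /setC /setT /mkset; tauto.
- move=> F mF tF QF; rewrite /Q.
  rewrite (_ : (fun w => _) = (fun w => \sum_(k <oo) npairs w (F k `&` strip2 M))).
    apply: ge0_emeasurable_sum => [k w _ _|k _]; first exact: cnt_ge0.
    exact: QF.
  apply/funext => w; rewrite /npairs setI_bigcupl cnt_bigcup//.
  exact: trivIset_setIr.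
- by rewrite -measurable_prod_measurableType.
Qed.

Let layer M : set (pt R * pt R) := seqDU strip2 M.

Let mlayer M : measurable (layer M).
Proof. by apply: measurableD => //; exact: bigsetU_measurable. Qed.

Let layer_sub M : layer M `<=` strip2 M. Proof. exact: subset_seqDU. Qed.

Let bigcup_layer G : G = \bigcup_k (G `&` layer k).
Proof.
rewrite -setI_bigcupr -seqDU_bigcup_eq (_ : \bigcup_k _ = setT) ?setIT//.
rewrite -subTset => -[a b] _.
have [m _ am] : (\bigcup_n strip n) a by rewrite bigcup_strip.
have [n _ bn] : (\bigcup_n strip n) b by rewrite bigcup_strip.
exists (maxn m n) => //; split; first exact: subset_strip (leq_maxl m n) _ am.
exact: subset_strip (leq_maxr m n) _ bn.
Qed.

Let triv_layer G : trivIset setT (fun k => G `&` layer k).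
Proof. by apply: trivIset_setIl; exact: trivIset_seqDU. Qed.

Let npairs_layers w G : npairs w G = \sum_(k <oo) npairs w ((G `&` layer k) `&` strip2 k).
Proof.
rewrite /npairs [in LHS](bigcup_layer G) cnt_bigcup//; apply: eq_eseriesr => k _.
by congr cnt; rewrite -setIA (setIidl (@layer_sub k)).
Qed.

Lemma measurable_npairs G : measurable G -> measurable_fun setT (fun w => npairs w G).
Proof.
move=> mG; under eq_fun do rewrite npairs_layers.
apply: ge0_emeasurable_sum => [k w _ _|k _]; first exact: cnt_ge0.
by apply: measurable_npairs_strip; exact: measurableI.
Qed.

Let vp (ab : pt R * pt R) : R := fine (void_prob Lam ab).

Let vpE ab : (vp ab)%:E = void_prob Lam ab.
Proof.
rewrite fineK// /void_prob; case: ifPn => // _.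
rewrite ge0_fin_numE ?expeR_ge0//; apply: (@le_lt_trans _ _ 1); last exact: ltry.
by rewrite -expeR0 lee_expeR oppe_le0.
Qed.

Let vp0 ab : (0 <= vp ab)%R. Proof. by rewrite fine_ge0// void_prob_ge0. Qed.

Let mvp : measurable_fun setT vp.
Proof. exact: measurableT_comp (fine_measurable measurableT) (measurable_void_prob Lam). Qed.

Let kappa := density_measure (sfprod Lam Lam) mvp vp0.

Let kappaE G : kappa G = \int[sfprod Lam Lam]_(p in G) void_prob Lam p.
Proof. by apply: eq_integral => p _; rewrite vpE. Qed.

Section strip_measure.
Variable M : nat.

Definition mean_pairs G : \bar R := \int[P]_w npairs w (G `&` strip2 M).

Let mean_pairs0 : mean_pairs set0 = 0.
Proof. by apply: integral0_eq => w _; rewrite /npairs set0I setI0; exact/cnt_eq0. Qed.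

Let mean_pairs_ge0 G : 0 <= mean_pairs G.
Proof. by apply: integral_ge0 => w _; exact: cnt_ge0. Qed.

Let mean_pairs_sigma_additive : semi_sigma_additive mean_pairs.
Proof.
move=> F mF tF mUF.
have -> : mean_pairs (\bigcup_k F k) = \sum_(k <oo) mean_pairs (F k).
  rewrite /mean_pairs -integral_nneseries//; last 2 first.
  - by move=> k; exact: measurable_npairs_strip.
  - by move=> k w _; exact: cnt_ge0.
  apply: eq_integral => w _; rewrite /npairs setI_bigcupl cnt_bigcup//.
  exact: trivIset_setIr.
by apply: is_cvg_nneseries => k _ _; exact: mean_pairs_ge0.
Qed.

HB.instance Definition _ := isMeasure.Build _ _ _ mean_pairs
  mean_pairs0 mean_pairs_ge0 mean_pairs_sigma_additive.

(** Both sides are measures in [G] that agree on rectangles. Within a strip the total mass is finite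
    by [integral_point_pairs_le], which uniqueness requires. *)
Lemma mean_pairs_kappa G : measurable G -> mean_pairs G = kappa (G `&` strip2 M).
Proof.
pose m2 := mrestr kappa (mstrip2 M).
move=> mG; change (mean_pairs G = m2 G).
have rect A B : measurable A -> measurable B -> mean_pairs (A `*` B) = m2 (A `*` B).
  move=> mA mB; rewrite /m2 /mrestr kappaE /mean_pairs.
  under eq_integral do rewrite npairs_rectangle.
  have mA' : measurable (A `&` strip M) by apply: measurableI => //; exact: measurable_strip.
  have mB' : measurable (B `&` strip M) by apply: measurableI => //; exact: measurable_strip.
  rewrite (mecke_nn pp Phi_clean Lam_strip Lam_nonpos mA' mB' (@subIsetr _ _ _) (@subIsetr _ _ _)).2.
  rewrite /strip2 -setXI [RHS]integral_mkcond; apply: integral_prod_in => //.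
    exact: measurable_void_prob.
  by move=> x; exact: void_prob_ge0.
apply: (@measure_unique _ _ _ [set A `*` B | A in measurable & B in measurable] (fun=> setT)) => //.
- by rewrite measurable_prod_measurableType.
- move=> _ _ [A mA [B mB <-]] [A' mA' [B' mB' <-]]; exists (A `&` A'); first exact: measurableI.
  by exists (B `&` B'); [exact: measurableI|rewrite setXI].
- by move=> _; exists setT => //; exists setT => //; rewrite setXTT.
- by rewrite bigcup_const.
- by move=> _ [A mA [B mB <-]]; exact: rect.
- have mS : measurable (setT `&` strip M : set (pt R)) by apply: measurableI => //; exact: measurable_strip.
  have sS : setT `&` strip M `<=` (strip M : set (pt R)) by exact: subIsetr.
  move=> _; rewrite -setXTT /= /mean_pairs; under eq_integral do rewrite npairs_rectangle.
  apply: (@le_lt_trans _ _ (\int[P]_w cnt (point_pairs Phi (setT `&` strip M) (setT `&` strip M) w))).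
    apply: ge0_le_integral => //.
    - by move=> w _; exact: cnt_ge0.
    - exact: (mecke_nn pp Phi_clean Lam_strip Lam_nonpos mS mS sS sS).1.
    - exact: (measurable_point_pairs pp Phi_clean mS mS sS sS).
    - by move=> w _; apply: cnt_le => ab [].
  apply: le_lt_trans (integral_point_pairs_le pp Phi_clean Lam_strip mS mS sS sS) _.
  have LS : Lam (setT `&` strip M) < +oo by rewrite setTI.
  by rewrite lte_mul_pinfty// ge0_fin_numE.
Qed.
End strip_measure.

Lemma mecke G : measurable G ->
  \int[P]_w npairs w G = \int[sfprod Lam Lam]_(p in G) void_prob Lam p.
Proof.
move=> mG; rewrite -kappaE.
under eq_integral do rewrite npairs_layers.
rewrite integral_nneseries//; last 2 first.
- by move=> k; apply: measurable_npairs_strip; exact: measurableI.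
- by move=> k w _; exact: cnt_ge0.
rewrite [in RHS](bigcup_layer G) [RHS]measure_bigcup//; last by move=> k _; exact: measurableI.
rewrite [RHS](eq_eseriesl (Q := xpredT)); last by move=> k; rewrite in_setT.
apply: eq_eseriesr => k _.
rewrite -[LHS]/(mean_pairs k (G `&` layer k)) mean_pairs_kappa; last exact: measurableI.
by congr (kappa _); rewrite -setIA (setIidl (@layer_sub k)).
Qed.

End mecke_measure.

(** * The Palm integral *)

Section intensity_measure.
Context {R : realType}.
Local Notation mu := (@lebesgue_measure R).
Local Notation mu2 := (@leb2M R).
Variables (lam : R) (f : R -> R).
Hypotheses (lam0 : 0 < lam) (f0 : forall z, 0 < z -> 0 <= f z).
Hypothesis mf : measurable_fun (@pos R) f.
Hypothesis f1 : (\int[mu]_(z in @pos R) (f z)%:E = 1)%E.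
Local Open Scope ereal_scope.

Lemma measurable_pos : measurable (@pos R).
Proof. by rewrite -[X in measurable X]setTI; exact: measurable_fun_ltr. Qed.

Lemma fext_ge0 z : (0 <= fext f z)%R.
Proof. by rewrite /fext; case: ifPn => // z0; exact: f0. Qed.

Let fextE : fext f = f \_ (@pos R).
Proof.
apply/funext => z; rewrite /fext patchE.
case: ifPn => z0; first by rewrite mem_set.
by rewrite memNset//= /pos/=; exact/negP.
Qed.

Lemma measurable_fext : measurable_fun setT (fext f).
Proof. by rewrite fextE; exact: (measurable_restrictT f measurable_pos).1 mf. Qed.

Lemma integral_fext : \int[mu]_z (fext f z)%:E = 1.
Proof.
rewrite -f1 [RHS]integral_mkcond; apply: eq_integral => z _; rewrite fextE !patchE.
by case: ifPn.
Qed.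

Let phioo : \int[mu]_z (fext f z)%:E < +oo. Proof. by rewrite integral_fext ltry. Qed.

Let W := weight_measure measurable_fext fext_ge0.

Definition lam_nng : {nonneg R} := NngNum (ltW lam0).

Let mid : measurable_fun setT (fun p : measurableTypeR R * measurableTypeR R * measurableTypeR R => (p : pt R)).
Proof. by move=> _ Y mY; rewrite setTI. Qed.

(* The identity transports the measure from the Lebesgue-display product type to [pt R]. *)
Definition intens0 : {measure set (pt R) -> \bar R} :=
  measure_function_pushforward__canonical__measure_function_Measure (mscale lam_nng W) mid.

Definition intens : set (pt R) -> \bar R := intens0.

HB.instance Definition _ := Measure.on intens.

Lemma intensE B : intens B = intensity lam f B. Proof. by []. Qed.

Lemma weight_cylinder (A : set (R * R)) : measurable A ->
  weight (fext f) [set p | A p.1] = mu2 A.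
Proof.
move=> mA; rewrite weight_iter; [|exact: measurable_fext|exact: fext_ge0|]; last first.
  by rewrite -[X in measurable X]setTI; exact: measurable_fst.
transitivity (\int[mu]_z ((fext f z)%:E * mu2 A)).
  apply: eq_integral => z _; rewrite -ge0_integralZl_indic//; last exact: fext_ge0.
have mE : measurable_fun setT (fun z : R => (fext f z)%:E).
  by apply/measurable_EFinP; exact: measurable_fext.
have E0 z : 0 <= (fext f z)%:E by rewrite lee_fin fext_ge0.
by rewrite ge0_integralZr// integral_fext mul1e.
Qed.

Lemma intens_cylinder (A : set (R * R)) : measurable A ->
  intens [set p | A p.1] = lam%:E * mu2 A.
Proof. by move=> mA; rewrite -weight_cylinder. Qed.

Lemma intens_strip n : intens (strip n) < +oo.
Proof.
pose I : set R := [set x | (`|x| <= n%:R)%R].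
have -> : strip n = [set p : pt R | (I `*` I) p.1] by [].
have mI : measurable I.
  by rewrite -[X in measurable X]setTI; apply: measurable_fun_ler => //; exact: measurableT_comp.
rewrite intens_cylinder; last exact: measurableX.
have -> : mu2 (I `*` I) = mu I * mu I by exact: product_measure1E.
have : mu I < +oo.
  rewrite (_ : I = `[(- n%:R)%R, n%:R]%classic); last first.
    by apply/seteqP; split => x; rewrite /I/= in_itv/= ler_norml.
  by rewrite lebesgue_measure_itv/=; case: ifP; rewrite -?EFinB ltry.
move=> Ioo; rewrite lte_mul_pinfty//; first by rewrite lee_fin ltW.
by rewrite lte_mul_pinfty// ge0_fin_numE.
Qed.

Let intens_sigma_finite : sigma_finite setT intens.
Proof.
exists (fun n => strip n); first by rewrite bigcup_strip.
by move=> n; split; [exact: measurable_strip|exact: intens_strip].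
Qed.

HB.instance Definition _ := Measure_isSigmaFinite.Build _ _ _ intens intens_sigma_finite.

Lemma intens_nonpos : intens nonpos = 0.
Proof.
rewrite intensE /intensity integral0_eq ?mule0// => p; rewrite /nonpos/= => p0.
by rewrite /fext ltNge p0.
Qed.

Definition intensM : {sigma_finite_measure set (pt R) -> \bar R} := intens.

Lemma integral_intens (h : pt R -> \bar R) : measurable_fun setT h -> (forall p, 0 <= h p) ->
  \int[intensM]_p h p = lam%:E * \int[mu]_z \int[mu2]_q (h (q, z) * (fext f z)%:E).
Proof.
move=> mh h0.
transitivity (\int[mscale lam_nng W]_p h p).
  exact: (ge0_integral_pushforward mid).
rewrite ge0_integral_mscale//=; congr (_ * _).
transitivity (\int[sfprod mu2 mu]_p (h p * (fext f p.2)%:E)).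
  have msnd : measurable_fun setT (fun p : R * R * R => fext f p.2).
    exact: measurableT_comp measurable_fext measurable_snd.
  exact: (@ge0_integral_mdensity _ _ _ (sfprod mu2 mu) _ msnd (fun p => fext_ge0 p.2) h mh h0).
apply: (@fubini_tonelli2 _ _ _ _ _ mu2 mu (fun p => h p * (fext f p.2)%:E)).
- apply: emeasurable_funM => //; apply/measurable_EFinP.
  exact: measurableT_comp measurable_fext measurable_snd.
- by move=> p; rewrite mule_ge0// lee_fin fext_ge0.
Qed.

End intensity_measure.

Section palm_integral.
Context {R : realType}.
Local Notation mu := (@lebesgue_measure R).
Local Notation mu2 := (@leb2M R).
Variables (lam : R) (f : R -> R).
Hypotheses (lam0 : 0 < lam) (f0 : forall z, 0 < z -> 0 <= f z).
Hypothesis mf : measurable_fun (@pos R) f.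
Hypothesis f1 : (\int[mu]_(z in @pos R) (f z)%:E = 1)%E.
Variable D : set (R * R).
Hypotheses (mD : measurable D) (Dpos : D `<=` [set zz | 0 < zz.1 /\ 0 < zz.2]).
Local Open Scope ereal_scope.
Local Notation phi := (fext f).
Local Notation Lam := (intensM lam0 f0 mf f1).

Let mphi := measurable_fext mf.
Let phi0 := fext_ge0 f0.
Let phioo : \int[mu]_z (phi z)%:E < +oo. Proof. by rewrite integral_fext// ltry. Qed.

(** By [VE] this is [expR (- lam * Ffun f s z zt)] at positive arguments. It is used instead because
    its joint measurability comes from [void_prob], without any analysis of the nested integrals in
    [Ffun]. *)
Let V (s z zt : R) : \bar R := void_prob Lam (pt2 0 0 z, pt2 s 0 zt).

Let V0 s z zt : 0 <= V s z zt. Proof. exact: void_prob_ge0. Qed.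

Let mV : measurable_fun setT (fun x : R * (R * R) => V x.1 x.2.1 x.2.2).
Proof.
have m1 : measurable_fun setT (fun x : R * (R * R) => (pt2 0 0 x.2.1, pt2 x.1 0 x.2.2)).
  apply: measurable_fun_pair; apply: measurable_fun_pair => //.
  - exact: measurableT_comp.
  - exact: measurable_fun_pair.
  - exact: measurableT_comp.
exact: measurableT_comp (measurable_void_prob Lam) m1.
Qed.

Let LamE a b : Lam (nn_region a b) = lam%:E * weight phi (nn_region a b). Proof. by []. Qed.

Lemma void_probE (a b : pt R) : (0 < a.2)%R -> (0 < b.2)%R -> a.1 != b.1 ->
  void_prob Lam (a, b) = (expR (- lam * Ffun f (Num.sqrt (sqdist2 a.1 b.1)) a.2 b.2))%:E.
Proof.
move=> a0 b0 ab; rewrite /void_prob/= ifF; last first.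
  by apply/negbTE; apply: contra ab => /eqP ->.
by rewrite LamE (weight_nn_region mphi phi0 phioo)// -EFinM /= mulNr.
Qed.

Let VE s z zt : (0 < s)%R -> (0 < z)%R -> (0 < zt)%R ->
  V s z zt = (expR (- lam * Ffun f s z zt))%:E.
Proof.
move=> s0 z0 zt0.
have ne : (pt2 0 0 z).1 != (pt2 s 0 zt).1 by rewrite xpair_eqE negb_and lt_eqF.
have sE : Num.sqrt (sqdist2 (pt2 0 0 z).1 (pt2 s 0 zt).1) = s.
  have -> : sqdist2 (pt2 0 0 z).1 (pt2 s 0 zt).1 = (s ^+ 2)%R by rewrite /sqdist2 /pt2 /=; ring.
  by rewrite sqrtr_sqr gtr0_norm.
by have := @void_probE (pt2 0 0 z) (pt2 s 0 zt) z0 zt0 ne; rewrite sE.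
Qed.

Let J (zz : R * R) : \bar R := \int[mu]_(s in @pos R) (V s zz.1 zz.2 * s%:E).

Let Vs (x : R * (R * R)) : \bar R := V x.1 x.2.1 x.2.2 * (Num.max x.1 0)%:E.

Let Vs0 x : 0 <= Vs x. Proof. by rewrite mule_ge0// lee_fin le_max lexx orbT. Qed.

Let mVs : measurable_fun setT Vs.
Proof. by apply: emeasurable_funM => //; apply/measurable_EFinP; exact: measurable_maxr. Qed.

Let JE zz : J zz = \int[mu]_(s in @pos R) Vs (s, zz).
Proof.
apply: eq_integral => s /set_mem s0; rewrite /Vs /= max_l//; exact: ltW.
Qed.

Let J0 zz : 0 <= J zz. Proof. by rewrite JE; exact: integral_ge0. Qed.

Let mJ : measurable_fun setT J.
Proof.
have m1 : measurable_fun setT (fun x : (R * R) * R => Vs (x.2, x.1)).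
  have m2 : measurable_fun setT (fun x : (R * R) * R => (x.2, x.1)) by exact: measurable_fun_pair.
  exact: measurableT_comp mVs m2.
have := @measurable_integral_in _ _ _ _ _ mu (fun x : (R * R) * R => Vs (x.2, x.1)) _
  measurable_pos m1 (fun x => Vs0 _).
by apply: eq_measurable_fun => zz _; rewrite JE.
Qed.

Lemma sqdist2_gt0 (u v : R * R) : u != v -> (0 < sqdist2 u v)%R.
Proof.
move=> uv; rewrite lt_neqAle sqdist2_ge0 andbT eq_sym; apply: contra uv.
rewrite paddr_eq0 ?sqr_ge0// !sqrf_eq0 !subr_eq0 => /andP[/eqP h1 /eqP h2].
by rewrite (surjective_pairing u) h1 h2 -surjective_pairing.
Qed.

Lemma set1_plane (u : R * R) : [set u] = [set u.1] `*` [set u.2].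
Proof. by case: u => x y; apply/seteqP; split => [_ ->//|[x' y'] [/= -> ->]]. Qed.

Lemma measurable_set1_plane (u : R * R) : measurable [set u].
Proof. by rewrite set1_plane; apply: measurableX; exact: measurable_set1. Qed.

Lemma leb2M_set1 (u : R * R) : mu2 [set u] = 0.
Proof.
rewrite set1_plane.
have -> : mu2 ([set u.1] `*` [set u.2]) = mu [set u.1] * mu [set u.2] by exact: product_measure1E.
by rewrite lebesgue_measure_set1 mul0e.
Qed.

(** Except at [qb = qa], a null set, the integrand depends on [qa] and [qb] only through their
    distance. *)
Lemma integral_void_prob (qa : R * R) z zt : (0 < z)%R -> (0 < zt)%R ->
  \int[mu2]_qb void_prob Lam ((qa, z), (qb, zt)) = (2 * pi)%:E * J (z, zt).
Proof.
move=> z0 zt0.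
have mVz : measurable_fun setT (fun s => V s z zt).
  have m1 : measurable_fun setT (fun s : R => (s, (z, zt))) by exact: measurable_fun_pair.
  exact: measurableT_comp mV m1.
have mVn : measurable_fun setT (fun q : R * R => V (norm2 q) z zt).
  exact: measurableT_comp mVz measurable_norm2.
have mVq : measurable_fun setT (fun q : R * R => V (norm2 (q.1 - qa.1, q.2 - qa.2)%R) z zt).
  have m1 : measurable_fun setT (fun q : R * R => (q.1 - qa.1, q.2 - qa.2)%R).
    by apply: measurable_fun_pair; exact: measurable_funB.
  exact: measurableT_comp mVn m1.
transitivity (\int[mu2]_q V (norm2 (q.1 - qa.1, q.2 - qa.2)%R) z zt).
  apply: ge0_ae_eq_integral => //.
  - have m1 : measurable_fun setT (fun q : R * R => (((qa, z), (q, zt)) : pt R * pt R)).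
      by apply: measurable_fun_pair => //; exact: measurable_fun_pair.
    exact: measurableT_comp (measurable_void_prob Lam) m1.
  - by move=> q _; exact: void_prob_ge0.
  - exists [set qa]; split; [exact: measurable_set1_plane|exact: leb2M_set1|].
    move=> q /= h; apply: contrapT => /eqP qqa; apply: h => _.
    have s0 : (0 < Num.sqrt (sqdist2 qa q))%R by rewrite sqrtr_gt0 sqdist2_gt0// eq_sym.
    have nE : norm2 (q.1 - qa.1, q.2 - qa.2)%R = Num.sqrt (sqdist2 qa q).
      by rewrite /norm2 /sqdist2 /=; congr Num.sqrt; ring.
    rewrite nE (VE s0 z0 zt0).
    have qaq : ((qa, z) : pt R).1 != ((q, zt) : pt R).1 by rewrite eq_sym.
    exact: (@void_probE (qa, z) (q, zt) z0 zt0 qaq).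
transitivity (\int[mu2]_q V (norm2 q) z zt).
  rewrite -[RHS](@ge0_integral_shift2 _ (- qa.1, - qa.2)%R (fun q => V (norm2 q) z zt))//.
rewrite [LHS](@ge0_integral_radial _ (fun s => V s z zt))//; congr (_ * _).
rewrite /J/= -integral_itv_obnd_cbnd; last first.
  by apply: emeasurable_funM; apply: measurable_funTS => //; exact/measurable_EFinP.
by congr (integral _ _ _); apply/seteqP; split => x /=; rewrite in_itv/= andbT.
Qed.

Let w (zz : R * R) : R := (\1_D zz * phi zz.1 * phi zz.2)%R.

Let w0 zz : (0 <= w zz)%R. Proof. by rewrite !mulr_ge0. Qed.

Let mw : measurable_fun setT w.
Proof.
apply: measurable_funM; last exact: measurableT_comp.
by apply: measurable_funM; [exact: measurable_indic|exact: measurableT_comp].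
Qed.

Let mwE : measurable_fun setT (fun zz => (w zz)%:E). Proof. exact/measurable_EFinP. Qed.

Let Jw : \bar R := \int[mu2]_zz (J zz * (w zz)%:E).

(** [PD] integrates over the distance last; Tonelli brings that integral inside, where it forms
    [J]. *)
Lemma PD_palm : PD D lam f = (2 * pi * lam)%:E * Jw.
Proof.
rewrite /PD; congr (_ * _).
have mVw : measurable_fun setT (fun x : R * (R * R) => Vs x * (w x.2)%:E).
  by apply: emeasurable_funM => //; exact: measurableT_comp mwE measurable_snd.
have Vw0 x : 0 <= Vs x * (w x.2)%:E by rewrite mule_ge0// lee_fin.
transitivity (\int[mu]_(s in @pos R) \int[mu2]_zz (Vs (s, zz) * (w zz)%:E)).
  apply: eq_integral => s /set_mem s0.
  have mz : measurable_fun setT (fun zz : R * R => V s zz.1 zz.2 * (w zz)%:E).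
    apply: emeasurable_funM => //.
    have m1 : measurable_fun setT (fun zz : R * R => (s, zz)) by exact: measurable_fun_pair.
    exact: measurableT_comp mV m1.
  have z0 zz : 0 <= V s zz.1 zz.2 * (w zz)%:E by rewrite mule_ge0// lee_fin.
  transitivity ((\int[mu2]_zz (V s zz.1 zz.2 * (w zz)%:E)) * s%:E).
    congr (_ * _); rewrite [RHS](@fubini_tonelli1 _ _ _ _ _ mu mu _ mz z0).
    rewrite integral_mkcond; apply: eq_integral => z _; rewrite patchE /fubini_F /w /=.
    case: ifPn => zp; last first.
      rewrite integral0_eq// => zt _; rewrite /fext ifF ?mulr0 ?mul0r ?mule0//.
      by apply/negbTE; apply: contraNN zp => zp; rewrite mem_set.
    rewrite integral_mkcond; apply: eq_integral => zt _; rewrite patchE.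
    move: zp => /set_mem zp; case: ifPn => ztp; last first.
      rewrite /fext [X in (_ * _ * X)%R]ifF ?mulr0 ?mule0//.
      by apply/negbTE; apply: contraNN ztp => ztp; rewrite mem_set.
    move: ztp => /set_mem ztp; rewrite (VE s0 zp ztp) -EFinM /fext zp ztp.
    by rewrite !mulrA.
  rewrite -ge0_integralZr//; last by rewrite lee_fin ltW.
  by apply: eq_integral => zz _; rewrite /Vs /= max_l ?(ltW s0)// muleAC.
rewrite (@tonelli_in _ _ _ _ _ mu mu2 (fun x : R * (R * R) => Vs x * (w x.2)%:E) _ setT measurable_pos)//.
apply: eq_integral => zz _; rewrite JE.
have m1 : measurable_fun setT (fun s : R => (s, zz)) by exact: measurable_fun_pair.
have m2 : measurable_fun (@pos R) (fun s => Vs (s, zz)).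
  exact: measurable_funTS (measurableT_comp mVs m1).
have k0 : 0 <= (w zz)%:E by rewrite lee_fin.
rewrite -(@ge0_integralZr _ _ _ mu _ measurable_pos _ m2 _ _ k0)//.
Qed.

Definition palm_set (A : set (R * R)) : set (pt R * pt R) :=
  [set ab | A ab.1.1 /\ D (ab.1.2, ab.2.2)].

Lemma measurable_palm_set A : measurable A -> measurable (palm_set A).
Proof.
move=> mA; apply: measurableI; rewrite -[X in measurable X]setTI.
  have m1 : measurable_fun setT (fun ab : pt R * pt R => ab.1.1) by exact: measurableT_comp.
  exact: m1.
have m2 : measurable_fun setT (fun ab : pt R * pt R => (ab.1.2, ab.2.2)).
  by apply: measurable_fun_pair; exact: measurableT_comp.
exact: m2.
Qed.

(** The integral over the partner [b] gives [lam * 2 * pi] and no longer depends on the position of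
    [a]. The integral over [a] then gives the second [lam] and the area of [A], and [PD] absorbs
    [2 * pi * lam]. *)
Lemma integral_palm A : measurable A ->
  \int[sfprod Lam Lam]_(p in palm_set A) void_prob Lam p = PD D lam f * lam%:E * mu2 A.
Proof.
move=> mA; have mG := measurable_palm_set mA.
pose h (ab : pt R * pt R) : \bar R := void_prob Lam ab * (\1_(palm_set A) ab)%:E.
have h0 ab : 0 <= h ab by rewrite mule_ge0 ?void_prob_ge0// lee_fin.
have mh : measurable_fun setT h.
  apply: emeasurable_funM; first exact: measurable_void_prob.
  exact/measurable_EFinP/measurable_indic.
have mha a : measurable_fun setT (fun b => h (a, b)).
  have m1 : measurable_fun setT (fun b : pt R => (a, b)) by exact: measurable_fun_pair.
  exact: measurableT_comp mh m1.
have pi0 : (0 <= 2 * pi :> R)%R by rewrite mulr_ge0// pi_ge0.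
transitivity (\int[Lam]_a \int[Lam]_b h (a, b)).
  rewrite [LHS]integral_mkcond.
  transitivity (\int[sfprod Lam Lam]_p h p).
    apply: eq_integral => p _; rewrite patchE /h indicE.
    by case: ifPn => _; rewrite ?mule1 ?mule0.
  exact: (@fubini_tonelli1 _ _ _ _ _ Lam Lam h mh h0).
pose T z : \bar R := \int[mu]_zt (J (z, zt) * (\1_D (z, zt) * phi zt)%:E).
have T0 z : 0 <= T z.
  by apply: integral_ge0 => zt _; rewrite mule_ge0// lee_fin mulr_ge0.
have mTi : measurable_fun setT (fun x : R * R => J x * (\1_D x * phi x.2)%:E).
  apply: emeasurable_funM => //; apply/measurable_EFinP; apply: measurable_funM.
    exact: measurable_indic.
  exact: measurableT_comp.
have Ti0 x : 0 <= J x * (\1_D x * phi x.2)%:E by rewrite mule_ge0// lee_fin mulr_ge0.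
have mT : measurable_fun setT T.
  exact: (@measurable_integral_in _ _ _ _ _ mu (fun x : R * R => J x * (\1_D x * phi x.2)%:E)).
have c0 : 0 <= (lam * (2 * pi))%:E :> \bar R by rewrite lee_fin mulr_ge0// ltW.
have inner a : \int[Lam]_b h (a, b) = (lam * (2 * pi))%:E * ((\1_A a.1)%:E * T a.2).
  case: a => qa z; rewrite integral_intens//= EFinM -muleA; congr (_ * _).
  have m1 : measurable_fun setT (fun zt : R => (z, zt)) by exact: measurable_fun_pair.
  have mTz : measurable_fun setT (fun zt : R => J (z, zt) * (\1_D (z, zt) * phi zt)%:E).
    exact: (measurableT_comp mTi m1).
  have Tz0 zt : setT zt -> 0 <= J (z, zt) * (\1_D (z, zt) * phi zt)%:E by move=> _; exact: Ti0.
  have k0 : 0 <= (2 * pi)%:E * (\1_A qa)%:E :> \bar R by rewrite mule_ge0// lee_fin.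
  rewrite muleA /T -(@ge0_integralZl _ _ _ mu _ measurableT _ mTz _ Tz0 k0).
  apply: eq_integral => zt _.
  (* Membership in [D] supplies the positive marks that [integral_void_prob] requires; off [D] both
     sides vanish. *)
  have [Dz|nDz] := pselect (D (z, zt)).
    have [/= z0 zt0] := Dpos Dz.
    transitivity (\int[mu2]_q (void_prob Lam ((qa, z), (q, zt)) * (\1_A qa * phi zt)%:E)).
      apply: eq_integral => q _; rewrite /h -muleA -EFinM; congr (_ * (_ * _)%:E).
      by apply: eq_indic; rewrite /palm_set /=; split => [[]|].
    have mv : measurable_fun setT (fun q : R * R => void_prob Lam ((qa, z), (q, zt))).
      have m3 : measurable_fun setT (fun q : R * R => (((qa, z), (q, zt)) : pt R * pt R)).
        by apply: measurable_fun_pair => //; exact: measurable_fun_pair.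
      exact: measurableT_comp (measurable_void_prob Lam) m3.
    have k1 : 0 <= (\1_A qa * phi zt)%:E by rewrite lee_fin mulr_ge0.
    rewrite ge0_integralZr//; last by move=> q _; exact: void_prob_ge0.
    rewrite integral_void_prob// (indicE _ D) mem_set//= mul1r.
    by rewrite EFinM muleACA.
  rewrite (indicE _ D) memNset//= mul0r !mule0.
  apply: integral0_eq => q _; rewrite /h indicE memNset ?mule0 ?mul0e//.
  by move=> [].
under eq_integral do rewrite inner.
have mA1 : measurable_fun setT (fun q : R * R => (\1_A q)%:E : \bar R).
  exact/measurable_EFinP/measurable_indic.
have mTphi : measurable_fun setT (fun z => T z * (phi z)%:E).
  by apply: emeasurable_funM => //; exact/measurable_EFinP.
have Tphi0 z : 0 <= T z * (phi z)%:E by rewrite mule_ge0// lee_fin.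
rewrite integral_intens; last 2 first.
- apply: measurable_funeM; apply: emeasurable_funM.
    exact: (measurableT_comp mA1 measurable_fst).
  exact: (measurableT_comp mT measurable_snd).
- by move=> a; rewrite !mule_ge0// lee_fin.
have TJ : \int[mu]_z (T z * (phi z)%:E) = Jw.
  have m1 : measurable_fun setT (fun zz => J zz * (w zz)%:E) by exact: emeasurable_funM.
  have h1 zz : 0 <= J zz * (w zz)%:E by rewrite mule_ge0// lee_fin.
  rewrite [RHS](@fubini_tonelli1 _ _ _ _ _ mu mu _ m1 h1).
  apply: eq_integral => z _.
  have m2 : measurable_fun setT (fun zt : R => (z, zt)) by exact: measurable_fun_pair.
  have mTz : measurable_fun setT (fun zt : R => J (z, zt) * (\1_D (z, zt) * phi zt)%:E).
    exact: (measurableT_comp mTi m2).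
  have Tz0 zt : setT zt -> 0 <= J (z, zt) * (\1_D (z, zt) * phi zt)%:E by move=> _; exact: Ti0.
  have k0 : 0 <= (phi z)%:E by rewrite lee_fin.
  rewrite /fubini_F /T -(@ge0_integralZr _ _ _ mu _ measurableT _ mTz _ Tz0 k0).
  apply: eq_integral => zt _; rewrite -muleA -EFinM; congr (_ * _%:E).
  by rewrite /w/= mulrAC.
have cA0 : 0 <= (lam * (2 * pi))%:E * mu2 A by rewrite mule_ge0.
transitivity (lam%:E * \int[mu]_z (((lam * (2 * pi))%:E * mu2 A) * (T z * (phi z)%:E))).
  congr (_ * _); apply: eq_integral => z _ /=.
  have k0 : 0 <= (lam * (2 * pi))%:E * (T z * (phi z)%:E) by rewrite mule_ge0.
  transitivity (\int[mu2]_q ((\1_A q)%:E * ((lam * (2 * pi))%:E * (T z * (phi z)%:E)))).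
    by apply: eq_integral => q _; rewrite -!muleA muleCA.
  rewrite ge0_integralZr// integral_indic// setIT.
  by rewrite muleA; congr (_ * _); rewrite muleC.
rewrite ge0_integralZl// TJ PD_palm.
have -> : (lam * (2 * pi) = 2 * pi * lam)%R by ring.
by rewrite -!muleA muleCA [RHS]muleA [RHS]muleC -[RHS]muleA.
Qed.

End palm_integral.

(** * Mean numbers of paired and unpaired points *)

Section ge0_eq_integral_off_null.
Import HBNNSimple.
Local Open Scope ereal_scope.
Context (d : measure_display) (T : measurableType d) {R : realType}.
Variable m : {measure set T -> \bar R}.

Let le_off_null (f g : T -> \bar R) (N : set T) : measurable N -> m N = 0 ->
  (forall x, 0 <= f x) -> (forall x, 0 <= g x) -> (forall x, ~ N x -> f x = g x) ->
  \int[m]_x f x <= \int[m]_x g x.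
Proof.
move=> mN N0 f0 g0 fg; rewrite !ge0_integralTE//.
apply: ge_ereal_sup => _ [h /= hf <-].
(* Setting [h] to 0 on [N] keeps its integral and brings it below [g]. *)
pose k := proj_nnsfun h (measurableC mN).
have -> : sintegral m h = sintegral m k.
  rewrite -!integralT_nnsfun; apply: ge0_ae_eq_integral => //.
  - by apply/measurable_EFinP; exact: measurable_funP.
  - by apply/measurable_EFinP; exact: measurable_funP.
  - by move=> x _; rewrite lee_fin.
  - by move=> x _; rewrite lee_fin.
  - exists N; split=> // x /= hx; apply: contrapT => Nx; apply: hx => _.
    by rewrite /k /= mindicE mem_set ?mulr1.
apply: ereal_sup_ubound; exists k => //= x; rewrite mindicE.
have [Nx|Nx] := pselect (N x); first by rewrite memNset ?mulr0.
by rewrite mem_set// mulr1 -fg.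
Qed.

(* Measurability is not required because [integral] is a supremum over simple functions. *)
Lemma ge0_eq_integral_off_null (f g : T -> \bar R) (N : set T) : measurable N -> m N = 0 ->
  (forall x, 0 <= f x) -> (forall x, 0 <= g x) -> (forall x, ~ N x -> f x = g x) ->
  \int[m]_x f x = \int[m]_x g x.
Proof.
move=> mN N0 f0 g0 fg; apply/eqP; rewrite eq_le; apply/andP; split.
  exact: (le_off_null mN N0).
by apply: (le_off_null mN N0) => // x Nx; rewrite fg.
Qed.

End ge0_eq_integral_off_null.

Section mutual_nn.
Context {R : realType}.
Implicit Types (phi : set (pt R)) (a b : pt R).

(** A tie already destroys the strict inequality in [nn_to], which is why the region that must be
    empty is closed. *)
Lemma nn_to_mutualP phi a b : clean phi -> phi a -> phi b -> a <> b ->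
  nn_to phi a b /\ nn_to phi b a <-> phi `&` nn_region a b `<=` [set a; b].
Proof.
move=> [pos _] pa pb ab; split=> [[[_ [_ nab]] [_ [_ nba]]] c [pc nc]|sub].
  apply: contrapT => /= /not_orP[ca cb].
  move: (nab c pc ca cb) (nba c pc cb ca); rewrite !dH3_lt; try exact: pos.
  by move=> h1 h2; case: nc; rewrite leNgt ?h1 ?h2.
have out c : phi c -> c <> a -> c <> b -> 0 < hdefect a b c /\ 0 < hdefect b a c.
  move=> pc ca cb; have nc : ~ nn_region a b c by move=> nc; case: (sub c (conj pc nc)).
  by split; rewrite ltNge; apply/negP => h; apply: nc; [left|right].
split; split=> //; split=> //; try by move=> /esym.
  by move=> c pc ca cb; rewrite dH3_lt; try exact: pos; have [] := out c pc ca cb.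
by move=> c pc cb ca; rewrite dH3_lt; try exact: pos; have [] := out c pc ca cb.
Qed.

Context (d : measure_display) (Omega : measurableType d).
Variable Phi : Omega -> set (pt R).
Hypothesis Phi_clean : forall w, clean (Phi w).

(** Of two distinct partners of [a], each would be strictly closer to [a] than the other. *)
Lemma mutual_pairs_fst_inj w : set_inj (mutual_pairs Phi w) fst.
Proof.
move=> [a b] [a' b'] /set_mem[/= pa pb ab h] /set_mem[/= pa' pb' ab' h'] aa'; subst a'.
congr pair; apply: contrapT => bb'.
have o : 0 < hdefect a b b'.
  rewrite ltNge; apply/negP => le; have [] := h b'; first by split => //; left.
    by move=> e; apply: ab'.
  by move=> e; apply: bb'.
have o' : 0 < hdefect a b' b.
  rewrite ltNge; apply/negP => le; have [] := h' b; first by split => //; left.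
    by move=> e; apply: ab.
  by move=> e; apply: bb'.
by move: o o'; rewrite /hdefect; lra.
Qed.

Lemma count_Phi2 (D : set (R * R)) (A : set (R * R)) w :
  count (Phi2 D (Phi w)) [set a | A a.1] = npairs Phi w (palm_set D A).
Proof.
rewrite /npairs -(@cnt_image _ _ _ _ fst); last first.
  by move=> x y /set_mem[xm _] /set_mem[ym _]; apply: (@mutual_pairs_fst_inj w); exact: mem_set.
congr (esum _ _); apply/seteqP; split.
  move=> a [[pa [b [pb [ba [nab [nba Dab]]]]]] /= Aa].
  have ab : a <> b by move=> /esym.
  exists (a, b) => //; split=> //; split=> //=.
  by apply/(nn_to_mutualP (Phi_clean w) pa pb ab).
move=> _ [[a b] [[/= pa pb ab h] [/= Aa Dab]] <-]; split=> //; split=> //.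
have [nab nba] := (nn_to_mutualP (Phi_clean w) pa pb ab).2 h.
by exists b; do ! split => //; move=> /esym.
Qed.

End mutual_nn.

Section thinning.
Context {R : realType} (d : measure_display) (Omega : measurableType d).
Variables (P : probability Omega R) (Phi : Omega -> set (pt R)).
Variables (lam : R) (f : R -> R) (D : set (R * R)).
Hypotheses (lam0 : 0 < lam) (f0 : forall z, 0 < z -> 0 <= f z).
Hypothesis mf : measurable_fun (@pos R) f.
Hypothesis f1 : (\int[@lebesgue_measure R]_(z in @pos R) (f z)%:E = 1)%E.
Hypotheses (mD : measurable D) (Dpos : D `<=` [set zz | 0 < zz.1 /\ 0 < zz.2]).
Local Notation mu2 := (@leb2M R).
Local Notation Lam := (intensM lam0 f0 mf f1).
Hypothesis pp : is_poisson_pp P Phi Lam.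
Local Open Scope ereal_scope.

Let Lam_strip n : Lam (strip n) < +oo. Proof. exact: intens_strip. Qed.
Let Lam_nonpos : Lam nonpos = 0. Proof. exact: intens_nonpos. Qed.

Let Phi0 := clean_Phi Phi.
Let Phi0_clean w : clean (Phi0 w). Proof. exact: clean_clean_Phi. Qed.
Let pp0 : is_poisson_pp P Phi0 Lam. Proof. exact: (clean_poisson pp). Qed.

Let cylinder (A : set (R * R)) : set (pt R) := [set a | A a.1].

Let measurable_cylinder A : measurable A -> measurable (cylinder A).
Proof. by move=> mA; rewrite -[X in measurable X]setTI; exact: measurable_fst. Qed.

Let square n : set (R * R) := [set q | (`|q.1| <= n%:R)%R /\ (`|q.2| <= n%:R)%R].

Let measurable_square n : measurable (square n).
Proof.
by apply: measurableI; rewrite -[X in measurable X]setTI; apply: measurable_fun_ler => //;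
  exact: measurableT_comp.
Qed.

(** The exceptional event is null, but nothing controls [Phi] on it, so the integrand may fail to be
    measurable; hence the comparison by [ge0_eq_integral_off_null]. *)
Let clean_integral (F : set (pt R) -> \bar R) : (forall phi, 0 <= F phi) ->
  \int[P]_w F (Phi w) = \int[P]_w F (Phi0 w).
Proof.
move=> F0; have [N [mN N0 E]] := clean_Phi_off_null pp Lam_strip Lam_nonpos.
by apply: (ge0_eq_integral_off_null mN N0) => // w Nw; rewrite /Phi0 E.
Qed.

Let M2_clean A : M2 P Phi D A = \int[P]_w count (Phi2 D (Phi0 w)) (cylinder A).
Proof. by apply: (clean_integral (F := fun phi => count (Phi2 D phi) _)) => phi; exact: cnt_ge0. Qed.

Let M1_clean A : M1 P Phi D A = \int[P]_w count (Phi1 D (Phi0 w)) (cylinder A).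
Proof. by apply: (clean_integral (F := fun phi => count (Phi1 D phi) _)) => phi; exact: cnt_ge0. Qed.

Let measurable_count2 A : measurable A ->
  measurable_fun setT (fun w => count (Phi2 D (Phi0 w)) (cylinder A)).
Proof.
move=> mA; under eq_fun do rewrite (count_Phi2 Phi0_clean).
exact: (measurable_npairs pp0 Phi0_clean Lam_strip Lam_nonpos (measurable_palm_set mD mA)).
Qed.

Lemma M2E A : measurable A -> M2 P Phi D A = PD D lam f * lam%:E * mu2 A.
Proof.
move=> mA; rewrite M2_clean; under eq_integral do rewrite (count_Phi2 Phi0_clean).
rewrite (mecke pp0 Phi0_clean Lam_strip Lam_nonpos (measurable_palm_set mD mA)).
exact: integral_palm.
Qed.

Let Lam_cylinder A : measurable A -> Lam (cylinder A) = lam%:E * mu2 A.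
Proof. by move=> mA; exact: intens_cylinder. Qed.

Let Lam_cylinder_lty A n : measurable A -> A `<=` square n -> Lam (cylinder A) < +oo.
Proof.
move=> mA An; apply: le_lt_trans (Lam_strip n).
apply: le_measure.
- by apply: mem_set; exact: measurable_cylinder.
- by apply: mem_set; exact: measurable_strip.
- by move=> p /An.
Qed.

Let mean_count0 A n : measurable A -> A `<=` square n ->
  \int[P]_w count (Phi0 w) (cylinder A) = lam%:E * mu2 A.
Proof.
move=> mA An; rewrite -Lam_cylinder//.
exact: (mean_count pp0 (measurable_cylinder mA) (Lam_cylinder_lty mA An)).
Qed.

Let measurable_count0 A : measurable A ->
  measurable_fun setT (fun w => count (Phi0 w) (cylinder A)).
Proof. by move=> mA; case: pp0 => mc _ _ _; exact: mc (measurable_cylinder mA). Qed.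

Lemma PD_ge0 : 0 <= PD D lam f.
Proof.
apply: mule_ge0; first by rewrite lee_fin !mulr_ge0 ?pi_ge0// ltW.
apply: integral_ge0 => s s0; apply: mule_ge0; last by rewrite lee_fin ltW.
apply: integral_ge0 => z z0; apply: integral_ge0 => zt zt0.
by rewrite lee_fin !mulr_ge0 ?expR_ge0 ?f0.
Qed.

Lemma PD_le1 : PD D lam f <= 1.
Proof.
pose I := `[0%R, 1%R]%classic : set R.
have mI : measurable (I `*` I) by apply: measurableX; exact: measurable_itv.
have I1 : mu2 (I `*` I) = 1.
  have -> : mu2 (I `*` I) = @lebesgue_measure R I * @lebesgue_measure R I.
    by apply: product_measure1E; exact: measurable_itv.
  by rewrite lebesgue_measure_itv/= lte_fin ltr01 oppr0 adde0 mule1.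
have Is : I `*` I `<=` square 1.
  by move=> q [/=]; rewrite /I/= !in_itv/= => /andP[h1 h2] /andP[h3 h4]; split; rewrite ger0_norm.
have : M2 P Phi D (I `*` I) <= \int[P]_w count (Phi0 w) (cylinder (I `*` I)).
  rewrite M2_clean; apply: ge0_le_integral => //.
  - by move=> w _; exact: cnt_ge0.
  - exact: measurable_count2.
  - exact: measurable_count0.
  - by move=> w _; apply: cnt_le => a [[pa _] Aa].
rewrite M2E// (mean_count0 mI Is) I1 !mule1.
by rewrite -{2}[lam%:E]mul1e lee_pmul2r// lte_fin.
Qed.

Let count_split w A : count (Phi0 w) (cylinder A) =
  count (Phi1 D (Phi0 w)) (cylinder A) + count (Phi2 D (Phi0 w)) (cylinder A).
Proof.
rewrite [LHS](cntID (Phi0 w `&` cylinder A) (Phi2 D (Phi0 w))) addeC.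
rewrite -[RHS]/(cnt (Phi1 D (Phi0 w) `&` cylinder A) + cnt (Phi2 D (Phi0 w) `&` cylinder A)).
by congr (_ + _); congr cnt; apply/seteqP; split => a; rewrite /Phi1 /Phi2 /setI /setD /setC /mkset; tauto.
Qed.

Let count_fin A n w : A `<=` square n -> count (Phi0 w) (cylinder A) \is a fin_num.
Proof.
move=> An; rewrite [count _ _]cnt_finite//; have [_ fin] := Phi0_clean w.
by apply: sub_finite_set (fin n) => a [pa Aa]; split => //; exact: An.
Qed.

Let measurable_count1 A n : measurable A -> A `<=` square n ->
  measurable_fun setT (fun w => count (Phi1 D (Phi0 w)) (cylinder A)).
Proof.
move=> mA An.
rewrite (_ : (fun w => _) = (fun w => count (Phi0 w) (cylinder A) - count (Phi2 D (Phi0 w)) (cylinder A))).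
  by apply: emeasurable_funB; [exact: measurable_count0|exact: measurable_count2].
apply/funext => w; have := count_fin w An; rewrite count_split fin_numD => /andP[_ fin2].
by rewrite addeK.
Qed.

Let M1_square A n : measurable A -> A `<=` square n ->
  \int[P]_w count (Phi1 D (Phi0 w)) (cylinder A) = (1 - PD D lam f) * lam%:E * mu2 A.
Proof.
move=> mA An.
have c1 w : setT w -> 0 <= count (Phi1 D (Phi0 w)) (cylinder A) by move=> _; exact: cnt_ge0.
have c2 w : setT w -> 0 <= count (Phi2 D (Phi0 w)) (cylinder A) by move=> _; exact: cnt_ge0.
have : \int[P]_w count (Phi1 D (Phi0 w)) (cylinder A) + M2 P Phi D A = lam%:E * mu2 A.
  rewrite M2_clean -(mean_count0 mA An).
  rewrite -(ge0_integralD _ measurableT c1 (measurable_count1 mA An) c2 (measurable_count2 mA)).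
  by apply: eq_integral => w _; rewrite count_split.
have finA : lam%:E * mu2 A \is a fin_num.
  by rewrite ge0_fin_numE ?mule_ge0 ?lee_fin ?(ltW lam0)// -Lam_cylinder// (Lam_cylinder_lty mA An).
have finP : PD D lam f \is a fin_num.
  by rewrite ge0_fin_numE ?PD_ge0// (le_lt_trans PD_le1)// ltry.
rewrite M2E//; move: (PD D lam f) finP => p finP; rewrite -!muleA => E.
rewrite muleBl ?fin_num_adde_defr// mul1e -[X in _ = X - _]E addeK//.
by rewrite fin_numM.
Qed.

(** Subtracting [M2] from the total mean is meaningless when both are infinite. Cutting [A] into
    disjoint bounded layers confines the subtraction to finite values and leaves a series of
    nonnegative terms. *)
Lemma M1E A : measurable A -> M1 P Phi D A = (1 - PD D lam f) * lam%:E * mu2 A.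
Proof.
move=> mA; rewrite M1_clean.
pose layer k := A `&` seqDU square k.
have ml k : measurable (layer k).
  by apply: measurableI => //; apply: measurableD => //; exact: bigsetU_measurable.
have ls k : layer k `<=` square k by move=> x [_]; exact: subset_seqDU.
have tl : trivIset setT layer by apply: trivIset_setIl; exact: trivIset_seqDU.
have AE : A = \bigcup_k layer k.
  rewrite -setI_bigcupr -seqDU_bigcup_eq (_ : \bigcup_k _ = setT) ?setIT// -subTset => q _.
  have [n _ nq] : (\bigcup_n strip n) ((q, 0%R) : pt R) by rewrite bigcup_strip.
  by exists n.
have cE w : count (Phi1 D (Phi0 w)) (cylinder A) =
    \sum_(k <oo) count (Phi1 D (Phi0 w)) (cylinder (layer k)).
  rewrite -[RHS]/(\sum_(k <oo) cnt (Phi1 D (Phi0 w) `&` cylinder (layer k))) -cnt_bigcup; last first.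
    move=> i j _ _ [a [ai aj]]; apply: (tl i j I I); by exists a.1.
  by congr cnt; congr (_ `&` _); rewrite [in LHS]AE.
under eq_integral do rewrite cE.
rewrite integral_nneseries//; last 2 first.
- by move=> k; exact: measurable_count1 (ml k) (ls k).
- by move=> k w _; exact: cnt_ge0.
under eq_eseriesr do rewrite (M1_square (ml _) (ls _)).
have finP : PD D lam f \is a fin_num.
  by rewrite ge0_fin_numE ?PD_ge0// (le_lt_trans PD_le1)// ltry.
rewrite -(fineK finP) -EFinB -EFinM nneseriesZl//; congr (_ * _).
rewrite [in RHS]AE [RHS]measure_bigcup//; last by move=> k _; exact: ml.
by rewrite [RHS](eq_eseriesl (Q := xpredT))// => k; rewrite in_setT.
Qed.

End thinning.
Theorem theorem3 (R : realType) (d : measure_display) (Omega : measurableType d)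
  (P : probability Omega R) (Phi : Omega -> set (pt R))
  (lam : R) (f : R -> R) (D : set (R * R)) :
  0 < lam ->
  (* f is a probability density on (0, +oo) *)
  (forall z, 0 < z -> 0 <= f z) ->
  measurable_fun (@pos R) f ->
  (\int[@leb R]_(z in @pos R) (f z)%:E = 1)%E ->
  (* D is a symmetric Borel subset of (0,+oo)^2 *)
  measurable D ->
  D `<=` [set zz | 0 < zz.1 /\ 0 < zz.2] ->
  (forall z zt, D (z, zt) -> D (zt, z)) ->
  (* Phi is a Poisson point process on R^2 x (0,oo) with intensity lam dx dy f(z) dz *)
  is_poisson_pp P Phi (intensity lam f) ->
  ((0 <= PD D lam f)%E /\ (PD D lam f <= 1)%E) /\
  forall A : set (R * R), measurable A ->
    M2 P Phi D A = (PD D lam f * lam%:E * @leb2 R A)%E /\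
    M1 P Phi D A = ((1 - PD D lam f) * lam%:E * @leb2 R A)%E.
Proof.
move=> lam0 f0 mf f1 mD Dpos _ pp.
have pp' : is_poisson_pp P Phi (intensM lam0 f0 mf f1) by exact: pp.
split.
  by split; [exact: PD_ge0|exact: (PD_le1 mD Dpos pp')].
by move=> A mA; split; [exact: (M2E mD Dpos pp')|exact: (M1E mD Dpos pp')].
Qed.
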